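(* Let $P$ be a partial description of a polygon with $n$ vertices, of which at most $\log_3 n-\log_3\log_3 n-1$ vertices are specified. Then either $P$ has no realization, or $P$ is unbounded, i.e., there is no bounded region of the plane that contains all realizations of $P$.
   Context: A (simple) polygon is the closed region in the plane enclosed by a simple closed curve consisting of a finite number of line segments; these segments are its edges and their endpoints are its vertices (consecutive edges are allowed to be collinear, i.e. a vertex may have a straight angle). A polygon $Q$ with $n\ge 3$ vertices is represented by an array of points $Q[0],\ldots,Q[n-1]$, which are its vertices in counterclockwise order along its boundary. A partial description $P$ of a polygon with $n$ vertices is an array with $n$ entries, indexed $0,\ldots,n-1$, in which some entries are specified points of the plane and the remaining entries are unspecified. A realization of $P$ is a polygon $Q$ with $n$ vertices such that $Q[i]=P[i]$ for every index $i$ whose entry is specified. *)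

(* Defs.v *)
From HB Require Import structures.
From mathcomp Require Import all_boot all_order all_algebra.
From mathcomp Require Import all_classical all_reals all_analysis.

Set Implicit Arguments.
Unset Strict Implicit.
Unset Printing Implicit Defensive.

Import Order.TTheory GRing.Theory Num.Theory.
Import numFieldNormedType.Exports.

Local Open Scope classical_set_scope.
Local Open Scope ring_scope.

Definition log3 (R : realType) (x : R) : R := ln x / ln 3.

Section Polygons.
Variables (R : realType) (n : nat).
Implicit Types (Q : 'I_n -> R * R) (P : 'I_n -> option (R * R)).

(* [ordS] is the cyclic successor on 'I_n, so edge n.-1 ends at Q[0]. *)
Definition edge_vec Q (i : 'I_n) : R * R := Q (ordS i) - Q i.

Definition edge_pt Q (i : 'I_n) (t : R) : R * R := Q i + t *: edge_vec Q i.

Definition boundary Q : set (R * R) :=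
  [set x | exists i t, 0 <= t <= 1 /\ x = edge_pt Q i t].

(* The closed curve is simple: its parametrization by the pairs (i, t) with
   0 <= t < 1 is injective. In particular edges are nondegenerate; a straight
   angle at a vertex is allowed, but not a fold-back. *)
Definition simple_closed Q : Prop :=
  forall (i j : 'I_n) (s t : R), 0 <= s < 1 -> 0 <= t < 1 ->
    edge_pt Q i s = edge_pt Q j t -> i = j /\ s = t.

(* Union of the bounded components of the complement of the curve. *)
Definition enclosed Q : set (R * R) :=
  [set x | ~ boundary Q x /\
           bounded_set (connected_component (~` boundary Q) x)].

Definition region Q : set (R * R) := boundary Q `|` enclosed Q.

(* The vector d rotated by a quarter turn to the left. *)
Definition left_normal (d : R * R) : R * R := (- d.2, d.1).

(* Traversing the boundary in the order of the indices, the enclosed open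
   region lies immediately to the left of every edge. *)
Definition counterclockwise Q : Prop :=
  forall (i : 'I_n) (t : R), 0 < t < 1 ->
    \forall e \near (0 : R)^'+,
      enclosed Q (edge_pt Q i t + e *: left_normal (edge_vec Q i)).

Definition is_polygon Q : Prop :=
  [/\ (3 <= n)%N, simple_closed Q & counterclockwise Q].

(* [None] stands for an unspecified entry. *)
Definition realization P Q : Prop :=
  is_polygon Q /\ forall (i : 'I_n) (p : R * R), P i = Some p -> Q i = p.

Definition num_specified P : nat := #|[pred i : 'I_n | P i != None]|.

Definition unbounded_description P : Prop :=
  ~ exists B : set (R * R), bounded_set B /\
      forall Q, realization P Q -> region Q `<=` B.

End Polygons.

(* Main.v *)
(* The specified vertices cut the boundary of a realization into blocks separated by gaps, the
   runs of unspecified vertices. As there are few specified vertices, there is a threshold such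
   that the gaps above it, taken in increasing order, have lengths growing faster than a
   doubling bound. Erase these gaps and keep the arcs of the realization between them.
   Redraw the gaps from the shortest to the longest: two consecutive arcs are joined by a path
   that avoids all arcs and whose number of vertices is linear in the total size of the arcs,
   since a path crossing an arc can be replaced by a detour along the arc.
   Hence the total size at most doubles with each gap. The longest gap, drawn last, has room for
   a path that climbs from the end of the remaining arc to a point of arbitrary height, goes up
   vertically, turns to the left and runs back to the start of the arc along its left side.
   Near this highest turn the winding number is nonzero on the left of the boundary, so the
   polygon is traversed counterclockwise. *)

Require Import Defs.
From mathcomp Require Import all_boot all_order all_algebra.
From mathcomp Require Import all_classical all_reals all_analysis.
From mathcomp Require Import ring lra zify.

Set Implicit Arguments.
Unset Strict Implicit.
Unset Printing Implicit Defensive.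

Import Order.TTheory GRing.Theory Num.Theory.
Import numFieldNormedType.Exports.

Local Open Scope classical_set_scope.
Local Open Scope ring_scope.

(** * Segments and polylines *)

Section Segments.
Variable R : realType.
Notation pt := (R * R)%type.
Implicit Types (a b c u v w z : pt) (s t d : R) (G O C : set pt) (l : seq pt).

(** A gap that is too short to be redrawn has to be kept, which lengthens the arcs and raises the
    demand on all other gaps. Giving up [j] gaps multiplies the load by at most
    [1 + j * 2^(j-1) <= (5/2)^j]. So if no threshold works, [n] is at most [(5/2)^(k+1) * (3k+1)]
    for [k] specified vertices. The hypothesis means [n >= 3^(k+1) * log3 n], which is larger as
    soon as [k > 2]; small [k] need numerical arguments. The number of vertices in each gap is
    prescribed exactly, so short paths are padded with straight-angle vertices. Padding must not
    count as complexity for later paths; therefore each arc carries a reduced version with the same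
    support. The region is defined by components of the complement, which seems to call for the
    Jordan curve theorem. It is avoided: [counterclockwise] only asks that the points just to the
    left of the edges lie in bounded components, and for this a nonzero winding number suffices,
    since it is locally constant off the boundary and vanishes far away. *)

Definition ev (P : R -> Prop) : Prop :=
  exists e : R, 0 < e /\ forall d : R, 0 < d < e -> P d.

Lemma ev_mono (P P' : R -> Prop) : (forall d, 0 < d -> P d -> P' d) -> ev P -> ev P'.
Proof.
move=> H [e [e0 He]]; exists e; split=> // d /[dup] /He Pd /andP[d0 _].
exact: H.
Qed.

(** Finitely many smallness conditions can thus be met by one parameter; all perturbation and
    general-position choices below are made in this way. *)
Lemma ev_and (P P' : R -> Prop) : ev P -> ev P' -> ev (fun d => P d /\ P' d).
Proof.
move=> [e [e0 He]] [f [f0 Hf]]; exists (Num.min e f); split.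
  by rewrite lt_min e0.
move=> d /andP[d0]; rewrite lt_min => /andP[de df].
by split; [apply: He|apply: Hf]; rewrite d0.
Qed.

Lemma ev_ex (P : R -> Prop) : ev P -> exists2 d, 0 < d & P d.
Proof.
move=> [e [e0 He]]; exists (e / 2); first by lra.
apply: He; lra.
Qed.

Lemma evT (P : R -> Prop) : (forall d, 0 < d -> P d) -> ev P.
Proof. by move=> H; exists 1; split=> // d /andP[d0 _]; exact: H. Qed.

Lemma ev_lt s : 0 < s -> ev (fun d => d < s).
Proof. by move=> s0; exists s; split=> // d /andP[]. Qed.

Lemma ev_affine (s t : R) : 0 < s -> ev (fun d => 0 < s + d * t).
Proof.
move=> s0; exists (s / (`|t| + 1)); split.
  by rewrite divr_gt0 //; have := normr_ge0 t; lra.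
move=> d /andP[d0]; rewrite ltr_pdivlMr; last by have := normr_ge0 t; lra.
move=> ds; have : - `|t| <= t by rewrite lerNl -normrN ler_norm.
by rewrite -(ler_pM2l d0) mulrN; rewrite mulrDr mulr1 in ds; lra.
Qed.

Lemma ev_affine_neq0 (s t : R) : s != 0 \/ t != 0 -> ev (fun d => s + d * t != 0).
Proof.
case: (ltrgtP s 0) => [s0|s0|->] H.
- have := @ev_affine (- s) (- t); rewrite oppr_gt0 => /(_ s0); apply: ev_mono => d _.
  by rewrite mulrN -opprD oppr_gt0 => ?; rewrite lt_eqF.
- by apply: ev_mono (@ev_affine s t s0) => d _ ?; rewrite gt_eqF.
- case: H => [/eqP//|t0].
  by apply: evT => d d0; rewrite add0r mulf_neq0 // gt_eqF.
Qed.

Lemma ev_all (T : eqType) (r : seq T) (P : T -> R -> Prop) :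
  (forall x, x \in r -> ev (P x)) -> ev (fun d => forall x, x \in r -> P x d).
Proof.
elim: r => [_|x r IH H]; first exact: evT.
have Hx := H x (mem_head _ _).
have Hr : ev (fun d => forall y, y \in r -> P y d).
  by apply: IH => y yr; apply: H; rewrite inE yr orbT.
apply: ev_mono (ev_and Hx Hr) => d _ [Px Pr] y; rewrite inE.
by move=> /predU1P[->|/Pr].
Qed.

Lemma ptP a b : a.1 = b.1 -> a.2 = b.2 -> a = b.
Proof. by case: a b => [? ?] [? ?] /= -> ->. Qed.

Definition lp a b t : pt := a + t *: (b - a).

Definition seg a b : set pt := [set z | exists2 t, 0 <= t <= 1 & z = lp a b t].

Lemma segP a b z : seg a b z <->
  exists t, [/\ 0 <= t <= 1, z.1 = a.1 + t * (b.1 - a.1) & z.2 = a.2 + t * (b.2 - a.2)].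
Proof.
split=> [[t t01 ->]|[t [t01 e1 e2]]]; first by exists t.
by exists t => //; exact: ptP.
Qed.

Lemma seg_sym a b : seg a b = seg b a.
Proof.
rewrite predeqE => z; split=> /segP [t [t01 e1 e2]]; apply/segP;
  exists (1 - t); (split; [lra| |]); rewrite ?e1 ?e2 /=; ring.
Qed.

Lemma lpE1 a b t : (lp a b t).1 = a.1 + t * (b.1 - a.1). Proof. by []. Qed.
Lemma lpE2 a b t : (lp a b t).2 = a.2 + t * (b.2 - a.2). Proof. by []. Qed.

Lemma lp0 a b : lp a b 0 = a. Proof. by rewrite /lp scale0r addr0. Qed.
Lemma lp1 a b : lp a b 1 = b. Proof. by rewrite /lp scale1r addrC subrK. Qed.

Lemma seg_l a b : seg a b a.
Proof. by exists 0; rewrite ?lp0 // lexx ler01. Qed.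
Lemma seg_r a b : seg a b b.
Proof. by exists 1; rewrite ?lp1 // lexx ler01. Qed.

Definition cross a b : R := a.1 * b.2 - a.2 * b.1.

Lemma lp_continuous (f g : R * R -> pt) (h : R * R -> R) :
  continuous f -> continuous g -> continuous h ->
  continuous (fun x => lp (f x) (g x) (h x)).
Proof.
move=> cf cg ch x; rewrite /lp.
apply: cvgD; first exact: cf.
apply: cvgZ; first exact: ch.
by apply: cvgB; [exact: cg|exact: cf].
Qed.

(** Tube lemma: each [(t, 0)] with [t] in the compact interval [[0, 1]] has a neighbourhood that is
    mapped outside [G], and [compact_near_coveringP] turns these into a single bound on [d]. *)
Lemma near_seg G a b u w : closed G -> (forall z, seg a b z -> ~ G z) ->
  ev (fun d => forall z, seg (a + d *: u) (b + d *: w) z -> ~ G z).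
Proof.
move=> cG aG.
pose f (x : R * R) : pt := lp (a + x.2 *: u) (b + x.2 *: w) x.1.
have cf : continuous f.
  apply: (@lp_continuous (fun x => a + x.2 *: u) (fun x => b + x.2 *: w) fst).
  - move=> x; apply: cvgD; first exact: cvg_cst.
    by apply: cvgZr_tmp; exact: cvg_snd.
  - move=> x; apply: cvgD; first exact: cvg_cst.
    by apply: cvgZr_tmp; exact: cvg_snd.
  - by move=> x; exact: cvg_fst.
have /compact_near_coveringP/(_ R (nbhs (0:R)) (fun d t => ~ G (f (t, d)))) := @segment_compact R 0 1.
case.
  move=> t /=; rewrite in_itv /= => t01.
  have oG : open (f @^-1` (~` G)).
    by apply: open_comp; [move=> ? _; exact: cf | exact: closed_openC].
  have : nbhs (t, 0) (f @^-1` (~` G)).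
    apply: open_nbhs_nbhs; split=> //=.
    apply: aG; exists t => //; rewrite /f /=; congr lp; by rewrite scale0r addr0.
  move=> [[A B] /= [At B0] AB].
  by exists (A, B) => //= -[t' d'] /= [? ?]; apply: AB.
move=> e /= e0 He; exists e; split=> // d /andP[d0 de] z [t t01 ->].
apply: (He d) => /=; last by rewrite in_itv.
by rewrite /ball /= sub0r normrN gtr0_norm.
Qed.

Lemma seg_compact a b : compact (seg a b).
Proof.
have -> : seg a b = lp a b @` `[0, 1].
  rewrite predeqE => z; split.
    by move=> [t t01 ->]; exists t => //=; rewrite in_itv.
  by move=> [t /=]; rewrite in_itv /= => ? <-; exists t.
apply: continuous_compact; last exact: segment_compact.
apply: continuous_subspaceT => x.
apply: cvgD; first exact: cvg_cst.
by apply: cvgZr_tmp; exact: cvg_id.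
Qed.

Lemma seg_closed a b : closed (seg a b).
Proof. by apply: compact_closed; [exact: norm_hausdorff|exact: seg_compact]. Qed.

Lemma set1_closed a : closed [set a].
Proof. by apply: compact_closed; [exact: norm_hausdorff|exact: compact_set1]. Qed.

Lemma first_hit C a b : closed C -> (exists2 z, seg a b z & C z) ->
  exists t, [/\ 0 <= t <= 1, C (lp a b t) & forall s, 0 <= s < t -> ~ C (lp a b s)].
Proof.
move=> cC [z [t0 t01 ez] Cz].
pose T := `[0, 1]%classic `&` lp a b @^-1` C.
have clp : continuous (lp a b).
  move=> x; apply: cvgD; first exact: cvg_cst.
  by apply: cvgZr_tmp; exact: cvg_id.
have cT : compact T.
  apply: compact_closedI; first exact: segment_compact.
  by apply: preimage_closed => // x _; exact: clp.
have T0 : T !=set0 by exists t0; split; rewrite /= ?in_itv //= -ez.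
have [t + mint] := compact_EVT_min T0 cT (continuous_subspaceT (fun x => @cvg_id _ (nbhs x))).
rewrite inE => -[/=]; rewrite in_itv /= => t01' Ct.
exists t; split=> // s /andP[s0 st] Cs.
have : s \in T by rewrite inE; split; rewrite /= ?in_itv //=; apply/andP; split=> //; lra.
by move=> /mint; rewrite leNgt st.
Qed.
End Segments.

Section Polylines.
Variable R : realType.
Notation pt := (R * R)%type.
Implicit Types (a b c u v w x y z : pt) (s t d : R) (G O C : set pt) (l : seq pt).

(** A one-point list has nonempty support, so a polyline can be cut at a vertex shared by both
    pieces even if a piece is trivial. *)
Fixpoint supp l : set pt :=
  if l is x :: l' then (if l' is y :: _ then seg x y `|` supp l' else [set x])
  else set0.

(** Letting the first edge meet the rest only in their common vertex excludes fold-backs but permits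
    straight angles. *)
Fixpoint simple l : Prop :=
  if l is x :: l' then
    (if l' is y :: _ then
       [/\ x <> y, (forall z, seg x y z -> supp l' z -> z = y) & simple l']
     else True)
  else True.

Lemma supp_head x l : supp (x :: l) x.
Proof. by case: l => [//|y l]; left; exact: seg_l. Qed.

Lemma supp_mem x l : x \in l -> supp l x.
Proof.
elim: l => // y [|y' l] IH; first by rewrite inE => /eqP ->.
rewrite inE => /predU1P[->|/IH]; first exact: supp_head.
by right.
Qed.

Lemma supp_closed l : closed (supp l).
Proof.
elim: l => [|x [|y l] IH]; first exact: closed0.
  exact: set1_closed.
by apply: closedU => //; exact: seg_closed.
Qed.

Lemma supp_cons x y l z : supp (x :: y :: l) z <-> seg x y z \/ supp (y :: l) z.
Proof. by []. Qed.

Lemma supp_catP l1 x l2 z :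
  supp (l1 ++ x :: l2) z <-> supp (rcons l1 x) z \/ supp (x :: l2) z.
Proof.
elim: l1 => [|a [|b l1] IH].
- by split; [right|move=> [->|//]; exact: supp_head].
- rewrite [rcons _ _]/= [_ ++ _]/= !supp_cons; split=> [[|]|[[|->]|]]; try tauto.
  by right; exact: supp_head.
- rewrite [rcons _ _]/= [_ ++ _]/= !supp_cons; rewrite /= in IH; tauto.
Qed.

Lemma supp_rcons2 l x y z :
  supp (rcons (rcons l x) y) z <-> supp (rcons l x) z \/ seg x y z.
Proof.
rewrite -[rcons _ y]cats1 cat_rcons supp_catP supp_cons.
have : supp [:: y] z -> seg x y z by move=> ->; exact: seg_r.
tauto.
Qed.

Lemma supp_rev l z : supp (rev l) z <-> supp l z.
Proof.
elim: l => [//|x [//|y l] IH].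
rewrite rev_cons [X in rcons X _]rev_cons supp_rcons2 supp_cons -rev_cons IH seg_sym.
tauto.
Qed.

Lemma supp_cat l1 l2 z : supp l1 z \/ supp l2 z -> supp (l1 ++ l2) z.
Proof.
case: l2 => [|x l2]; first by rewrite cats0 => -[].
move=> H; apply/supp_catP; case: H; last by right.
case/lastP: l1 => // l1 y H; left; apply/supp_rcons2; by left.
Qed.

Lemma simple_catP l1 x l2 : simple (l1 ++ x :: l2) <->
  [/\ simple (rcons l1 x), simple (x :: l2) &
      forall z, supp (rcons l1 x) z -> supp (x :: l2) z -> z = x].
Proof.
elim: l1 => [|a [|b l1] IH]; first by split=> [H|[]//]; split=> // z ->.
- split=> [[ax H1 H2]|[[ax _ _] H2 H3]].
    by split=> // z [Hz|->] // Hz'; exact: H1.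
  by split=> // z Hz Hz'; apply: H3 => //; left.
- split=> [[ab H1 /IH [H2 H3 H4]]|[[ab H1 H2] H3 H4]].
    split=> //.
      split=> // z Hz H; apply: H1 => //.
      by apply/(supp_catP (b :: l1)); left.
    move=> z /supp_cons [Hz|]; last exact: H4.
    move=> Hz'; have zb : z = b by apply: H1 => //; apply/(supp_catP (b :: l1)); right.
    by apply: H4 => //; rewrite zb; exact: supp_head.
  split=> //.
    move=> z Hz /(supp_catP (b :: l1)) [/H1|Hz']; first exact.
    have zx : z = x by apply: H4 => //; left.
    apply: H1 => //; rewrite zx -/(rcons (b :: l1) x); apply: supp_mem.
    by rewrite mem_rcons mem_head.
  apply/IH; split=> // z Hz; apply: H4; by right.
Qed.

Lemma simple_rcons2 l x y : simple (rcons (rcons l x) y) <->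
  [/\ simple (rcons l x), x <> y & forall z, supp (rcons l x) z -> seg x y z -> z = x].
Proof.
rewrite -[rcons _ y]cats1 cat_rcons simple_catP; split=> -[H1 H2 H3]; split=> //.
- by case: H2.
- by move=> z Hz Hz'; apply: H3 => //; left.
- by move=> z Hz [Hz'|e]; apply: H3 => //; rewrite (e : z = y); exact: seg_r.
Qed.

Lemma simple_rev l : simple (rev l) <-> simple l.
Proof.
elim: l => [//|x [//|y l] IH].
rewrite rev_cons [X in rcons X _]rev_cons simple_rcons2 -rev_cons.
split=> -[H1 H2 H3].
  split; [by move=> e; apply: H2| |exact/IH].
  by move=> z Hz Hz'; apply: H3; [apply/supp_rev|rewrite seg_sym].
split; [exact/IH|by move=> e; apply: H1|].
by move=> z /supp_rev Hz; rewrite seg_sym => Hz'; exact: H2.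
Qed.

Lemma simple_suffix l1 l2 : simple (l1 ++ l2) -> simple l2.
Proof. by case: l2 => // x l2 /simple_catP[]. Qed.

Lemma simple_prefix l1 l2 : simple (l1 ++ l2) -> simple l1.
Proof.
rewrite -(simple_rev (_ ++ _)) rev_cat => /simple_suffix.
by rewrite simple_rev.
Qed.

(** A common point would have to equal both ends of the edge that separates the two pieces. *)
Lemma simple_disj l1 x y l2 z : simple (l1 ++ x :: y :: l2) ->
  supp (rcons l1 x) z -> supp (y :: l2) z -> False.
Proof.
move=> /simple_catP [_ [xy H1 _] H2] Hz Hz'.
have zx : z = x by apply: H2 => //; right.
by apply: xy; rewrite -zx; apply: H1 => //; rewrite zx; exact: seg_l.
Qed.

Lemma simple_edge_l l1 x y l2 z : simple (l1 ++ x :: y :: l2) ->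
  supp (rcons l1 x) z -> seg x y z -> z = x.
Proof. by move=> /simple_catP [_ _ H] Hz Hz'; apply: H => //; left. Qed.

Lemma simple_edge_r l1 x y l2 z : simple (l1 ++ x :: y :: l2) ->
  seg x y z -> supp (y :: l2) z -> z = y.
Proof. by move=> /simple_suffix [_ H _]; exact: H. Qed.

Lemma simple_neq l1 x y l2 : simple (l1 ++ x :: y :: l2) -> x <> y.
Proof. by move=> /simple_suffix []. Qed.

Lemma seg_split a b t z : 0 <= t <= 1 ->
  seg a b z <-> seg a (lp a b t) z \/ seg (lp a b t) b z.
Proof.
move=> t01; split.
  move=> [s s01 ->]; case: (leP s t) => st.
    left; case: (eqVneq t 0) => [t0|t0].
      have -> : s = 0 by lra.
      by rewrite lp0; exact: seg_l.
    apply/segP; exists (s / t); split.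
    - rewrite divr_ge0 /=; [|lra|lra]; rewrite ler_pdivrMr ?mul1r //.
      by rewrite lt_neqAle eq_sym t0; lra.
    - by rewrite !lpE1; field.
    - by rewrite !lpE2; field.
  right; apply/segP; exists ((s - t) / (1 - t)); split.
  - have ? : 0 < 1 - t by lra.
    by rewrite divr_ge0 /=; [|lra|lra]; rewrite ler_pdivrMr ?mul1r //; lra.
  - by rewrite !lpE1; field; apply/eqP => ?; lra.
  - by rewrite !lpE2; field; apply/eqP => ?; lra.
case=> /segP [s [s01 e1 e2]]; apply/segP.
  by exists (s * t); (split; [nra| |]); rewrite ?e1 ?e2 ?lpE1 ?lpE2; ring.
by exists (t + s * (1 - t)); (split; [nra| |]); rewrite ?e1 ?e2 ?lpE1 ?lpE2; ring.
Qed.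

End Polylines.

(** * Loop erasure: extracting a simple path from an arbitrary one *)

Section LoopErasure.
Variable R : realType.
Notation pt := (R * R)%type.
Implicit Types (a b c u v w x y z : pt) (s t d : R) (G O C : set pt) (l : seq pt).

Lemma lp_inj a b s t : a <> b -> lp a b s = lp a b t -> s = t.
Proof.
move=> ab /pair_equal_spec [] /=.
rewrite -!/(lp a b _).1 -!/(lp a b _).2.
change (a.1 + s * (b.1 - a.1) = a.1 + t * (b.1 - a.1) ->
  a.2 + s * (b.2 - a.2) = a.2 + t * (b.2 - a.2) -> s = t) => e1 e2.
have H1 : (s - t) * (b.1 - a.1) = 0 by lra.
have H2 : (s - t) * (b.2 - a.2) = 0 by lra.
move/eqP: H1; rewrite mulf_eq0 => /orP[/eqP ?|/eqP h1]; first by lra.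
move/eqP: H2; rewrite mulf_eq0 => /orP[/eqP ?|/eqP h2]; first by lra.
by exfalso; apply: ab; apply: ptP; lra.
Qed.

Lemma seg_sub a b t z : 0 <= t <= 1 -> seg a (lp a b t) z -> seg a b z.
Proof. by move=> t01 H; apply/(seg_split _ _ _ t01); left. Qed.

Lemma seg_sub_r a b t z : 0 <= t <= 1 -> seg (lp a b t) b z -> seg a b z.
Proof. by move=> t01 H; apply/(seg_split _ _ _ t01); right. Qed.

Lemma seg_meet a b t z : a <> b -> 0 <= t <= 1 ->
  seg a (lp a b t) z -> seg (lp a b t) b z -> z = lp a b t.
Proof.
move=> ab t01 [r r01 er] [s s01 es].
have e1 : z = lp a b (r * t) by rewrite er; apply: ptP; rewrite !(lpE1, lpE2); ring.
have e2 : z = lp a b (t + s * (1 - t)).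
  by rewrite es; apply: ptP; rewrite !(lpE1, lpE2); ring.
have /(lp_inj ab) H : lp a b (r * t) = lp a b (t + s * (1 - t)) by rewrite -e1.
by rewrite e1; congr lp; nra.
Qed.

Lemma supp_insert l1 a b t l2 z : 0 <= t <= 1 ->
  supp (l1 ++ a :: lp a b t :: b :: l2) z <-> supp (l1 ++ a :: b :: l2) z.
Proof.
move=> t01; rewrite !supp_catP !supp_cons (seg_split a b z t01); tauto.
Qed.

Lemma simple_insert l1 a b t l2 : 0 < t < 1 ->
  simple (l1 ++ a :: b :: l2) -> simple (l1 ++ a :: lp a b t :: b :: l2).
Proof.
move=> t01; have t01' : 0 <= t <= 1 by lra.
move=> /simple_catP [H1 [ab H2 H3] H4]; apply/simple_catP; split=> //; last first.
  by move=> z Hz /(supp_insert [::] _ _ _ _ t01'); exact: H4.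
split.
- by move=> e; have := @lp_inj a b 0 t ab; rewrite lp0 => /(_ e) ?; lra.
- move=> z Hz [|Hz']; first exact: seg_meet.
  have zb : z = b by apply: H2 => //; exact: seg_sub Hz.
  rewrite zb in Hz *; apply: seg_meet => //; exact: seg_r.
- split=> //.
  + by move=> e; have := @lp_inj a b t 1 ab; rewrite lp1 => /(_ e) ?; lra.
  + by move=> z Hz; apply: H2; exact: seg_sub_r Hz.
Qed.

Lemma supp_split l z : supp l z -> z \in l \/
  exists l1 a b l2 t, [/\ l = l1 ++ a :: b :: l2, 0 < t < 1 & z = lp a b t].
Proof.
elim: l => // x [|y l] IH; first by move=> ->; left; exact: mem_head.
case=> [[t t01 ->]|/IH [Hz|[l1 [a [b [l2 [t [-> t01 ->]]]]]]]].
- case: (eqVneq t 0) => [->|t0]; first by rewrite lp0; left; exact: mem_head.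
  case: (eqVneq t 1) => [->|t1]; first by rewrite lp1; left; rewrite !inE eqxx orbT.
  right; exists [::], x, y, l, t; split=> //.
  by move: t0 t1 t01; rewrite !lt_neqAle eq_sym => -> -> /=.
- by left; rewrite inE Hz orbT.
- by right; exists (x :: l1), a, b, l2, t.
Qed.

(** A hit at a vertex is attributed to the edge that ends there, whence [0 < t]: the hit is reached
    along a proper piece of an edge, so the side of arrival makes sense. *)
Lemma list_first_hit C b l : closed C -> ~ C b -> (exists2 z, supp (b :: l) z & C z) ->
  exists l1 p q l2 t, [/\ b :: l = l1 ++ p :: q :: l2,
    0 < t <= 1, C (lp p q t), (forall s, 0 <= s < t -> ~ C (lp p q s)) &
    forall z, supp (rcons l1 p) z -> ~ C z].
Proof.
move=> cC; elim: l b => [|q l IH] b Cb; first by move=> [z ->].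
have [/(first_hit cC) [t [t01 Ct Hs]] _|nohit] := pselect (exists2 z, seg b q z & C z).
  exists [::], b, q, l, t; split=> //; last by move=> z ->.
  have : t != 0 by apply/eqP => t0; apply: Cb; rewrite -(lp0 b q) -t0.
  by rewrite lt_neqAle eq_sym => ->.
move=> [z [Hz|Hz] Cz]; first by exfalso; apply: nohit; exists z.
have Cq : ~ C q by move=> ?; apply: nohit; exists q => //; exact: seg_r.
have [l1 [p [q' [l2 [t [e t01 Ct Hs Hl]]]]]] := IH q Cq (ex_intro2 _ _ z Hz Cz).
exists (b :: l1), p, q', l2, t; split=> //; first by rewrite e.
move=> z'; case: l1 e Hl => [|c l1] /= [eq _] Hl [Hb Cz'|]; try exact: Hl.
  by apply: nohit; exists z'; rewrite // eq.
by apply: nohit; exists z'; rewrite // eq.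
Qed.

(** The tail is searched first, so the cut is made on the last edge through [w], and the truncated
    edge starts off the tail. *)
Lemma suffix_from y l w : simple (y :: l) -> supp (y :: l) w ->
  exists l', [/\ simple (w :: l'), last w l' = last y l,
    (forall z, supp (w :: l') z -> supp (y :: l) z) & (size l' <= size l)%N].
Proof.
elim: l y => [y _ ->|y' l IH y sl]; first by exists [::].
have [Hw _|Hw [|//]] := pselect (supp (y' :: l) w).
  have [l' [h1 h2 h3 h4]] := IH y' (simple_suffix (l1 := [:: y]) sl) Hw.
  exists l'; split=> //; first by move=> z /h3; right.
  by rewrite ltnW.
move=> [t t01 ew]; exists (y' :: l); split=> //; last first.
  by move=> z [Hz|Hz]; [left; rewrite ew in Hz; exact: seg_sub_r Hz|right].
case: sl => [_ H2 H3]; split=> //.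
  by move=> e; apply: Hw; rewrite e; exact: supp_head.
by move=> z Hz; apply: H2; rewrite ew in Hz; exact: seg_sub_r Hz.
Qed.

(** The new edge is cut where it first hits the simple rest, at the latest in [y]; the path goes on
    along the rest from there. *)
Lemma loop_erase_step x y l : simple (y :: l) -> ~ supp (y :: l) x ->
  exists t l', [/\ 0 < t <= 1, simple (x :: lp x y t :: l'),
    last (lp x y t) l' = last y l,
    (forall z, supp (x :: lp x y t :: l') z -> supp (x :: y :: l) z) &
    (size l' <= size l)%N].
Proof.
move=> sl xl.
have [t [t01 Ct Hs]] := first_hit (supp_closed (l := y :: l))
   (ex_intro2 _ _ y (@seg_r _ x y) (supp_head y l)).
have t0 : 0 < t.
  have : t != 0 by apply/eqP => t0; apply: xl; rewrite -(lp0 x y) -t0.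
  by rewrite lt_neqAle eq_sym => ->; case/andP: t01.
have [l' [h1 h2 h3 h4]] := suffix_from sl Ct.
exists t, l'; split=> //.
- by rewrite t0; case/andP: t01.
- split=> //; first by move=> e; apply: xl; rewrite e.
  move=> z [s s01 ez] /h3 Hz; case: (eqVneq s 1) => [s1|s1].
    by rewrite ez s1 lp1.
  exfalso; apply: (Hs (s * t)); last first.
    by have -> // : lp x y (s * t) = z; rewrite ez; apply: ptP; rewrite !(lpE1, lpE2); ring.
  have : s < 1 by rewrite lt_neqAle s1; case/andP: s01.
  nra.
- move=> z [Hz|/h3 Hz]; [left|by right].
  exact: seg_sub Hz.
Qed.

Lemma loop_erase x l : exists l', [/\ simple (x :: l'), last x l' = last x l,
    (forall z, supp (x :: l') z -> supp (x :: l) z) & (size l' <= size l)%N].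
Proof.
elim: l x => [|y l IH] x; first by exists [::].
have [l' [h1 h2 h3 h4]] := IH y.
have [Hx|Hx] := pselect (supp (y :: l') x).
  have [l2 [k1 k2 k3 k4]] := suffix_from h1 Hx.
  exists l2; split=> //; first by rewrite k2 /= h2.
    by move=> z /k3 /h3; right.
  by apply: leq_trans k4 _; exact: leq_trans h4 _.
have [t [l2 [t01 k1 k2 k3 k4]]] := loop_erase_step h1 Hx.
exists (lp x y t :: l2); split=> //; first by rewrite /= k2 h2.
  by move=> z /k3 [|/h3]; [left|right].
by rewrite /= ltnS (leq_trans k4).
Qed.

(** For a start off the rest, the first edge is only shortened. Its direction survives, which
    preserves the leftward turn at the top vertex. *)
Lemma loop_erase2 x y l : ~ supp (y :: l) x ->
  exists t l', [/\ 0 < t <= 1, simple (x :: lp x y t :: l'),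
    last (lp x y t) l' = last y l,
    (forall z, supp (x :: lp x y t :: l') z -> supp (x :: y :: l) z) &
    (size l' <= size l)%N].
Proof.
move=> Hx; have [l' [h1 h2 h3 h4]] := loop_erase y l.
have Hx' : ~ supp (y :: l') x by move=> /h3.
have [t [l2 [t01 k1 k2 k3 k4]]] := loop_erase_step h1 Hx'.
exists t, l2; split=> //; first by rewrite k2.
  by move=> z /k3 [|/h3]; [left|right].
exact: leq_trans h4.
Qed.

End LoopErasure.

(** * Paths along one side of a polyline *)

Section ParallelPaths.
Variable R : realType.
Notation pt := (R * R)%type.
Implicit Types (a b c e f u v w x y z : pt) (s t d h k : R) (G O C : set pt) (l : seq pt).

Lemma addp1 a b : (a + b).1 = a.1 + b.1. Proof. by []. Qed.
Lemma addp2 a b : (a + b).2 = a.2 + b.2. Proof. by []. Qed.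
Lemma oppp1 a : (- a).1 = - a.1. Proof. by []. Qed.
Lemma oppp2 a : (- a).2 = - a.2. Proof. by []. Qed.
Lemma scalep1 s a : (s *: a).1 = s * a.1. Proof. by []. Qed.
Lemma scalep2 s a : (s *: a).2 = s * a.2. Proof. by []. Qed.
Definition ptE := (addp1, addp2, oppp1, oppp2, scalep1, scalep2, lpE1, lpE2).

Lemma near_seg_r G a b w : closed G -> (forall z, seg a b z -> ~ G z) ->
  ev (fun d => forall z, seg a (b + d *: w) z -> ~ G z).
Proof.
move=> cG H; apply: ev_mono (@near_seg _ G a b 0 w cG H) => d _.
by rewrite scaler0 addr0.
Qed.

Lemma near_seg_l G a b u : closed G -> (forall z, seg a b z -> ~ G z) ->
  ev (fun d => forall z, seg (a + d *: u) b z -> ~ G z).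
Proof.
move=> cG H; apply: ev_mono (@near_seg _ G a b u 0 cG H) => d _.
by rewrite scaler0 addr0.
Qed.

Lemma near_seg_open O a b u w : open O -> (forall z, seg a b z -> O z) ->
  ev (fun d => forall z, seg (a + d *: u) (b + d *: w) z -> O z).
Proof.
move=> oO H; have cO : closed (~` O) by exact: open_closedC.
have /(near_seg u w cO) : forall z, seg a b z -> ~ (~` O) z by move=> z /H Oz.
by apply: ev_mono => d _ K z /K /contrapT.
Qed.

Lemma near_seg_open_r O a b w : open O -> (forall z, seg a b z -> O z) ->
  ev (fun d => forall z, seg a (b + d *: w) z -> O z).
Proof.
move=> oO H; apply: ev_mono (@near_seg_open O a b 0 w oO H) => d _.
by rewrite scaler0 addr0.
Qed.

Lemma cross_seg k e a x y z : 0 < k * cross e (x - a) -> 0 < k * cross e (y - a) ->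
  seg x y z -> 0 < k * cross e (z - a).
Proof.
move=> ax ay /segP [t [t01 e1 e2]].
have -> : k * cross e (z - a) = (1 - t) * (k * cross e (x - a)) + t * (k * cross e (y - a)).
  by rewrite /cross !ptE e1 e2; ring.
case: (eqVneq t 0) => [->|t0]; first by rewrite subr0 mul1r mul0r addr0.
have {}t0 : 0 < t by rewrite lt_neqAle eq_sym t0; case/andP: t01.
have H1 : 0 < t * (k * cross e (y - a)) by rewrite mulr_gt0.
have H2 : 0 <= (1 - t) * (k * cross e (x - a)) by rewrite mulr_ge0 ?(ltW ax) //; lra.
lra.
Qed.

Lemma crossC e f : cross e f = - cross f e.
Proof. by rewrite /cross; ring. Qed.

Lemma cross_on_seg a b z : seg a b z -> cross (b - a) (z - a) = 0.
Proof. by move=> /segP [t [t01 e1 e2]]; rewrite /cross !ptE e1 e2; ring. Qed.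

(* [c] is visible from the vertex [v1] of the polyline [v0 :: v1 :: v2 :: l], inside [O],
   in the sector between its two edges that lies on the side given by the sign of [k]
   (left for [k > 0]). *)
Definition vis k O v0 v1 v2 l c : Prop :=
  [/\ forall z, seg v1 c z -> supp (v0 :: v1 :: v2 :: l) z -> z = v1,
      forall z, seg v1 c z -> O z,
      0 < k * cross (v2 - v1) (c - v1) &
      0 < k * cross (v2 - v1) (v0 - v1) -> 0 < k * cross (c - v1) (v0 - v1)].

Lemma first_seg k O v0 v1 v2 l y w r : open O -> y = lp v1 v2 r -> 0 < r ->
  0 < k * cross (v2 - v1) w -> (forall z, seg v1 y z -> O z) ->
  ev (fun h => forall z, seg v1 (y + h *: w) z -> ~ supp (v2 :: l) z) ->
  ev (fun h => vis k O v0 v1 v2 l (y + h *: w)).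
Proof.
move=> oO ey r0 dw Oy H.
set D := cross (v2 - v1) (v0 - v1).
have E2 : ev (fun h => D = 0 \/ r * D + h * cross w (v0 - v1) != 0).
  case: (eqVneq D 0) => D0; first by apply: evT; left.
  have : r * D != 0 by rewrite mulf_neq0 // gt_eqF.
  by move=> rD; apply: ev_mono (@ev_affine_neq0 _ _ (cross w (v0 - v1)) (or_introl rD)) => h _; right.
have E3 : ev (fun h => 0 < k * D -> 0 < r * (k * D) + h * (k * cross w (v0 - v1))).
  case: (ltP 0 (k * D)) => D0; last by apply: evT.
  have : 0 < r * (k * D) by rewrite mulr_gt0.
  by move/(@ev_affine _ _ (k * cross w (v0 - v1))); apply: ev_mono => h _.
have E1 := near_seg_open_r w oO Oy.
apply: ev_mono (ev_and E1 (ev_and E2 (ev_and E3 H))) => h h0 [K1 [K2 [K3 K4]]].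
split=> //.
- move=> z Hz [|[|/(K4 _ Hz)//]] Hs.
    case/segP: Hz => t [t01 e1 e2]; case/segP: Hs => s [s01 f1 f2].
    suff t0 : t = 0 by apply: ptP; rewrite ?e1 ?e2 t0; ring.
    case: K2 => [D0|D0].
      have A1 : cross (v2 - v1) (z - v1) = t * (h * cross (v2 - v1) w).
        by rewrite /cross !ptE e1 e2 ey !ptE; ring.
      have A2 : cross (v2 - v1) (z - v1) = (1 - s) * D.
        by rewrite /D /cross !ptE f1 f2; ring.
      have : t * (h * cross (v2 - v1) w) = 0 by rewrite -A1 A2 D0 mulr0.
      move/eqP; rewrite !mulf_eq0 (gt_eqF h0) /= => /orP[/eqP//|/eqP c0].
      by move: dw; rewrite c0 mulr0 ltxx.
    have A1 : cross (z - v1) (v0 - v1) = t * (r * D + h * cross w (v0 - v1)).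
      by rewrite /D /cross !ptE e1 e2 ey !ptE; ring.
    have A2 : cross (z - v1) (v0 - v1) = 0.
      by rewrite /cross !ptE f1 f2; ring.
    by move/eqP: A1; rewrite A2 eq_sym mulf_eq0 (negbTE D0) orbF => /eqP.
  case/segP: Hz => t [t01 e1 e2]; case/segP: Hs => s [s01 f1 f2].
  suff t0 : t = 0 by apply: ptP; rewrite ?e1 ?e2 t0; ring.
  have A1 : cross (v2 - v1) (z - v1) = t * (h * cross (v2 - v1) w).
    by rewrite /cross !ptE e1 e2 ey !ptE; ring.
  have A2 : cross (v2 - v1) (z - v1) = 0 by rewrite /cross !ptE f1 f2; ring.
  move/eqP: A1; rewrite A2 eq_sym !mulf_eq0 (gt_eqF h0) /= => /orP[/eqP//|/eqP c0].
  by move: dw; rewrite c0 mulr0 ltxx.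
- have -> : cross (v2 - v1) (y + h *: w - v1) = h * cross (v2 - v1) w.
    by rewrite /cross !ptE ey !ptE; ring.
  by rewrite mulrCA mulr_gt0.
- move=> /K3; have -> // : r * (k * D) + h * (k * cross w (v0 - v1)) =
    k * cross (y + h *: w - v1) (v0 - v1).
  by rewrite /D /cross !ptE ey !ptE; ring.
Qed.

(** Offset direction at a corner. The difference of the two edge vectors has the same cross product
    with both of them, which settles proper corners; at a straight angle a normal vector works. *)
Lemma miter k v1 v2 v3 l : k != 0 -> simple (v1 :: v2 :: v3 :: l) ->
  exists n : pt, 0 < k * cross (v2 - v1) n /\ 0 < k * cross (v3 - v2) n.
Proof.
move=> k0 [n12 H [n23 _ _]].
set D := cross (v2 - v1) (v3 - v2).
case: (eqVneq D 0) => D0; last first.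
  exists ((k * D) *: ((v3 - v2) - (v2 - v1))).
  have kD : 0 < (k * D) ^+ 2 by rewrite exprn_even_gt0 //= mulf_neq0.
  split.
    have -> // : k * cross (v2 - v1) ((k * D) *: (v3 - v2 - (v2 - v1))) = (k * D) ^+ 2.
    by rewrite /D /cross !ptE; ring.
  have -> // : k * cross (v3 - v2) ((k * D) *: (v3 - v2 - (v2 - v1))) = (k * D) ^+ 2.
  by rewrite /D /cross !ptE; ring.
set e := v3 - v2; set f := v2 - v1.
pose N := e.1 ^+ 2 + e.2 ^+ 2; pose M := f.1 ^+ 2 + f.2 ^+ 2; pose E := f.1 * e.1 + f.2 * e.2.
have sum_gt0 (g : pt) : g <> 0 -> 0 < g.1 ^+ 2 + g.2 ^+ 2.
  move=> g0; rewrite lt_neqAle addr_ge0 ?sqr_ge0 // andbT eq_sym.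
  rewrite paddr_eq0 ?sqr_ge0 // !sqrf_eq0; apply/negP => /andP[/eqP h1 /eqP h2].
  by apply: g0; apply: ptP.
have N0 : 0 < N by apply: sum_gt0 => /eqP; rewrite subr_eq0 => /eqP e0; exact: n23.
have M0 : 0 < M by apply: sum_gt0 => /eqP; rewrite subr_eq0 => /eqP e0; exact: n12.
have kk : 0 < k ^+ 2 by rewrite exprn_even_gt0.
have E0 : 0 < E.
  have EE : E ^+ 2 = N * M.
    have : E ^+ 2 + D ^+ 2 = N * M by rewrite /E /D /N /M /cross -/e -/f; ring.
    by rewrite D0 expr0n /= addr0.
  have E0 : E != 0 by apply/eqP => E0; move: EE; rewrite E0 expr0n /=; nra.
  rewrite ltNge le_eqVlt (negbTE E0) /=; apply/negP => En.
  (* otherwise the second edge folds back onto the first one *)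
  have ME : M != 0 by rewrite gt_eqF.
  pose s := Num.min 1 (- M / E).
  have s0 : 0 < s by rewrite lt_min ltr01 /= nmulr_rgt0 ?invr_lt0 ?oppr_lt0.
  have s1 : s <= 1 by rewrite ge_min lexx.
  have sE : - (s * E) <= M.
    have : s <= - M / E by rewrite ge_min lexx orbT.
    by rewrite (ler_ndivlMr _ _ En) => ?; lra.
  have ef : e.1 * f.2 = e.2 * f.1 by move: D0; rewrite /D /cross -/e -/f; lra.
  have e1 : e.1 = E / M * f.1.
    apply: (mulfI ME); have -> : M * (E / M * f.1) = E * f.1 by field.
    by have := congr1 (fun r : R => f.2 * r) ef; rewrite /M /E; lra.
  have e2 : e.2 = E / M * f.2.
    apply: (mulfI ME); have -> : M * (E / M * f.2) = E * f.2 by field.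
    by have := congr1 (fun r : R => f.1 * r) ef; rewrite /M /E; lra.
  have : lp v2 v3 s = v2.
    apply: H; last by left; exists s => //; rewrite s1 ltW.
    apply/segP; exists (1 + s * (E / M)); split.
    - have : - M / M <= s * E / M <= 0 / M.
        by rewrite !ler_pM2r ?invr_gt0 //; nra.
      by rewrite mulNr divff // mul0r; lra.
    - by rewrite lpE1; move: e1; rewrite /e /f !ptE => ->; ring.
    - by rewrite lpE2; move: e2; rewrite /e /f !ptE => ->; ring.
  by rewrite -[in RHS](lp0 v2 v3) => /(lp_inj n23) s00; rewrite s00 ltxx in s0.
exists (k *: ((- e.2, e.1) : pt)); split.
  have -> : k * cross f (k *: ((- e.2, e.1) : pt)) = k ^+ 2 * E.
    by rewrite /E /cross !ptE /=; ring.
  by rewrite mulr_gt0.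
have -> : k * cross e (k *: ((- e.2, e.1) : pt)) = k ^+ 2 * N.
  by rewrite /N /cross !ptE /=; ring.
by rewrite mulr_gt0.
Qed.

(** One step of a parallel path, backwards from the corner [v2] to the corner [v1]. [L] is [v2]
    moved along the miter direction, so [L c] is close to [v2 c], which touches the polyline only in
    [v2]; near [v2], both [L] and [c] lie in the same sector. *)
Lemma vis_step k O v0 v1 v2 v3 l c : k != 0 -> open O ->
  simple (v0 :: v1 :: v2 :: v3 :: l) -> (forall z, seg v1 v2 z -> O z) ->
  vis k O v1 v2 v3 l c -> (forall z, seg v2 c z -> ~ seg v0 v1 z) ->
  exists L, vis k O v0 v1 v2 (v3 :: l) L /\
    forall z, seg L c z -> O z /\ ~ supp (v0 :: v1 :: v2 :: v3 :: l) z.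
Proof.
move=> k0 oO sl Oe [V1 V2 V3 V4] V0.
have sl1 : simple (v1 :: v2 :: v3 :: l) := simple_suffix (l1 := [:: v0]) sl.
have [n [n1 n2]] := miter k0 sl1.
have v2n : ~ supp (v3 :: l) v2.
  move=> H; have := simple_suffix (l1 := [:: v1]) sl1.
  by case=> [+ /(_ _ (seg_l _ _) H)].
have E1 : ev (fun h => forall z, seg v1 (v2 + h *: n) z -> ~ supp (v3 :: l) z).
  apply: near_seg_r; first exact: supp_closed.
  move=> z Hz Hz'; have zv : z = v2 by apply: (simple_edge_r (l1 := [::]) sl1 Hz); right.
  by apply: v2n; rewrite -zv.
have E2 : ev (fun h => vis k O v0 v1 v2 (v3 :: l) (v2 + h *: n)).
  apply: (first_seg _ _ _ (r := 1)); rewrite ?lp1 ?ltr01 //.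
  apply: ev_mono E1 => h h0 H1 z Hz [Hz'|]; last exact: H1.
  have A : 0 < h * (k * cross (v2 - v1) n) by rewrite mulr_gt0.
  case/segP: (Hz) => t [t01 e1 e2]; case/segP: (Hz') => s [s01 f1 f2].
  have B1 : k * cross n (z - v2) = (1 - t) * (k * cross (v2 - v1) n).
    by rewrite /cross !ptE e1 e2 !ptE; ring.
  have B2 : k * cross n (z - v2) = - (s * (k * cross (v3 - v2) n)).
    by rewrite /cross !ptE f1 f2; ring.
  have t1 : t = 1 by nra.
  have s0 : s = 0 by nra.
  have C1 : k * cross (v2 - v1) (z - v2) = h * (k * cross (v2 - v1) n).
    by rewrite /cross !ptE e1 e2 !ptE t1; ring.
  have C2 : k * cross (v2 - v1) (z - v2) = 0.
    by rewrite /cross !ptE f1 f2 s0; ring.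
  lra.
have E3 : ev (fun h => forall z, seg (v2 + h *: n) c z -> O z).
  have := near_seg_open n 0 oO V2.
  by apply: ev_mono => h _; rewrite scaler0 addr0.
have E4 : ev (fun h => forall z, seg (v2 + h *: n) c z -> ~ supp (v3 :: l) z).
  apply: near_seg_l; first exact: supp_closed.
  move=> z Hz Hz'; have zv : z = v2 by apply: V1 => //; do 2 right.
  by apply: v2n; rewrite -zv.
have E5 := near_seg_l n (@seg_closed _ v0 v1) V0.
have [h h0 [K2 [K3 [K4 K5]]]] := ev_ex (ev_and E2 (ev_and E3 (ev_and E4 E5))).
exists (v2 + h *: n); split=> // z Hz; split; first exact: K3.
case; first exact: K5.
have Lk : 0 < k * cross (v3 - v2) (v2 + h *: n - v2).
  have -> : k * cross (v3 - v2) (v2 + h *: n - v2) = h * (k * cross (v3 - v2) n).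
    by rewrite /cross !ptE; ring.
  by rewrite mulr_gt0.
have Zk := cross_seg Lk V3 Hz.
case; last case; last exact: K4.
(* If the sector at [v2] is convex, [L] and [c] also lie strictly on one side of the line [v1 v2].
   Otherwise the edge [v1 v2] is weakly on the other side of the line [v2 v3]. *)
- move=> Hz'; case: (ltP 0 (k * cross (v3 - v2) (v1 - v2))) => [/V4 V4'|Hn].
    have V5 : 0 < - k * cross (v1 - v2) (c - v2) by rewrite crossC mulrNN.
    have L5 : 0 < - k * cross (v1 - v2) (v2 + h *: n - v2).
      have -> : - k * cross (v1 - v2) (v2 + h *: n - v2) = h * (k * cross (v2 - v1) n).
        by rewrite /cross !ptE; ring.
      by rewrite mulr_gt0.
    have := cross_seg L5 V5 Hz.
    by rewrite (@cross_on_seg v2 v1 z) ?mulr0 ?ltxx // seg_sym.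
  case/segP: Hz' => t [t01 e1 e2].
  have : k * cross (v3 - v2) (z - v2) = (1 - t) * (k * cross (v3 - v2) (v1 - v2)).
    by rewrite /cross !ptE e1 e2; ring.
  nra.
- by move=> /cross_on_seg z0; move: Zk; rewrite z0 mulr0 ltxx.
Qed.

End ParallelPaths.

(** * Paths from a point beside an edge to the end of the arc *)

Section ParallelLegs.
Variable R : realType.
Notation pt := (R * R)%type.
Implicit Types (a b c e f p q u v w x y z : pt) (s t h k : R) (G O C : set pt) (l F : seq pt).

Lemma vis_sub k O O' v0 v1 v2 l c : O `<=` O' ->
  vis k O v0 v1 v2 l c -> vis k O' v0 v1 v2 l c.
Proof. by move=> OO [H1 H2 H3 H4]; split=> // z /H2 /OO. Qed.

Definition visL k O W c : Prop :=
  if W is v0 :: v1 :: v2 :: l then vis k O v0 v1 v2 l c else False.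

Lemma open_diff O G : open O -> closed G -> open (O `\` G).
Proof. by move=> oO cG; rewrite setDE; apply: openI => //; exact: closed_openC. Qed.

(** The induction removes the first edge from the open set, so the path drawn along the rest never
    meets it. The assumption concerns only [behead], because the rest of the polyline starts on the
    removed edge. *)
Lemma parallel_path k pre a b d l c O : k != 0 -> simple (pre ++ [:: a, b, d & l]) -> open O ->
  (forall z, supp (behead (pre ++ [:: a, b, d & l])) z -> O z) ->
  vis k (O `\` supp (rcons pre a)) a b d l c ->
  exists c' cs, [/\ size cs = size pre, last c' cs = c,
    visL k O (pre ++ [:: a, b, d & l]) c' &
    forall z, supp (c' :: cs) z -> O z /\ ~ supp (pre ++ [:: a, b, d & l]) z].
Proof.
move=> k0; elim: pre O => [|p pre IH] O sW oO WO V.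
  exists c, [::]; split=> //; first by apply: vis_sub V => z [].
  move=> z ->; case: V => V1 V2 V3 _.
  have [Oc _] := V2 c (@seg_r _ _ _); split=> // Hc.
  by move: V3; rewrite (V1 c (@seg_r _ _ _) Hc) subrr /cross /= !mulr0 subrr mulr0 ltxx.
have [q [u [w [l3 eW]]]] : exists q u w l3, pre ++ [:: a, b, d & l] = [:: q, u, w & l3].
  case: pre {IH sW WO V} => [|q [|u [|w pre]]] /=.
  - by exists a, b, d, l.
  - by exists q, a, b, (d :: l).
  - by exists q, u, a, [:: b, d & l].
  - by exists q, u, w, (pre ++ [:: a, b, d & l]).
have hq z : seg p q z \/ supp (rcons pre a) z -> supp (rcons (p :: pre) a) z.
  case: pre eW {IH sW WO V} => [|q' pre] /= [-> _] //.
rewrite cat_cons eW in sW WO *.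
have O'o : open (O `\` seg p q) by apply: open_diff => //; exact: seg_closed.
have [] := IH (O `\` seg p q).
- by rewrite eW; exact: (simple_suffix (l1 := [:: p]) sW).
- by [].
- rewrite eW => z Hz; split; first by apply: WO; right.
  by move=> Hz'; apply: (simple_disj (l1 := [:: p]) sW _ Hz); left.
- apply: vis_sub V => z [Oz Hz]; split; [split=> // Hz'|move=> Hz'];
    apply: Hz; apply: hq; tauto.
move=> c' [cs [h1 h2]]; rewrite eW => h3 h4.
have [L [L1 L2]] : exists L, vis k O p q u (w :: l3) L /\
    forall z, seg L c' z -> O z /\ ~ supp [:: p, q, u, w & l3] z.
  apply: vis_step => //.
  - by move=> z Hz; apply: WO; left.
  - by apply: vis_sub h3 => z [].
  - by case: h3 => _ + _ _ z Hz => /(_ z Hz) [].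
exists L, (c' :: cs); split=> //=; first by rewrite h1.
move=> z [/L2 //|/h4 [[Oz Hz] Hz']]; split=> //.
by case.
Qed.

(** [x] stands for an inner point of an edge, inserted as a straight-angle vertex; the cross product
    condition expresses collinearity. A point slightly off [x] sees [c] because both lie strictly on
    the same side of that edge. *)
Lemma perturb k O v0 x v2 l c p : open O -> simple [:: v0, x, v2 & l] ->
  (forall z, seg v0 x z -> cross (v2 - x) (z - x) = 0) ->
  vis k O v0 x v2 l c -> 0 < k * cross (v2 - x) (p - x) ->
  ev (fun h => forall z, seg (lp x p h) c z -> O z /\ ~ supp [:: v0, x, v2 & l] z).
Proof.
move=> oO sl col [V1 V2 V3 V4] pk.
have E1 : ev (fun h => forall z, seg (x + h *: (p - x)) c z -> O z).
  have := near_seg_open (p - x) 0 oO V2.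
  by apply: ev_mono => h _; rewrite scaler0 addr0.
have E2 : ev (fun h => forall z, seg (x + h *: (p - x)) c z -> ~ supp (v2 :: l) z).
  apply: near_seg_l; first exact: supp_closed.
  move=> z Hz Hz'; have zx : z = x by apply: V1 => //; do 2 right.
  rewrite zx in Hz'; apply: (simple_disj (l1 := [:: v0]) sl _ Hz').
  by left; exact: seg_r.
apply: ev_mono (ev_and E1 E2) => h h0 [K1 K2] z Hz; split; first exact: K1.
have xk : 0 < k * cross (v2 - x) (lp x p h - x).
  have -> : k * cross (v2 - x) (lp x p h - x) = h * (k * cross (v2 - x) (p - x)).
    by rewrite /cross !ptE; ring.
  by rewrite mulr_gt0.
have zk := cross_seg xk V3 Hz.
case=> [/col z0|[/cross_on_seg z0|]]; last exact: K2.
  by move: zk; rewrite z0 mulr0 ltxx.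
by move: zk; rewrite z0 mulr0 ltxx.
Qed.

(* The sign of [k] selects the side of the edge [a b], as in [vis]. *)
Definition tip k a b h : pt :=
  b + h *: ((b - a) + k *: ((- (b - a).2, (b - a).1) : pt)).

Lemma sqr_norm_gt0 a b : a <> b -> 0 < (b - a).1 ^+ 2 + (b - a).2 ^+ 2.
Proof.
move=> ab; rewrite lt_neqAle addr_ge0 ?sqr_ge0 // andbT eq_sym.
rewrite paddr_eq0 ?sqr_ge0 // !sqrf_eq0 !ptE; apply/negP => /andP[/eqP h1 /eqP h2].
by apply: ab; apply: ptP; lra.
Qed.

(** In the direction of the last edge, all points between the tips lie beyond [b] by the same
    positive amount, while no point of the edge does: [D1] against [D2]. *)
Lemma tip_turn O m a b k1 k2 : open O -> simple (rcons (rcons m a) b) -> O b ->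
  ev (fun h => forall z, seg (tip k1 a b h) (tip k2 a b h) z ->
    O z /\ ~ supp (rcons (rcons m a) b) z).
Proof.
move=> oO /simple_rcons2 [sm ab Hb] Ob.
have segbb z : seg b b z -> z = b.
  by move=> /segP [t [_ e1 e2]]; apply: ptP; rewrite ?e1 ?e2; ring.
have E1 := near_seg_open ((b - a) + k1 *: ((- (b - a).2, (b - a).1) : pt))
  ((b - a) + k2 *: ((- (b - a).2, (b - a).1) : pt)) oO
  (fun z (Hz : seg b b z) => eq_ind_r O Ob (segbb z Hz)).
have Hb' : forall z, seg b b z -> ~ supp (rcons m a) z.
  move=> z /segbb -> H; apply: ab; rewrite (Hb b) //; exact: seg_r.
have E2 := near_seg ((b - a) + k1 *: ((- (b - a).2, (b - a).1) : pt))
  ((b - a) + k2 *: ((- (b - a).2, (b - a).1) : pt)) (@supp_closed _ _) Hb'.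
apply: ev_mono (ev_and E1 E2) => h h0 [K1 K2] z Hz; split; first exact: K1.
case/supp_rcons2; first exact: K2.
move=> /segP [s [s01 f1 f2]]; case/segP: Hz => t [t01 e1 e2].
have N0 := sqr_norm_gt0 ab.
pose D := (b - a).1 * (z - b).1 + (b - a).2 * (z - b).2.
have D1 : D = h * ((b - a).1 ^+ 2 + (b - a).2 ^+ 2).
  by rewrite /D !ptE e1 e2 /tip !ptE /=; ring.
have D2 : D = (s - 1) * ((b - a).1 ^+ 2 + (b - a).2 ^+ 2).
  by rewrite /D !ptE f1 f2 ?ptE /=; ring.
have := mulr_gt0 h0 N0; rewrite -D1 D2; nra.
Qed.

Lemma tail3 l a b c : exists l' a' b', [/\ [:: a, b & rcons l c] = l' ++ [:: a'; b'; c] ,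
  size l' = size l, b' = last b l & supp [:: b'; c] `<=` supp (b :: rcons l c)].
Proof.
elim: l a b => [|d l IH] a b; first by exists [::], a, b; split.
have [l' [a' [b' [/= e1 e2 e3 e4]]]] := IH b d.
exists (a :: l'), a', b'; split=> //=; first by rewrite e1.
  by rewrite e2.
by move=> z /e4; right.
Qed.

(** One leg of a detour: [x] is inserted as a vertex, a parallel path is built backwards from the
    tip beyond [b], and the segment between [p] and [x] is stopped shortly before [x]. *)
Lemma parallel_leg k O l1 v v' l2 m a b t p : k != 0 -> simple (l1 ++ v :: v' :: l2) ->
  l1 ++ v :: v' :: l2 = rcons (rcons m a) b -> open O ->
  (forall z, supp (l1 ++ v :: v' :: l2) z -> O z) -> 0 < t < 1 ->
  0 < k * cross (v' - v) (p - lp v v' t) ->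
  ev (fun h => exists s cs, [/\ 0 < s <= 1, size cs = size l2 &
    forall z, supp (lp (lp v v' t) p s :: rcons cs (tip k a b h)) z ->
      O z /\ ~ supp (l1 ++ v :: v' :: l2) z]).
Proof.
move=> k0 sF eF oO FO t01 pk; set x := lp v v' t in pk *.
have t01' : 0 <= t <= 1 by lra.
have sW := simple_insert t01 sF; rewrite -/x in sW.
have vv' := simple_neq sF.
have ab : a <> b by move: sF; rewrite eF => /simple_rcons2 [].
(* After the insertion the last edge is the old one ([r = 1]), or the part of [v v'] behind [x] if
   that edge was the last ([r = 1 - t]). *)
have [pre [a0 [b0 [r [eW spre r0 eb Hb]]]]] : exists pre a0 b0 r,
   [/\ [:: v, x, v' & l2] = pre ++ [:: a0; b0; b], size pre = size l2,
       0 < r, b - b0 = r *: (b - a) & supp [:: b0; b] `<=` supp [:: x, v' & l2]].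
  case/lastP: l2 eF {sF FO sW} => [|l3 b1] eF.
    exists [::], v, x, (1 - t).
    move: eF; rewrite -[X in _ ++ X]/(rcons [:: v] v') -rcons_cat => /rcons_inj[].
    rewrite cats1 => /rcons_inj [_ ea] eb; subst a b; split=> //; first by lra.
    by apply: ptP; rewrite /x !ptE; ring.
  have [l' [a' [b' [h1 h2 h3 h4]]]] := tail3 l3 x v' b1.
  move: eF; rewrite -!rcons_cons -rcons_cat => /rcons_inj[].
  move=> e1 eb1; subst b1.
  have ea : a = last v' l3 by have := congr1 (last v) e1; rewrite last_rcons last_cat /= => ->.
  exists (v :: l'), a', b', 1; split=> //.
  - by rewrite cat_cons -h1.
  - by rewrite /= h2 size_rcons.
  - by rewrite h3 -ea scale1r.
  - by move=> z /h4; right.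
set w := (b - a) + k *: ((- (b - a).2, (b - a).1) : pt).
have kw : 0 < k * cross (b - b0) w.
  have -> : k * cross (b - b0) w = r * (k ^+ 2 * ((b - a).1 ^+ 2 + (b - a).2 ^+ 2)).
    by rewrite eb /w /cross !ptE /=; ring.
  rewrite mulr_gt0 // mulr_gt0 ?exprn_even_gt0 //; exact: sqr_norm_gt0.
set O1 := O `\` supp (rcons l1 v).
have oO1 : open O1 by apply: open_diff => //; exact: supp_closed.
have oO2 : open (O1 `\` supp (rcons pre a0)) by apply: open_diff => //; exact: supp_closed.
have WF z : supp [:: v, x, v' & l2] z -> supp (l1 ++ v :: v' :: l2) z.
  by move=> H; apply/supp_catP; right; apply/(supp_insert [::] _ _ _ _ t01').
have WO1 z : supp [:: x, v' & l2] z -> O1 z.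
  move=> H; split; first by apply: FO; apply: WF; right.
  by move=> H'; exact: (simple_disj sW H' H).
have sW1 : simple (pre ++ [:: a0; b0; b]) by rewrite -eW; exact: simple_suffix sW.
have b0b : b0 <> b by apply: (simple_neq (l1 := rcons pre a0) (l2 := [::])); rewrite cat_rcons.
have E1 : ev (fun h => vis k (O1 `\` supp (rcons pre a0)) a0 b0 b [::] (b + h *: w)).
  apply: (first_seg _ _ _ (r := 1)); rewrite ?lp1 ?ltr01 //.
    move=> z Hz; have Hz' : supp [:: b0; b] z by left.
    split; first by apply: WO1; exact: Hb.
    by move=> H; exact: (simple_disj sW1 H Hz').
  apply: evT => h h0 z /segP [s [s01 e1 e2]] zb; rewrite /= in zb.
  have : k * cross (b - b0) (z - b0) = s * (h * (k * cross (b - b0) w)).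
    by rewrite /cross !ptE e1 e2 !ptE; ring.
  rewrite zb; have -> : cross (b - b0) (b - b0) = 0 by rewrite /cross; ring.
  have hk0 : h * (k * cross (b - b0) w) != 0 by exact: lt0r_neq0 (mulr_gt0 h0 kw).
  rewrite mulr0 => /esym/eqP; rewrite mulf_eq0 (negbTE hk0) orbF => /eqP s0.
  by apply: b0b; rewrite -zb; apply: ptP; rewrite ?e1 ?e2 s0; ring.
apply: ev_mono E1 => h h0 V.
have [|c' [cs [h1 h2 h3 h4]]] := parallel_path k0 sW1 oO1 _ V.
  by rewrite -eW => z; exact: WO1.
rewrite -eW in h3 h4.
have E2 : ev (fun s => forall z, seg (lp x p s) c' z -> O1 z /\ ~ supp [:: v, x, v' & l2] z).
  apply: (@perturb k) => //.
  - exact: simple_suffix sW.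
  - move=> z /segP [s [s01 e1 e2]]; rewrite /cross !ptE e1 e2 /x !ptE; ring.
  - have -> : k * cross (v' - x) (p - x) = (1 - t) * (k * cross (v' - v) (p - x)).
      by rewrite /cross /x !ptE; ring.
    by rewrite mulr_gt0 // subr_gt0; case/andP: t01.
have [s s0 [s1 K]] := ev_ex (ev_and (ev_lt ltr01) E2).
exists s, (belast c' cs); split; first by rewrite s0 ltW.
  by rewrite size_belast h1.
have -> : rcons (belast c' cs) (tip k a b h) = c' :: cs by rewrite lastI h2.
have avoid z : O1 z -> ~ supp [:: v, x, v' & l2] z -> O z /\ ~ supp (l1 ++ v :: v' :: l2) z.
  move=> [Oz Hz] Hz'; split=> //.
  by move/(supp_insert _ _ _ _ _ t01') => /supp_catP [].
by move=> z [/K[]|/h4[]]; exact: avoid.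
Qed.

End ParallelLegs.

(** * Detours around a single arc *)

Section Detours.
Variable R : realType.
Notation pt := (R * R)%type.
Implicit Types (a b c e p q u v w x y z : pt) (s t h k r : R) (G O C : set pt) (f g l F : seq pt).

Lemma supp_cat2 l1 x y l2 z :
  supp (rcons l1 x ++ y :: l2) z <-> [\/ supp (rcons l1 x) z, seg x y z | supp (y :: l2) z].
Proof.
rewrite cat_rcons supp_catP supp_cons; split=> [[|[]]|[]]; try tauto.
- by constructor 1.
- by constructor 2.
- by constructor 3.
Qed.

Lemma size_cat2 l1 l2 x y :
  size (l1 ++ x :: y :: l2) = (size l1 + size l2 + 2)%N.
Proof. by rewrite size_cat /= !addnS addn0. Qed.

(** Both legs lead to the end of [F], possibly on different sides, and are joined by a turn around
    it. The cross products themselves serve as signs [k], so positivity is that of a square. *)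
Lemma around F O f1 v v' f2 r p g1 w w' g2 r' p' :
  F = f1 ++ v :: v' :: f2 -> F = g1 ++ w :: w' :: g2 -> simple F -> open O ->
  (forall z, supp F z -> O z) -> 0 < r < 1 -> 0 < r' < 1 ->
  cross (v' - v) (p - lp v v' r) != 0 -> cross (w' - w) (p' - lp w w' r') != 0 ->
  (size f2 + size g2 + 2 <= size F)%N ->
  exists s s' cs, [/\ 0 < s <= 1, 0 < s' <= 1, (size cs <= size F)%N &
    forall z, supp (lp (lp v v' r) p s :: rcons cs (lp (lp w w' r') p' s')) z ->
      O z /\ ~ supp F z].
Proof.
move=> e1 e2 sF oO FO r01 r'01 c1 c2 sz.
have [m [a [b eF]]] : exists m a b, F = rcons (rcons m a) b.
  case/lastP: F e1 {e2 sF FO sz} => [|F b]; first by case: f1.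
  case/lastP: F => [|F a] e1; last by exists F, a, b.
  by have := congr1 size e1; rewrite size_cat /=; lia.
have pos (c : R) : c != 0 -> 0 < c * c by move=> c0; rewrite -expr2 exprn_even_gt0.
have L1 := @parallel_leg R _ O f1 v v' f2 m a b r p c1.
rewrite -e1 in L1; have {}L1 := L1 sF eF oO FO r01 (pos _ c1).
have L2 := @parallel_leg R _ O g1 w w' g2 m a b r' p' c2.
rewrite -e2 in L2; have {}L2 := L2 sF eF oO FO r'01 (pos _ c2).
have Ob : O b by apply: FO; apply: supp_mem; rewrite eF mem_rcons mem_head.
have sF' := sF; rewrite eF in sF'.
have L3 := @tip_turn R O m a b (cross (v' - v) (p - lp v v' r))
  (cross (w' - w) (p' - lp w w' r')) oO sF' Ob.
rewrite -eF in L3.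
have [h h0 [[s [cs [s01 h1 h2]]] [[s' [cs' [s'01 k1 k2]]] h3]]] := ev_ex (ev_and L1 (ev_and L2 L3)).
set T1 := tip _ a b h in h2 h3; set T2 := tip _ a b h in k2 h3.
exists s, s', (rcons cs T1 ++ T2 :: rev cs'); split=> //.
  by rewrite size_cat /= size_rcons size_rev h1 k1; move: sz; clear; lia.
set x' := lp _ _ s in h2 *; set y' := lp _ _ s' in k2 *.
have -> : x' :: rcons (rcons cs T1 ++ T2 :: rev cs') y' =
  rcons (x' :: cs) T1 ++ T2 :: rcons (rev cs') y' by rewrite rcons_cat.
move=> z /supp_cat2 [/h2|/h3|Hz] //.
by apply: k2; apply/supp_rev; rewrite rev_cons rev_rcons.
Qed.

(** Excludes tangential arrival: a path that reaches an edge along the line of this edge is on the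
    edge already before its first hit. *)
Lemma parallel_enters v v' r p : v <> v' -> 0 < r < 1 ->
  cross (v' - v) (p - lp v v' r) = 0 ->
  exists2 s, 0 < s < 1 & seg v v' (lp (lp v v' r) p s).
Proof.
move=> vv' r01 c0; set x := lp v v' r in c0 *.
set d := v' - v in c0 *; set g := p - x in c0 *.
have N0 := sqr_norm_gt0 vv'; rewrite -/d in N0.
set N := d.1 ^+ 2 + d.2 ^+ 2 in N0.
have NN : N != 0 by rewrite gt_eqF.
pose m := (d.1 * g.1 + d.2 * g.2) / N.
have cc : d.1 * g.2 = d.2 * g.1 by move: c0; rewrite /cross; lra.
have g1 : g.1 = m * d.1.
  apply: (mulfI NN); have -> : N * (m * d.1) = (d.1 * g.1 + d.2 * g.2) * d.1.
    by rewrite /m; field.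
  by have := congr1 (fun r : R => d.2 * r) cc; rewrite /N; lra.
have g2 : g.2 = m * d.2.
  apply: (mulfI NN); have -> : N * (m * d.2) = (d.1 * g.1 + d.2 * g.2) * d.2.
    by rewrite /m; field.
  by have := congr1 (fun r : R => d.1 * r) cc; rewrite /N; lra.
have r0 : 0 < r by case/andP: r01.
have r1 : 0 < 1 - r by rewrite subr_gt0; case/andP: r01.
have [s s0 [H1 [H2 H3]]] :=
  ev_ex (ev_and (ev_affine m r0) (ev_and (ev_affine (- m) r1) (ev_lt ltr01))).
exists s; first by rewrite s0.
apply/segP; exists (r + s * m); split; first by lra.
  rewrite lpE1; have -> : p.1 - x.1 = m * (v'.1 - v.1) by have := g1; rewrite /g /d !ptE.
  by rewrite /x lpE1; ring.
rewrite lpE2; have -> : p.2 - x.2 = m * (v'.2 - v.2) by have := g2; rewrite /g /d !ptE.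
by rewrite /x lpE2; ring.
Qed.

Lemma lp_back p q t s : lp (lp p q t) p s = lp p q (t * (1 - s)).
Proof. by apply: ptP; rewrite !ptE; ring. Qed.

(** The stretch from the first to the last hit is replaced by a walk around an end of [F], inside
    any neighbourhood [O] of [F]. As no vertex of [F] is on the path, both hits are inner points of
    edges of [F]. *)
Lemma detour F O b l : simple F -> open O -> (forall z, supp F z -> O z) ->
  ~ supp F b -> ~ supp F (last b l) -> (forall v, v \in F -> ~ supp (b :: l) v) ->
  exists l', [/\ last b l' = last b l, forall z, supp (b :: l') z -> ~ supp F z,
    forall z, supp (b :: l') z -> supp (b :: l) z \/ O z &
    (size l' <= size l + size F + 2)%N].
Proof.
move=> sF oO FO Fb Fl vF.
have cF := @supp_closed R F.
have [hit|nohit] := pselect (exists2 z, supp (b :: l) z & supp F z); last first.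
  exists l; split=> //; first by move=> z Hz Hz'; apply: nohit; exists z.
    by left.
  by rewrite -addnA leq_addr.
have [l1 [p [q [l2 [t [el t01 Fx Hx Hl]]]]]] := list_first_hit cF Fb hit.
set x := lp p q t in Fx.
have el2 : last b l = last x (q :: l2).
  by have := congr1 (last b) el; rewrite last_cat /=.
have t01' : 0 <= t <= 1 by case/andP: t01 => t0 ->; rewrite ltW.
have sub2 z : supp (x :: q :: l2) z -> supp (b :: l) z.
  move=> H; rewrite el; apply/supp_catP; right.
  by apply/(supp_insert [::] p q l2 z t01'); right.
(* The last hit is the first hit of the reversed remainder. *)
have [m em] : exists m, rev (x :: q :: l2) = last b l :: m.
  by rewrite el2 lastI rev_rcons; exists (rev (belast x (q :: l2))).
have hit2 : exists2 z, supp (last b l :: m) z & supp F z.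
  by exists x => //; rewrite -em; apply/supp_rev; exact: supp_head.
have [m1 [p2 [q2 [m2 [t2 [em' t201 Fy Hy Hm]]]]]] := list_first_hit cF Fl hit2.
set y := lp p2 q2 t2 in Fy.
have t201' : 0 <= t2 <= 1 by case/andP: t201 => t0 ->; rewrite ltW.
have sub3 z : supp (m1 ++ p2 :: q2 :: m2) z -> supp (b :: l) z.
  by rewrite -em' -em => /supp_rev; exact: sub2.
have onP z : seg p q z -> supp (b :: l) z.
  by move=> H; rewrite el; apply/supp_catP; right; left.
have onP2 z : seg p2 q2 z -> supp (b :: l) z.
  by move=> H; apply: sub3; apply/supp_catP; right; left.
have edge z : supp F z -> supp (b :: l) z ->
    exists f1 v v' f2 r, [/\ F = f1 ++ v :: v' :: f2, 0 < r < 1 & z = lp v v' r].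
  by move=> /supp_split[/vF//|].
have xl : supp (b :: l) x by apply: onP; exists t.
have yl : supp (b :: l) y by apply: onP2; exists t2.
have [f1 [v [v' [f2 [r [eF r01 ex]]]]]] := edge x Fx xl.
have [g1 [w [w' [g2 [r' [eG r'01 ey]]]]]] := edge y Fy yl.
have side P Q T V V' f1' f2' rho : F = f1' ++ V :: V' :: f2' -> 0 < T <= 1 ->
    (forall s, 0 <= s < T -> ~ supp F (lp P Q s)) -> 0 < rho < 1 -> lp P Q T = lp V V' rho ->
    cross (V' - V) (P - lp V V' rho) != 0.
  move=> eV T01 HT rho01 eT; apply/eqP => /(parallel_enters _ rho01) [].
    by rewrite eV in sF; exact: simple_neq sF.
  move=> s s01; rewrite -eT lp_back => H; apply: (HT (T * (1 - s))); first by nra.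
  by rewrite eV; apply/supp_catP; right; left.
have c1 := side _ _ _ _ _ _ _ _ eF t01 Hx r01 ex.
have c2 := side _ _ _ _ _ _ _ _ eG t201 Hy r'01 ey.
have szF : size F = (size f1 + size f2 + 2)%N by rewrite eF size_cat2.
have szG : size F = (size g1 + size g2 + 2)%N by rewrite eG size_cat2.
have [s [s' [cs [s01 s'01 hcs Hcs]]]] : exists s s' cs, [/\ 0 < s <= 1, 0 < s' <= 1,
    (size cs <= size F)%N & forall z, supp (lp x p s :: rcons cs (lp y p2 s')) z ->
      O z /\ ~ supp F z].
  (* The costs of the walks around the two ends add up to [2 * size F], so one of them is at most
     [size F]; reversing [F] exchanges them. *)
  case: (leqP (size f2 + size g2 + 2) (size F)) => sz.
    by rewrite ex ey; apply: (around eF eG).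
  have eF' : rev F = rev f2 ++ v' :: v :: rev f1 by rewrite eF rev_cat !rev_cons !cat_rcons.
  have eG' : rev F = rev g2 ++ w' :: w :: rev g1 by rewrite eG rev_cat !rev_cons !cat_rcons.
  have lpC a c (tau : R) : lp a c tau = lp c a (1 - tau) by apply: ptP; rewrite !ptE; ring.
  have oneC (tau : R) : 0 < tau < 1 -> 0 < 1 - tau < 1 by lra.
  have crC a c e : cross (a - c) e = - cross (c - a) e by rewrite /cross !ptE; ring.
  have [] := @around (rev F) O _ _ _ _ (1 - r) p _ _ _ _ (1 - r') p2 eF' eG' _ oO.
  - exact/simple_rev.
  - by move=> z /supp_rev; exact: FO.
  - exact: oneC.
  - exact: oneC.
  - by rewrite -lpC crC oppr_eq0.
  - by rewrite -lpC crC oppr_eq0.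
  - by rewrite !size_rev; move: sz szF szG; clear; lia.
  move=> s [s' [cs [s01 s'01]]]; rewrite size_rev -!lpC -ex -ey => hcs Hcs.
  exists s, s', cs; split=> // z /Hcs [Oz Hz]; split=> // Hz'.
  by apply: Hz; apply/supp_rev.
have near P Q T sg z : 0 < T <= 1 -> (forall s, 0 <= s < T -> ~ supp F (lp P Q s)) ->
    0 < sg <= 1 -> seg P (lp (lp P Q T) P sg) z -> ~ supp F z /\ seg P Q z.
  move=> T01 HT sg01 [u u01 ->]; rewrite lp_back.
  have -> : lp P (lp P Q (T * (1 - sg))) u = lp P Q (u * (T * (1 - sg))).
    by apply: ptP; rewrite !ptE; ring.
  have H1 : 0 <= T * (1 - sg) < T by nra.
  have H2 : 0 <= u * (T * (1 - sg)) < T by nra.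
  split; first exact: HT.
  by exists (u * (T * (1 - sg))) => //; lra.
set N := rcons l1 p ++ (lp x p s :: rcons cs (lp y p2 s')) ++ rev (rcons m1 p2).
have eN : N = b :: behead N by rewrite /N; case: (l1) el => [|c l0] /= [->].
have key z : supp N z -> ~ supp F z /\ (supp (b :: l) z \/ O z).
  rewrite /N cat_cons => /supp_cat2 [Hz|Hz|].
  - split; first exact: Hl.
    by left; rewrite el; apply/supp_catP; left.
  - by have [? /onP] := near _ _ _ _ _ t01 Hx s01 Hz; split=> //; left.
  rewrite -cat_cons -rcons_cons rev_rcons => /supp_cat2 [/Hcs[]|Hz|Hz].
  - by split=> //; right.
  - rewrite seg_sym in Hz; have [? /onP2] := near _ _ _ _ _ t201 Hy s'01 Hz.
    by split=> //; left.
  - have Hz' : supp (rcons m1 p2) z by apply/supp_rev; rewrite rev_rcons.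
    split; first exact: Hm.
    by left; apply: sub3; apply/supp_catP; left.
have szl : size l = (size l1 + size l2 + 1)%N.
  by have := congr1 size el; rewrite size_cat2 /=; clear; lia.
have szm : (size m1 <= size l2)%N.
  have := congr1 size em'; rewrite -em size_rev size_cat2 /=; clear; lia.
exists (behead N); split.
- have -> : last b (behead N) = last b N by rewrite [in RHS]eN.
  rewrite /N !last_cat last_cons.
  have : last b l = head p2 (rcons m1 p2) by case: (m1) em' => [|c m0] /= [->].
  move=> ->; rewrite rev_rcons /= -(last_cons p2) -/(rev_rcons _ _).
  by rewrite -rev_rcons -nth_last size_rev nth_rev ?size_rcons // subnn nth0; case: (m1).
- by move=> z Hz; rewrite -eN in Hz; case: (key z Hz).
- by move=> z Hz; rewrite -eN in Hz; case: (key z Hz).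
- by rewrite size_behead /N !size_cat /= size_rev !size_rcons; move: szl szm hcs; clear; lia.
Qed.

End Detours.

(** * Joining arcs in the complement of other arcs *)

Section Connections.
Variable R : realType.
Notation pt := (R * R)%type.
Implicit Types (a b c e p q u v w x y z : pt) (s t h k r : R) (G O C Z U : set pt)
  (f g l m n F : seq pt) (Fs : seq (seq pt)).

Fixpoint pairwise_disjoint Fs : Prop :=
  if Fs is F :: Fs' then
    (forall F', F' \in Fs' -> forall z, supp F z -> supp F' z -> False) /\ pairwise_disjoint Fs'
  else True.

Definition suppU Fs : set pt := [set z | exists2 F, F \in Fs & supp F z].

Lemma suppU_cons F Fs : suppU (F :: Fs) = supp F `|` suppU Fs.
Proof.
rewrite predeqE => z; split=> [[G]|[H|[G GF H]]].
- by rewrite inE => /predU1P[->|GF] H; [left|right; exists G].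
- by exists F; rewrite ?mem_head.
- by exists G => //; rewrite inE GF orbT.
Qed.

Lemma suppU_closed Fs : closed (suppU Fs).
Proof.
elim: Fs => [|F Fs IH].
  by have -> : suppU [::] = set0; [rewrite predeqE => z; split=> // -[]|exact: closed0].
by rewrite suppU_cons; apply: closedU => //; exact: supp_closed.
Qed.

(** The detour around [F] stays near [F], away from [Z] and from the arcs still to come, so it
    creates no new hits; afterwards [F] joins the forbidden set [Z]. *)
Lemma detour_all Fs O Z b l : closed Z -> open O -> pairwise_disjoint Fs ->
  {in Fs, forall F, simple F} -> (forall z, suppU Fs z -> O z /\ ~ Z z) ->
  ~ suppU Fs b -> ~ suppU Fs (last b l) ->
  (forall F v, F \in Fs -> v \in F -> ~ supp (b :: l) v) ->
  (forall z, supp (b :: l) z -> ~ Z z) ->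
  exists l', [/\ last b l' = last b l, forall z, supp (b :: l') z -> ~ Z z /\ ~ suppU Fs z,
    forall z, supp (b :: l') z -> supp (b :: l) z \/ O z &
    (size l' <= size l + \sum_(F <- Fs) (size F + 2))%N].
Proof.
move=> cZ oO; elim: Fs Z l cZ => [|F Fs IH] Z l cZ dF sF FO Fb Fl vF bZ.
  exists l; split=> //; last by rewrite big_nil addn0.
    by move=> z /bZ ?; split=> // -[].
  by left.
case: dF => dF dFs; rewrite suppU_cons in FO Fb Fl.
have FF : F \in F :: Fs by exact: mem_head.
have sub (G : seq pt) : G \in Fs -> G \in F :: Fs by rewrite inE => ->; rewrite orbT.
have o1 : open ((O `\` Z) `\` suppU Fs).
  by apply: open_diff; [exact: open_diff|exact: suppU_closed].
have [l1 [h1 h2 h3 h4]] : exists l', [/\ last b l' = last b l,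
    forall z, supp (b :: l') z -> ~ supp F z,
    forall z, supp (b :: l') z -> supp (b :: l) z \/ ((O `\` Z) `\` suppU Fs) z &
    (size l' <= size l + size F + 2)%N].
  apply: detour o1 _ _ _ _ => //.
  - exact: sF.
  - move=> z Hz; split; first by apply: FO; left.
    by move=> [G /dF]; apply.
  - by move=> ?; apply: Fb; left.
  - by move=> ?; apply: Fl; left.
  - by move=> v; exact: vF.
have [] := IH (Z `|` supp F) l1.
- by apply: closedU => //; exact: supp_closed.
- by [].
- by move=> G /sub; exact: sF.
- move=> z Hz; have [] := FO z (or_intror Hz); split=> // -[] //.
  by case: Hz => G /dF H1 H2 /H1; apply.
- by move=> H; apply: Fb; right.
- by rewrite h1 => H; apply: Fl; right.
- move=> G v GF vG /h3 [|[_]]; first exact: vF (sub _ GF) vG.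
  by apply; exists G => //; exact: supp_mem.
- by move=> z Hz [|/(h2 _ Hz) //]; case: (h3 _ Hz) => [/bZ//|[[]]].
move=> l' [k1 k2 k3 k4]; exists l'; split.
- by rewrite k1.
- move=> z /k2 [ZF Fsz]; split; first by move=> ?; apply: ZF; left.
  by rewrite suppU_cons => -[?|//]; apply: ZF; right.
- by move=> z /k3 [/h3 [|[[]]]|]; [left|right|right].
- by rewrite big_cons; apply: leq_trans k4 _; lia.
Qed.

(** A direction [(1, r)] is chosen in which neither [a] nor a point of [Vs] is seen from [b]. Then
    [x] moves in this direction; since [a] is not in it, the line from [x] to [a] turns, and each
    point of [Vs] excludes at most one position. *)
Lemma generic_point b a (Vs : seq pt) U : b <> a -> open U -> U b ->
  (forall v, v \in Vs -> v <> b /\ v <> a) ->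
  exists2 x, U x & forall v, v \in Vs -> ~ supp [:: b; x; a] v.
Proof.
move=> ba oU Ub Vab.
pose w (r : R) : pt := (1, r).
have crw v : v <> b -> ev (fun r => cross (w r) (v - b) != 0).
  move=> vb; have H : (v - b).2 != 0 \/ - (v - b).1 != 0.
    case: (eqVneq (v - b).2 0) => [e2|]; [right|by left].
    rewrite oppr_eq0; apply/eqP => e1; apply: vb; apply: ptP.
      by move: e1; rewrite !ptE; lra.
    by move: e2; rewrite !ptE; lra.
  apply: ev_mono (ev_affine_neq0 H) => d _.
  by have -> // : (v - b).2 + d * - (v - b).1 = cross (w d) (v - b); rewrite /cross /w /=; ring.
have E1 : ev (fun r => forall v, v \in a :: Vs -> cross (w r) (v - b) != 0).
  apply: ev_all => v; rewrite inE => /predU1P[->|/Vab[vb _]].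
    by apply: crw => e; apply: ba.
  exact: crw vb.
have [r _ Hr] := ev_ex E1.
have ra := Hr a (mem_head _ _).
have E2 : ev (fun s => forall v, v \in Vs -> cross (v - a) (b + s *: w r - a) != 0).
  apply: ev_all => v vV; have [vb va] := Vab v vV.
  have H : cross (v - a) (b - a) != 0 \/ cross (v - a) (w r) != 0.
    case: (eqVneq (cross (v - a) (b - a)) 0) => [e1|]; [right|by left].
    apply/eqP => e2; apply: va.
    (* [v - a] would be parallel to both [b - a] and [(1, r)]; these are independent, so it would
       vanish. *)
    have D1 : (v - a).1 * cross (w r) (a - b) = 0.
      have -> : (v - a).1 * cross (w r) (a - b) =
        (b - a).1 * cross (v - a) (w r) - (w r).1 * cross (v - a) (b - a).
        by rewrite /cross !ptE; ring.
      by rewrite e1 e2; ring.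
    have D2 : (v - a).2 * cross (w r) (a - b) = 0.
      have -> : (v - a).2 * cross (w r) (a - b) =
        (b - a).2 * cross (v - a) (w r) - (w r).2 * cross (v - a) (b - a).
        by rewrite /cross !ptE; ring.
      by rewrite e1 e2; ring.
    apply: ptP.
      by move/eqP: D1; rewrite mulf_eq0 (negbTE ra) orbF => /eqP; rewrite !ptE; lra.
    by move/eqP: D2; rewrite mulf_eq0 (negbTE ra) orbF => /eqP; rewrite !ptE; lra.
  apply: ev_mono (ev_affine_neq0 H) => s _.
  have -> // : cross (v - a) (b - a) + s * cross (v - a) (w r) =
    cross (v - a) (b + s *: w r - a) by rewrite /cross !ptE; ring.
have E3 : ev (fun s => forall z, seg b (b + s *: w r) z -> U z).
  apply: near_seg_open_r => // z /segP [t [_ e1 e2]].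
  by have -> : z = b by apply: ptP; rewrite ?e1 ?e2; ring.
have [s s0 [K2 K3]] := ev_ex (ev_and E2 E3).
exists (b + s *: w r); first by apply: K3; exact: seg_r.
move=> v vV; have [vb va] := Vab v vV; case; last case => //.
  move=> /segP [t [_ e1 e2]].
  have /eqP : cross (w r) (v - b) != 0 by apply: Hr; rewrite inE vV orbT.
  by apply; rewrite /cross !ptE e1 e2 !ptE; ring.
move=> /segP [t [_ e1 e2]]; have /eqP := K2 v vV; apply.
by rewrite /cross !ptE e1 e2 !ptE; ring.
Qed.

Lemma path_avoiding Fs O U b a : b <> a -> open O -> open U -> U b -> pairwise_disjoint Fs ->
  {in Fs, forall F, simple F} -> (forall z, suppU Fs z -> O z) ->
  ~ suppU Fs b -> ~ suppU Fs a ->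
  exists x l', [/\ U x, last b l' = a, forall z, supp (b :: l') z -> ~ suppU Fs z,
    forall z, supp (b :: l') z -> supp [:: b; x; a] z \/ O z &
    (size l' <= 2 + \sum_(F <- Fs) (size F + 2))%N].
Proof.
move=> ba oO oU Ub dF sF FO Fb Fa.
have [|x Ux Hx] := @generic_point b a (flatten Fs) U ba oU Ub.
  move=> v /flattenP [F FF vF].
  have Hv : suppU Fs v by exists F => //; exact: supp_mem.
  by split=> e; [apply: Fb|apply: Fa]; rewrite -e.
have [] := @detour_all Fs O set0 b [:: x; a] (@closed0 _) oO dF sF.
- by move=> z /FO Oz; split=> // -[].
- exact: Fb.
- exact: Fa.
- by move=> F v FF vF; apply: Hx; apply/flattenP; exists F.
- by move=> z _ [].
move=> l' [h1 h2 h3 h4]; exists x, l'; split=> //.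
by move=> z /h2 [].
Qed.

(** A connecting path must have its ends off the arcs. A short stub in the direction of the last
    edge provides such an end. *)
Lemma extend_end m b G : simple (rcons m b) -> closed G -> ~ G b ->
  exists2 b', b' <> b & forall z, seg b b' z -> (supp (rcons m b) z -> z = b) /\ ~ G z.
Proof.
move=> sm cG Gb.
have segbb z : seg b b z -> z = b.
  by move=> /segP [t [_ e1 e2]]; apply: ptP; rewrite ?e1 ?e2; ring.
have nearG C (w : pt) : closed C -> ~ C b ->
    ev (fun h => forall z, seg b (b + h *: w) z -> ~ C z).
  by move=> cC Cb; apply: near_seg_r => // z /segbb ->.
have moved (w : pt) h : 0 < h -> w <> 0 -> b + h *: w <> b.
  move=> h0 w0 /eqP; rewrite -subr_eq0 addrC addKr scaler_eq0 gt_eqF //=.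
  by move/eqP.
case/lastP: m sm => [_|m a].
  have [h h0 H] := ev_ex (nearG G ((1, 0) : pt) cG Gb).
  exists (b + h *: ((1, 0) : pt)).
    by apply: moved => // -[/eqP]; rewrite oner_eq0.
  by move=> z Hz; split=> //; exact: H.
move=> /simple_rcons2 [sm ab Hb].
have ba : b - a <> 0 by move=> /eqP; rewrite subr_eq0 => /eqP e; apply: ab.
have Sb : ~ supp (rcons m a) b.
  by move=> H; apply: ab; rewrite (Hb b) //; exact: seg_r.
have E1 := nearG (supp (rcons m a)) (b - a) (@supp_closed _ _) Sb.
have [h h0 [H1 H2]] := ev_ex (ev_and E1 (nearG G (b - a) cG Gb)).
exists (b + h *: (b - a)); first exact: moved.
move=> z Hz; split; last exact: H2.
case/supp_rcons2; first by move=> /(H1 _ Hz).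
move=> /segP [s [s01 f1 f2]]; case/segP: Hz => t [t01 e1 e2].
have N0 := sqr_norm_gt0 ab.
pose D := (b - a).1 * (z - b).1 + (b - a).2 * (z - b).2.
have D1 : D = t * h * ((b - a).1 ^+ 2 + (b - a).2 ^+ 2).
  by rewrite /D !ptE e1 e2 !ptE /=; ring.
have D2 : D = (s - 1) * ((b - a).1 ^+ 2 + (b - a).2 ^+ 2).
  by rewrite /D !ptE f1 f2 ?ptE /=; ring.
have H3 : 0 <= t * h by apply: mulr_ge0; [case/andP: t01|exact: ltW].
have : t * h = 0 by nra.
move/eqP; rewrite mulf_eq0 (gt_eqF h0) orbF => /eqP t0.
by apply: ptP; rewrite ?e1 ?e2 t0; ring.
Qed.

(** Each of the two arcs gets a stub, the free ends are joined off all arcs, and loop erasure makes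
    the whole simple. The bound is that of [path_avoiding] plus one vertex for the stubs. *)
Lemma connect_arcs m b a n Fs :
  pairwise_disjoint [:: rcons m b, a :: n & Fs] ->
  {in [:: rcons m b, a :: n & Fs], forall F, simple F} ->
  exists c : seq pt, [/\ simple (b :: rcons c a),
    forall z, supp (b :: rcons c a) z ->
      [/\ supp (rcons m b) z -> z = b, supp (a :: n) z -> z = a & ~ suppU Fs z] &
    (size c <= 3 + \sum_(F <- [:: rcons m b, a :: n & Fs]) (size F + 2))%N].
Proof.
move=> dF sF; set A := rcons m b in dF sF *; set B := a :: n in dF sF *.
have [dA [dB dFs]] := dF.
have sA : simple A by apply: sF; rewrite !inE eqxx.
have sB : simple B by apply: sF; rewrite !inE eqxx orbT.
have Ab : supp A b by apply: supp_mem; rewrite mem_rcons mem_head.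
have Ba : supp B a by exact: supp_head.
have cUF := @suppU_closed Fs.
have cA := @supp_closed _ A; have cB := @supp_closed _ B.
have AB z : supp A z -> supp B z -> False by apply: dA; rewrite inE eqxx.
have AF z : supp A z -> suppU Fs z -> False.
  by move=> Hz [F FF]; apply: dA Hz; rewrite inE FF orbT.
have BF z : supp B z -> suppU Fs z -> False by move=> Hz [F FF]; exact: dB Hz.
have [b' b'b Hb'] : exists2 b', b' <> b &
    forall z, seg b b' z -> (supp A z -> z = b) /\ ~ (supp B `|` suppU Fs) z.
  apply: extend_end => //; first exact: closedU.
  by move=> [/(AB _ Ab)|/(AF _ Ab)].
(* The second stub must also avoid the first one. *)
have [a' a'a Ha'] : exists2 a', a' <> a &
    forall z, seg a a' z -> (supp (rcons (rev n) a) z -> z = a) /\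
      ~ ((supp A `|` suppU Fs) `|` seg b b') z.
  apply: extend_end; first by rewrite -rev_cons; exact/simple_rev.
    by apply: closedU; [exact: closedU|exact: seg_closed].
  move=> [[H|/(BF _ Ba)//]|/Hb' [_]]; first exact: AB H Ba.
  by apply; left.
have Ha2 z : seg a a' z -> [/\ supp B z -> z = a, ~ supp A z, ~ suppU Fs z & ~ seg b b' z].
  move=> /Ha' [h1 h2]; split.
  - by move=> H; apply: h1; rewrite -rev_cons; apply/supp_rev.
  - by move=> H; apply: h2; left; left.
  - by move=> H; apply: h2; left; right.
  - by move=> H; apply: h2; right.
have Hb2 z : seg b b' z -> [/\ supp A z -> z = b, ~ supp B z & ~ suppU Fs z].
  move=> /Hb' [h1 h2]; split=> // H; apply: h2; [by left|by right].
have b'a' : b' <> a'.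
  by move=> e; have [_ _ _] := Ha2 a' (@seg_r _ _ _); apply; rewrite -e; exact: seg_r.
have nb' : ~ suppU [:: A, B & Fs] b'.
  have [h1 h2 h3] := Hb2 b' (@seg_r _ _ _).
  by rewrite !suppU_cons => -[/h1//|[]].
have na' : ~ suppU [:: A, B & Fs] a'.
  have [h1 h2 h3 _] := Ha2 a' (@seg_r _ _ _).
  by rewrite !suppU_cons => -[//|[/h1|]].
have [x [l' [_ h1 h2 _ h3]]] :=
  @path_avoiding _ setT setT b' a' b'a' (@openT _) (@openT _) I dF sF (fun _ _ => I) nb' na'.
have El z : supp (b' :: rcons l' a) z <-> supp (b' :: l') z \/ seg a a' z.
  have -> : b' :: rcons l' a = rcons (rcons (belast b' l') a') a.
    by rewrite -rcons_cons [b' :: l']lastI h1.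
  by rewrite supp_rcons2 -h1 -lastI (seg_sym a).
have nb : ~ supp (b' :: rcons l' a) b.
  move=> /El [/h2|/Ha2 [_ + _ _]]; last exact.
  by apply; rewrite suppU_cons; left.
have [t [l2 [t01 k1 k2 k3 k4]]] := loop_erase2 nb.
have e2 : lp b b' t :: l2 = rcons (belast (lp b b' t) l2) a.
  by rewrite lastI k2 last_rcons.
exists (belast (lp b b' t) l2); rewrite -e2; split=> //; last first.
  by rewrite size_belast; apply: leq_trans k4 _; rewrite size_rcons; lia.
move=> z /k3 [/Hb2 [g1 g2 g3]|/El [/h2|/Ha2 [g1 g2 g3 g4]]].
- by split=> // /g2.
- rewrite !suppU_cons => H; split=> H'; (exfalso; apply: H);
    [by left|by right; left|by right; right].
- by split=> // /g2.
Qed.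

End Connections.

(** * Closing an arc over a high vertex *)

Section ClosedPolylines.
Variable R : realType.
Notation pt := (R * R)%type.
Implicit Types (a b e p q u v w x y z : pt) (s t h k r X H M : R) (G O C Z U : set pt)
  (c f l m n F A K : seq pt) (Fs : seq (seq pt)) (g : nat).

Definition csupp K : set pt :=
  if K is x :: l then supp (x :: l) `|` seg (last x l) x else set0.

Definition csimple K : Prop :=
  if K is x :: l then
    [/\ simple (x :: l), last x l <> x &
        forall z, seg (last x l) x z -> supp (x :: l) z -> z = last x l \/ z = x]
  else False.

(* The polygon goes up vertically from [p] to [u], then to the left to [w],
   and nothing lies above [u]. *)
Definition top_turn K : Prop := exists j p u w K',
  [/\ rot j K = [:: p, u, w & K'], p.1 = u.1 /\ p.2 < u.2, w.1 < u.1 &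
      forall z, csupp K z -> z.1 = u.1 -> z.2 <= u.2].

Lemma convex_lt (B r s t : R) : r < B -> s < B -> 0 <= t <= 1 -> r + t * (s - r) < B.
Proof.
move=> rB sB t01; have : 0 <= (1 - t) * (B - r) by apply: mulr_ge0; lra.
have : 0 <= t * (B - s) by apply: mulr_ge0; lra.
case: (eqVneq t 0) => [->|t0]; first by lra.
have : 0 < t * (B - s) by apply: mulr_gt0; [rewrite lt_neqAle eq_sym t0; case/andP: t01|lra].
lra.
Qed.

Lemma supp_bound l : exists H, forall z, supp l z -> z.2 < H.
Proof.
elim: l => [|x [|y l] [H IH]]; first by exists 0.
  by exists (x.2 + 1) => z ->; rewrite ltrDl.
exists (Num.max H (x.2 + 1)) => z [|/IH]; last by rewrite lt_max => ->.
move=> /segP [t [t01 _ ->]].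
have yH : y.2 < H by apply: IH; exact: supp_head.
have : y.2 < Num.max H (x.2 + 1) by rewrite lt_max yH.
have : x.2 < Num.max H (x.2 + 1) by rewrite lt_max ltrDl ltr01 orbT.
by move=> *; exact: convex_lt.
Qed.

Lemma supp_rcons_cat m b l z :
  supp (rcons m b ++ l) z <-> supp (rcons m b) z \/ supp (b :: l) z.
Proof. by rewrite cat_rcons supp_catP. Qed.

Lemma simple_merge m b l : simple (rcons m b) -> simple (b :: l) ->
  (forall z, supp (rcons m b) z -> supp (b :: l) z -> z = b) -> simple (rcons m b ++ l).
Proof. by move=> *; rewrite cat_rcons; apply/simple_catP. Qed.

(** Repeatedly halving the first edge adds straight-angle vertices without changing the support or
    the direction at [b]. *)
Lemma pad b y l (k : nat) : simple (b :: y :: l) -> exists y' l',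
  [/\ size l' = (size l + k)%N, simple (b :: y' :: l'),
      forall z, supp (b :: y' :: l') z <-> supp (b :: y :: l) z,
      last y' l' = last y l & exists2 t, 0 < t <= 1 & y' = lp b y t].
Proof.
elim: k => [|k IH] sl.
  exists y, l; split=> //; first by rewrite addn0.
  by exists 1; rewrite ?lp1 // ltr01 lexx.
have [y' [l' [h1 h2 h3 h4 [t t01 h5]]]] := IH sl.
have half : 0 < (1 / 2 : R) < 1 by lra.
have half' : 0 <= (1 / 2 : R) <= 1 by lra.
exists (lp b y' (1 / 2)), (y' :: l'); split=> //.
- by rewrite /= h1 addnS.
- exact: (simple_insert (l1 := [::]) half).
- by move=> z; rewrite -h3; exact: (supp_insert [::]).
- exists (1 / 2 * t); first by lra.
  by rewrite h5; apply: ptP; rewrite !ptE; ring.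
Qed.

Lemma open_below H : open [set z : pt | z.2 < H].
Proof.
have -> : [set z : pt | z.2 < H] = snd @^-1` [set x | x < H] by [].
by apply: open_comp; [move=> x _; exact: cvg_snd|exact: open_lt].
Qed.

(** The half-plane below [H] serves both as neighbourhood for the detours and as place for the
    generic point, so only the final vertex reaches the height [H]. *)
Lemma connect_up m b X H : simple (rcons m b) -> (forall z, supp (rcons m b) z -> z.2 < H) ->
  exists c, [/\ simple (b :: rcons c (X, H)),
    forall z, supp (b :: rcons c (X, H)) z ->
      (supp (rcons m b) z -> z = b) /\ (z.2 < H \/ z = (X, H)) &
    (size c <= size m + 5)%N].
Proof.
move=> sA AH; set A := rcons m b in sA AH *; set p : pt := (X, H).
have Ab : supp A b by apply: supp_mem; rewrite mem_rcons mem_head.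
have oU := @open_below H.
have [b' b'b Hb'] : exists2 b', b' <> b & forall z, seg b b' z ->
    (supp A z -> z = b) /\ ~ (~` [set z : pt | z.2 < H]) z.
  apply: extend_end => //; first exact: open_closedC.
  by apply; exact: AH.
have {}Hb' z : seg b b' z -> (supp A z -> z = b) /\ z.2 < H.
  by move=> /Hb' [h1 /contrapT].
have [Hb1 Hb2] := Hb' b' (@seg_r _ _ _).
have b'p : b' <> p by move=> e; move: Hb2; rewrite e /p /= ltxx.
have UA : suppU [:: A] = supp A.
  by rewrite suppU_cons predeqE => z; split=> [[//|[]//]|]; left.
have [] := @path_avoiding _ [:: A] _ _ b' p b'p oU oU Hb2.
- by [].
- by move=> F; rewrite inE => /eqP ->.
- by rewrite UA.
- by rewrite UA => /Hb1.
- by rewrite UA => /AH; rewrite /p /= ltxx.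
move=> x [l' [xH h1 h2 h3]]; rewrite big_seq1 UA in h2 * => h4.
have nb : ~ supp (b' :: l') b by move=> /h2.
have [t [l2 [t01 k1 k2 k3 k4]]] := loop_erase2 nb.
have e2 : lp b b' t :: l2 = rcons (belast (lp b b' t) l2) p by rewrite lastI k2 h1.
exists (belast (lp b b' t) l2); rewrite -e2; split=> //; last first.
  rewrite size_belast; move: k4 h4; rewrite /A size_rcons; clear; lia.
move=> z /k3 [/Hb' [? ?]|Hz]; first by split=> //; left.
split; first by move=> /(h2 _ Hz).
case: (h3 _ Hz) => [|?]; last by left.
have low q z' : q.2 < H -> seg b' q z' -> z'.2 < H.
  by move=> qH /segP [s [s01 _ ->]]; exact: convex_lt.
case; first by move/(low x) => ?; left; auto.
case; last by right.
move=> /segP [s [s01 e1 e3]]; case: (eqVneq s 1) => [s1|s1].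
  by right; apply: ptP; rewrite ?e1 ?e3 s1; ring.
left; rewrite e3 /p /=; have s1' : s < 1 by rewrite lt_neqAle s1; case/andP: s01.
have : 0 < (1 - s) * (H - x.2) by rewrite mulr_gt0 // subr_gt0.
lra.
Qed.

Lemma ray_closed X H : closed [set z : pt | z.1 = X /\ H <= z.2].
Proof.
have -> : [set z : pt | z.1 = X /\ H <= z.2] =
   (fst @^-1` [set X]) `&` (snd @^-1` [set x | H <= x]) by [].
apply: closedI; apply: preimage_closed.
- by move=> x _; exact: cvg_fst.
- by apply: compact_closed; [exact: norm_hausdorff|exact: compact_set1].
- by move=> x _; exact: cvg_snd.
- exact: closed_ge.
Qed.

(** The given polyline is the arc read backwards, so its right side ([k = -1]) is the left side of
    the arc. The new path must also avoid the vertical ray above [u], so that nothing lies above the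
    top vertex. *)
Lemma close_hug X H n a : let p : pt := (X, H) in let u : pt := (X, H + 1) in
  simple [:: u, p & rcons n a] -> (forall z, supp (p :: rcons n a) z -> z.2 <= H) ->
  exists w c, [/\ w.1 < X, simple (u :: w :: rcons c a),
    forall z, supp (u :: w :: rcons c a) z ->
      (supp [:: u, p & rcons n a] z -> z = u \/ z = a) /\ (z.1 = X -> H + 1 <= z.2 -> z = u) &
    (size c <= size n + 1)%N].
Proof.
(* Prolonging the polyline to [u'] makes [u] an inner vertex with a sector to start from. The edge
   [u' u] blocks the lower part of the ray above [u]; the rest of the ray is removed by [O]. *)
move=> p u sW lowW; pose u' : pt := (X, H + 2).
set W0 := [:: u, p & rcons n a] in sW *.
have low2 z : seg u p z -> z.1 = X /\ z.2 <= H + 1.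
  move=> /segP [t [t01 -> ->]]; rewrite /u /p /=; split; [ring|lra].
have lowW0 z : supp W0 z -> z.2 <= H + 1.
  by case=> [/low2[]//|/lowW]; lra.
have up z : seg u' u z -> z.1 = X /\ H + 1 <= z.2.
  move=> /segP [t [t01 -> ->]]; rewrite /u /u' /=; split; [ring|lra].
have upu z : z.1 = X -> H + 1 <= z.2 -> z.2 <= H + 1 -> z = u.
  by move=> h1 h2 h3; apply: ptP; rewrite /u /= ?h1 //; lra.
have sW' : simple (u' :: W0).
  split=> //; first by move=> /pair_equal_spec [_]; lra.
  by move=> z /up [h1 h2] /lowW0; exact: upu.
have [l' [a0 [b0 [eW /eqP sl' _ Hb]]]] := tail3 n u p a.
rewrite -/W0 in eW.
have eW' : u' :: W0 = (u' :: l') ++ [:: a0; b0; a] by rewrite eW.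
pose O : set pt := ~` [set z : pt | z.1 = X /\ H + 2 <= z.2].
have oO : open O by apply: closed_openC; exact: ray_closed.
have lowO z : z.2 <= H + 1 -> O z by move=> h [_]; lra.
have sW1 := sW'; rewrite eW' in sW1.
have b0a : b0 <> a by apply: (simple_neq (l1 := rcons (u' :: l') a0) (l2 := [::])); rewrite cat_rcons.
have au : a <> u.
  move=> e; have : a.2 <= H by apply: lowW; apply: supp_mem; rewrite inE mem_rcons mem_head orbT.
  by rewrite e /u /=; lra.
have k0 : (-1 : R) != 0 by rewrite oppr_eq0 oner_eq0.
set d := a - b0.
pose w0 : pt := (d.2, - d.1).
have kw : 0 < -1 * cross d w0.
  have -> : -1 * cross d w0 = d.1 ^+ 2 + d.2 ^+ 2 by rewrite /cross /w0 /=; ring.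
  exact: sqr_norm_gt0.
(* The path has to end in [a] itself: it follows the polyline up to a point beside the midpoint of
   the last edge, and a segment leads from there to [a]. *)
set y := lp b0 a (1 / 2).
have half : 0 <= (1 / 2 : R) <= 1 by lra.
set pre := u' :: l' in eW' sW1.
have oO2 : open (O `\` supp (rcons pre a0)) by apply: open_diff => //; exact: supp_closed.
have edgeO z : seg b0 a z -> (O `\` supp (rcons pre a0)) z.
  move=> Hz; have Hz' : supp [:: b0; a] z by left.
  split; last by move=> H'; exact: (simple_disj sW1 H' Hz').
  by apply: lowO; have := lowW _ (Hb _ Hz'); lra.
have E1 : ev (fun h => vis (-1) (O `\` supp (rcons pre a0)) a0 b0 a [::] (y + h *: w0)).
  have half0 : 0 < (1 / 2 : R) by clear; lra.
  apply: (@first_seg R (-1) _ a0 b0 a [::] y w0 (1 / 2)) => //.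
    by move=> z /(seg_sub half); exact: edgeO.
  apply: near_seg_r; first exact: supp_closed.
  move=> z [s s01 ez] za; rewrite /= in za.
  have : lp b0 a 1 = lp b0 a (s * (1 / 2)).
    by rewrite lp1 -{1}za ez; apply: ptP; rewrite /y !ptE; field.
  by move=> /(lp_inj b0a); move: s01; clear; lra.
have E2 : ev (fun h => forall z, seg (y + h *: w0) a z -> (O `\` supp (rcons pre a0)) z).
  have := @near_seg_open _ _ y a w0 0 oO2 (fun z Hz => edgeO z (seg_sub_r half Hz)).
  by apply: ev_mono => h _; rewrite scaler0 addr0.
have eW'' : u' :: W0 = rcons pre a0 ++ [:: b0; a] by rewrite cat_rcons.
have E3 : ev (fun h => forall z, seg (y + h *: w0) a z -> ~ supp (rcons (rcons pre a0) b0) z).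
  apply: near_seg_l; first exact: supp_closed.
  move=> z Hz Hz'; have sW2 := sW'; rewrite eW'' in sW2.
  have zb := simple_edge_l sW2 Hz' (seg_sub_r half Hz).
  case: Hz => s s01; rewrite zb => eb.
  have : lp b0 a 0 = lp b0 a (1 / 2 + s * (1 - 1 / 2)).
    by rewrite lp0 {1}eb; apply: ptP; rewrite /y !ptE; ring.
  by move=> /(lp_inj b0a); move: s01; clear; lra.
have [h h0 [V [K2 K4]]] := ev_ex (ev_and E1 (ev_and E2 E3)).
have K3 z : seg (y + h *: w0) a z -> seg b0 a z -> z = a.
  move=> /segP [t [t01 e1 e2]] /cross_on_seg.
  have -> : cross (a - b0) (z - b0) = (1 - t) * h * cross d w0.
    have [w01 w02] : w0.1 = a.2 - b0.2 /\ w0.2 = - (a.1 - b0.1) by [].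
    by rewrite /cross /d /y !ptE e1 e2 /y !ptE w01 w02; ring.
  move=> /eqP; rewrite !mulf_eq0 (gt_eqF h0) orbF => /orP[/eqP t1|/eqP c0].
    by have -> : z = a; last by []; apply: ptP; rewrite ?e1 ?e2 (_ : t = 1); [ring|lra|ring|lra].
  by move: kw; rewrite c0 mulr0 ltxx.
set c0 := y + h *: w0 in V K2 K3 K4.
have [|c' [cs [/eqP h1 h2 h3 h4]]] := parallel_path k0 sW1 oO _ V.
  by rewrite -eW' => z; rewrite [behead _]/= => /lowW0; exact: lowO.
rewrite -eW' in h3 h4; case: h3 => V1 V2 V3 _.
have supp2 z : supp (c' :: rcons cs a) z <-> supp (c' :: cs) z \/ seg c0 a z.
  have -> : c' :: rcons cs a = rcons (rcons (belast c' cs) c0) a by rewrite -h2 -lastI.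
  by rewrite supp_rcons2 -h2 -lastI.
have c0a z : seg c0 a z -> O z /\ (supp (u' :: W0) z -> z = a).
  move=> Hz; have [Oz _] := K2 z Hz; split=> //.
  rewrite eW'' => /supp_catP [/(K4 _ Hz)//|[|->//]]; exact: K3.
have nu : ~ supp (c' :: rcons cs a) u.
  have Wu : supp (u' :: W0) u by right; exact: supp_head.
  by move=> /supp2 [/h4 [_]//|/c0a [_ /(_ Wu)] e]; apply: au.
have [t [l2 [t01 k1 k2 k3 k4]]] := loop_erase2 nu.
set w := lp u c' t in k1 k2 k3.
have t01' : 0 <= t <= 1 by case/andP: t01 => t0 ->; rewrite ltW.
have Sz z : supp (u :: w :: l2) z -> O z /\ (supp (u' :: W0) z -> z = u \/ z = a).
  move=> /k3 [Hz|/supp2 [/h4[? ?]|/c0a[? Ha]]].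
  - by split; [exact: V2|move=> H1; left; exact: V1].
  - by split.
  - by split=> // /Ha ->; right.
(* For [k = -1] and the vertical edge [u p], visibility places [c'] to the left; loop erasure only
   shortens the edge [u c']. *)
have wX : w.1 < X.
  have cX : c'.1 < X by move: V3; rewrite /cross !ptE /u /p /=; lra.
  have t0 : 0 < t by case/andP: t01.
  have : 0 < t * (X - c'.1) by rewrite mulr_gt0 // subr_gt0.
  by rewrite /w lpE1 /u /=; lra.
have e2 : w :: l2 = rcons (belast w l2) a by rewrite lastI k2 last_rcons.
have sz : size l2 = size (rcons (behead (belast w l2)) a).
  case: (l2) k2 => [|x l3] /=; last by rewrite size_rcons size_belast.
  rewrite last_rcons => wa; exfalso.
  have [_] := Sz w (or_intror (supp_head _ _)).
  have Wa : supp (u' :: W0) w.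
    by rewrite wa; apply: supp_mem; rewrite /W0 !inE mem_rcons mem_head !orbT.
  have uw : u <> w by case: k1.
  move=> _; apply: (uw); apply/esym; apply: V1 => //; first exact: (ex_intro2 _ _ t t01' (erefl _)).
exists w, (behead (belast w l2)).
have -> : w :: rcons (behead (belast w l2)) a = w :: l2.
  by move: e2 sz; case: (l2) => [|x l3] //= [->].
split=> //; last first.
  by move: k4 sz; rewrite !size_rcons (eqP h1) /pre /= (eqP sl'); clear; lia.
move=> z Hz; have [Oz Nz] := Sz z Hz; split; first by move=> H1; apply: Nz; right.
move=> zX zH.
have [|//|za] := Nz _; last first.
  exfalso; have aH : a.2 <= H by apply: lowW; apply: supp_mem; rewrite inE mem_rcons mem_head orbT.
  by move: zH aH; rewrite za; clear; lra.
case: (leP (H + 2) z.2) => zH2; first by exfalso; apply: Oz.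
left; apply/segP; exists (H + 2 - z.2); split; first by lra.
  by rewrite /u' /u /= zX; ring.
by rewrite /u' /u /=; ring.
Qed.

End ClosedPolylines.

(** * The closed polygon with its top vertex *)

Section TopVertex.
Variable R : realType.
Notation pt := (R * R)%type.
Implicit Types (a b e p q u v w x y z : pt) (s t h k r X H M : R) (G O C Z U : set pt)
  (c f l m n F A K : seq pt) (Fs : seq (seq pt)) (g : nat).

Lemma csimple_close m u n a w c : rcons m u = a :: n -> simple (rcons m u) ->
  simple (u :: w :: rcons c a) ->
  (forall z, supp (rcons m u) z -> supp (u :: w :: rcons c a) z -> z = u \/ z = a) ->
  csimple (rcons m u ++ w :: c) /\
  forall z, csupp (rcons m u ++ w :: c) z <-> supp (rcons m u) z \/ supp (u :: w :: rcons c a) z.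
Proof.
move=> eL sL sc cap; set L := rcons m u in eL sL cap *.
have [e1 e2] : last u (w :: c) = last w c /\ u :: w :: rcons c a = rcons (rcons (u :: belast w c) (last w c)) a.
  by split=> //; rewrite rcons_cons -lastI.
have := sc; rewrite e2 => /simple_rcons2 []; rewrite rcons_cons -lastI => sc' la hla.
have suppc z : supp (u :: w :: rcons c a) z <-> supp (u :: w :: c) z \/ seg (last w c) a z.
  by rewrite e2 supp_rcons2 rcons_cons -lastI.
have na : ~ supp (u :: w :: c) a.
  by move=> H; apply: la; rewrite (hla a H (@seg_r _ _ _)).
have ua : u <> a by move=> e; apply: na; rewrite -e; exact: supp_head.
have capK z : supp L z -> supp (u :: w :: c) z -> z = u.
  move=> h1 h2; case: (cap z h1) => //; first by apply/suppc; left.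
  by move=> za; exfalso; apply: na; rewrite -za.
have eK : L ++ w :: c = a :: (n ++ w :: c) by rewrite eL.
have lK : last a (n ++ w :: c) = last w c by rewrite last_cat.
have sK : simple (L ++ w :: c) by apply: simple_merge.
have suppK z : supp (L ++ w :: c) z <-> supp L z \/ supp (u :: w :: c) z.
  exact: supp_rcons_cat.
have csuppK z : csupp (L ++ w :: c) z <-> supp L z \/ supp (u :: w :: rcons c a) z.
  by rewrite eK /csupp lK -eK suppc -or_assoc -suppK.
split=> //; rewrite eK /csimple lK -eK; split=> // z Hz /suppK [HL|Hc].
  right; have Hz' : supp (u :: w :: rcons c a) z by apply/suppc; right.
  case: (cap z HL Hz') => // zu; exfalso.
  have [uw H _] := sc; apply: uw; rewrite -zu; apply: H; first by rewrite zu; exact: seg_l.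
  by rewrite -rcons_cons [w :: c]lastI; apply/supp_rcons2; right.
by left; exact: hla.
Qed.

(** Apart from [p], everything drawn so far lies strictly below [H], so the vertical edge to [u]
    creates no crossing. *)
Lemma raise m b X H c : let p : pt := (X, H) in let u : pt := (X, H + 1) in
  simple (rcons m b) -> (forall z, supp (rcons m b) z -> z.2 < H) ->
  simple (b :: rcons c p) ->
  (forall z, supp (b :: rcons c p) z -> (supp (rcons m b) z -> z = b) /\ (z.2 < H \/ z = p)) ->
  let L := rcons (rcons (rcons m b ++ c) p) u in
  [/\ simple L,
      forall z, supp L z <-> [\/ supp (rcons m b) z, supp (b :: rcons c p) z | seg p u z],
      forall z, supp (rcons (rcons m b ++ c) p) z -> z.2 <= H &
      forall z, supp L z -> z.1 = X -> z.2 <= H + 1].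
Proof.
move=> p u sA lowA sc hc L.
have seg_up z : seg p u z -> H <= z.2 <= H + 1 /\ z.1 = X.
  by move=> /segP [t [t01 -> ->]]; rewrite /p /u /=; split; [lra|ring].
have S1 z : supp (rcons (rcons m b ++ c) p) z <-> supp (rcons m b) z \/ supp (b :: rcons c p) z.
  by rewrite rcons_cat supp_rcons_cat.
have low z : supp (rcons (rcons m b ++ c) p) z -> z.2 < H \/ z = p.
  by move=> /S1 [/lowA|/hc [_]]; [left|].
have S2 z : supp L z <-> [\/ supp (rcons m b) z, supp (b :: rcons c p) z | seg p u z].
  rewrite supp_rcons2 S1; split=> [[[]|]|[]]; try tauto.
  - by constructor 1.
  - by constructor 2.
  - by constructor 3.
have low' z : supp (rcons (rcons m b ++ c) p) z -> z.2 <= H.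
  by move=> /low [/ltW//|->].
split=> //.
- apply/simple_rcons2; split.
  + by rewrite rcons_cat; apply: simple_merge => // z h1 h2; case: (hc z h2) => h3 _; exact: h3.
  + by rewrite /p /u => /pair_equal_spec [_]; lra.
  + by move=> z /low [zH|//] /seg_up [h1 _]; exfalso; lra.
- by move=> z /supp_rcons2 [/low'|/seg_up [h1 _]] *; lra.
Qed.

(** Let [s] be the size of the reduced arc. The way up takes at most [s + 4] vertices, [p], [u] and
    [w] are three more, and the way back takes at most [2 * s + 4]. Paths built for the reduced arc
    fit the drawn one, as the supports agree. *)
Lemma close_top m b m0 a n n0 g M :
  rcons m b = a :: n -> rcons m0 b = a :: n0 -> simple (rcons m b) -> simple (rcons m0 b) ->
  (forall z, supp (rcons m b) z <-> supp (rcons m0 b) z) ->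
  (3 * size (rcons m0 b) + 11 <= g)%N ->
  exists c, [/\ size c = g, csimple (rcons m b ++ c), top_turn (rcons m b ++ c) &
    exists2 z, z \in rcons m b ++ c & M <= z.2].
Proof.
move=> eA eA0 sA sA0 eS hg.
have [H0 lowH0] := supp_bound (rcons m0 b); pose H := Num.max H0 M.
have HM : M <= H by rewrite le_max lexx orbT.
have lowA0 z : supp (rcons m0 b) z -> z.2 < H by move=> /lowH0; rewrite lt_max => ->.
have lowA z : supp (rcons m b) z -> z.2 < H by move=> /eS; exact: lowA0.
set p : pt := (0, H); set u : pt := (0, H + 1).
have [c1 [sc1 hc1 szc1]] := connect_up 0 sA0 lowA0.
have [sL0 SL0 low0 _] := raise sA0 lowA0 sc1 hc1; rewrite -/p -/u in sL0 SL0 low0 sc1 hc1.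
set L0 := rcons (rcons (rcons m0 b ++ c1) p) u in sL0 SL0.
have eW : rev L0 = [:: u, p & rcons (rev (n0 ++ c1)) a].
  by rewrite /L0 !rev_rcons eA0 cat_cons rev_cons.
have sW : simple (rev L0) by apply/simple_rev.
have lowW z : supp (p :: rcons (rev (n0 ++ c1)) a) z -> z.2 <= H.
  move=> Hz; apply: low0; apply/supp_rev.
  by rewrite rev_rcons eA0 cat_cons rev_cons.
rewrite eW in sW.
have [w [c [wX sc hc szc]]] := close_hug sW lowW.
rewrite -/p -/u -eW in sc hc.
have [y [l ey]] : exists y l, rcons c1 p = y :: l.
  by case: (c1) => [|y l]; [exists p, [::]|exists y, (rcons l p)].
(* All surplus vertices go on the first edge of the way up, after the way back has been built from
   the unpadded version. *)
rewrite ey in sc1; have [y' [l' [szl' sl' Sl' ll' _]]] := pad (g - 3 - size c - size c1) sc1.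
have lp' : last y' l' = p by rewrite ll' -(last_cons p) -ey last_rcons.
have szm : size m0 = size n0 by have := congr1 size eA0; rewrite size_rcons /= => -[].
set c1' := belast y' l'.
have ec1' : y' :: l' = rcons c1' p by rewrite lastI lp'.
have szc1' : size c1' = (g - 3 - size c)%N.
  rewrite size_belast szl'; have := congr1 size ey; rewrite size_rcons /=.
  by move: szc szc1 hg szm; rewrite size_rev size_cat size_rcons; clear; lia.
rewrite ec1' in sl' Sl'; rewrite -ey in Sl'.
have hc1' z : supp (b :: rcons c1' p) z ->
   (supp (rcons m b) z -> z = b) /\ (z.2 < H \/ z = p).
  by move=> /Sl' /hc1 [h1 h2]; split=> // /eS.
have [sL SL _ lowL] := raise sA lowA sl' hc1'; rewrite -/p -/u in sL SL lowL.
set L := rcons (rcons (rcons m b ++ c1') p) u in sL SL lowL.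
have LL0 z : supp L z <-> supp L0 z.
  rewrite SL SL0; split=> -[/eS|/Sl'|] ?;
    by [constructor 1|constructor 2|constructor 3].
have eL : L = a :: (rcons (rcons (n ++ c1') p) u) by rewrite /L eA.
have [|cK SK] := csimple_close eL sL sc.
  by move=> z /LL0 /supp_rev h1 /hc [h2 _]; exact: h2.
exists (rcons (rcons c1' p) u ++ w :: c).
have eK : rcons m b ++ (rcons (rcons c1' p) u ++ w :: c) = L ++ w :: c.
  by rewrite /L catA -!rcons_cat.
rewrite eK; split=> //.
- rewrite size_cat !size_rcons szc1' /=; move: szc szc1 hg szm.
  by rewrite size_rev size_cat size_rcons; clear; lia.
- exists (size (rcons m b ++ c1')), p, u, w, (c ++ (rcons m b ++ c1')); split=> //.
  + have -> : L ++ w :: c = (rcons m b ++ c1') ++ [:: p, u, w & c] by rewrite /L !cat_rcons.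
    by rewrite rot_size_cat.
  + by split=> //; rewrite /p /u /=; lra.
  + move=> z /SK [Hz zu|Hz zu]; first exact: lowL.
    case: (leP z.2 (H + 1)) => // zH.
    have [_ h2] := hc z Hz; have := h2 zu (ltW zH) => zu'.
    by move: zH; rewrite zu' /u /= ltxx.
- exists u; first by rewrite /L mem_cat mem_rcons mem_head.
  by rewrite /u /=; lra.
Qed.

End TopVertex.

(** * Winding number and orientation *)

Section Winding.
Variables (R : realType) (n : nat) (Q : 'I_n -> R * R).
Notation pt := (R * R)%type.
Implicit Types (a b p q u v w x y z : pt) (s t h k M : R) (A G O : set pt) (i j : 'I_n).

Notation edge i := (seg (Q i) (Q (ordS i))).

Definition edges (r : seq 'I_n) : set pt := [set z | exists2 i, i \in r & edge i z].

Lemma edges_closed r : closed (edges r).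
Proof.
elim: r => [|i r IH].
  by have -> : edges [::] = set0; [rewrite predeqE => z; split=> // -[]|exact: closed0].
have -> : edges (i :: r) = edge i `|` edges r.
  rewrite predeqE => z; split=> [[j]|[H|[j jr H]]].
  - by rewrite inE => /predU1P[->|jr] H; [left|right; exists j].
  - by exists i; rewrite ?mem_head.
  - by exists j => //; rewrite inE jr orbT.
by apply: closedU => //; exact: seg_closed.
Qed.

Lemma boundaryE : boundary Q = edges (enum 'I_n).
Proof.
rewrite predeqE => z; split=> [[i [t [t01 ->]]]|[i _ [t t01 ->]]].
  by exists i; rewrite ?mem_enum //; exists t.
by exists i, t.
Qed.

Lemma boundary_edge i z : edge i z -> boundary Q z.
Proof. by move=> [t t01 ->]; exists i, t. Qed.

Lemma boundary_closed : closed (boundary Q).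
Proof. by rewrite boundaryE; exact: edges_closed. Qed.

Lemma seg_convex a b q p t : 0 <= t <= 1 -> seg a b q -> seg a b p -> seg a b (lp q p t).
Proof.
move=> t01 /segP [r [r01 e1 e2]] /segP [s [s01 f1 f2]]; apply/segP.
exists (r + t * (s - r)); split.
- have : 0 <= t * s by apply: mulr_ge0; lra.
  have : 0 <= (1 - t) * r by apply: mulr_ge0; lra.
  have : 0 <= t * (1 - s) by apply: mulr_ge0; lra.
  have : 0 <= (1 - t) * (1 - r) by apply: mulr_ge0; lra.
  lra.
- by rewrite lpE1 e1 f1; ring.
- by rewrite lpE2 e2 f2; ring.
Qed.

(* The side of the edge [a b] on a vertical line does not change along a segment that
   avoids the edge. *)
Lemma above_seg a b q q' z z' : seg a b q -> seg a b q' -> q.1 = z.1 -> q'.1 = z'.1 ->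
  (forall x, seg z z' x -> ~ seg a b x) -> (z.2 < q.2) = (z'.2 < q'.2).
Proof.
move=> Hq Hq' e e' H.
pose D0 := q.2 - z.2; pose D1 := q'.2 - z'.2.
have key : D0 * D1 <= 0 -> False.
  move=> D01.
  have [t t01 Dt] : exists2 t, 0 <= t <= 1 & D0 + t * (D1 - D0) = 0.
    case: (eqVneq D0 0) => [->|D00]; first by exists 0; rewrite ?mul0r ?addr0 // lexx ler01.
    have D2 : 0 < D0 * D0 by rewrite -expr2 exprn_even_gt0.
    have D3 : D0 - D1 != 0.
      apply/eqP => d; have e1 : D1 = D0 by lra.
      by move: D01; rewrite e1; lra.
    have D4 : 0 < (D0 - D1) ^+ 2 by rewrite exprn_even_gt0.
    exists (D0 / (D0 - D1)); last by field.
    have -> : D0 / (D0 - D1) = (D0 * (D0 - D1)) / ((D0 - D1) ^+ 2) by field.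
    rewrite divr_ge0 ?(ltW D4) //=; last by lra.
    by rewrite ler_pdivrMr // mul1r; nra.
  apply: (H (lp z z' t)); first by exists t.
  have -> : lp z z' t = lp q q' t; last exact: seg_convex.
  apply: ptP; rewrite !ptE ?e ?e' //.
  by move: Dt; rewrite /D0 /D1; lra.
rewrite -subr_gt0 -[RHS]subr_gt0 -/D0 -/D1.
apply/idP/idP => h0; rewrite ltNge; apply/negP => h1; apply: key; nra.
Qed.

Definition above i z : bool :=
  `[< exists2 q, edge i q & q.1 = z.1 /\ z.2 < q.2 >].

(** The comparison is half-open: a vertex on the vertical line counts as lying to the left, so
    vertical edges contribute nothing and a crossing at a vertex is counted once. *)
Definition ind i z : R := ((Q i).1 <= z.1)%R%:R.

(* The winding number, as a signed count of the edges met by the upward ray from [z]. *)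
Definition wn z : R := \sum_i (above i z)%:R * (ind i z - ind (ordS i) z).

Lemma above_pt i z q : ~ edge i z -> edge i q -> q.1 = z.1 -> above i z = (z.2 < q.2).
Proof.
move=> Hz Hq e; apply/asboolP/idP => [[q' Hq' [e' h]]|h]; last by exists q.
rewrite (@above_seg (Q i) (Q (ordS i)) q q' z z) // => x /segP [t [_ e1 e2]].
by have -> : x = z by apply: ptP; rewrite ?e1 ?e2; ring.
Qed.

Lemma ind_neq i z : ind i z != ind (ordS i) z -> exists2 q, edge i q & q.1 = z.1.
Proof.
move=> H; have ne : (Q i).1 != (Q (ordS i)).1 by apply: contra H => /eqP; rewrite /ind => ->.
have d0 : (Q (ordS i)).1 - (Q i).1 != 0 by rewrite subr_eq0 eq_sym.
exists (lp (Q i) (Q (ordS i)) ((z.1 - (Q i).1) / ((Q (ordS i)).1 - (Q i).1))); last first.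
  by rewrite lpE1; field.
eexists; last reflexivity.
move: H; rewrite /ind; case: (leP (Q i).1 z.1) => h1; case: (leP (Q (ordS i)).1 z.1) => h2;
  rewrite ?eqxx // => _.
- have d : 0 < (Q (ordS i)).1 - (Q i).1 by lra.
  by rewrite divr_ge0 ?ler_pdivrMr //=; lra.
- have d : (Q (ordS i)).1 - (Q i).1 < 0 by lra.
  by rewrite ler_ndivrMr // ler_ndivlMr //; lra.
Qed.

Lemma sum_ordS (F : 'I_n -> R) : \sum_i F (ordS i) = \sum_i F i.
Proof. by rewrite [RHS](reindex_inj (@ordS_inj n)). Qed.

(** Single summands may change when the vertical line passes a vertex, but the sum does not. The
    change at edge [i] is [above i z] times [D i - D (ordS i)], and [D] vanishes at vertices off the
    vertical line of [z]. At a vertex on it, the two adjacent edges agree on [above], so the changes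
    telescope around the cycle. *)
Lemma wn_near z : ~ boundary Q z -> exists2 e, 0 < e &
  forall z', ball z e z' -> ~ boundary Q z' /\ wn z' = wn z.
Proof.
move=> Hz.
have [e0 e00 He0] : exists2 e, 0 < e & ball z e `<=` ~` boundary Q.
  have : nbhs z (~` boundary Q).
    by apply: open_nbhs_nbhs; split=> //; exact: closed_openC boundary_closed.
  by move=> /nbhs_ballP [e /= e0 H]; exists e.
have [e [e1 He]] : ev (fun e => forall i, i \in enum 'I_n -> (Q i).1 != z.1 -> e < `|(Q i).1 - z.1|).
  apply: ev_all => i _; case: (eqVneq (Q i).1 z.1) => [->|ne]; first exact: evT.
  by apply: ev_mono (ev_lt _) => [d _ H _|]; [exact: H|rewrite normr_gt0 subr_eq0].
(* [e / 2] is below the horizontal distance from [z] to every vertex off its vertical line. *)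
pose d := Num.min e0 (e / 2).
have d0 : 0 < d by rewrite lt_min e00 /=; lra.
have Hd i : (Q i).1 != z.1 -> d < `|(Q i).1 - z.1|.
  move=> ne; have := He (e / 2) _ i (mem_enum _ _) ne.
  have : d <= e / 2 by rewrite ge_min lexx orbT.
  by move=> h1 h2; apply: le_lt_trans h1 _; apply: h2; lra.
exists d => // z' Bz'.
have sub x : ball z d x -> ~ boundary Q x.
  by move=> Bx; apply: He0; apply: le_ball Bx; rewrite ge_min lexx.
have segB x : seg z z' x -> ~ boundary Q x.
  move=> Hx; apply: sub; case: Bz'; rewrite /ball /= => b1 b2.
  case/segP: Hx => t [t01 x1 x2]; split; rewrite /ball /= ?x1 ?x2.
    have -> : z.1 - (z.1 + t * (z'.1 - z.1)) = t * (z.1 - z'.1) by ring.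
    rewrite normrM ger0_norm; last by case/andP: t01.
    by have := normr_ge0 (z.1 - z'.1); nra.
  have -> : z.2 - (z.2 + t * (z'.2 - z.2)) = t * (z.2 - z'.2) by ring.
  rewrite normrM ger0_norm; last by case/andP: t01.
  by have := normr_ge0 (z.2 - z'.2); nra.
have bx : `|z.1 - z'.1| < d by case: Bz'.
split; first exact: sub.
have indE i : (Q i).1 != z.1 -> ind i z' = ind i z.
  move=> /Hd h; rewrite /ind; congr (nat_of_bool _)%:R.
  move: bx; rewrite ltr_norml => bx; apply/idP/idP => h1.
    by rewrite leNgt; apply/negP => h2; move: h; rewrite gtr0_norm; lra.
  by rewrite leNgt; apply/negP => h2; move: h; rewrite ler0_norm; lra.
pose D i := ind i z' - ind i z.
have wnE' : wn z' = \sum_i (above i z)%:R * (ind i z' - ind (ordS i) z').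
  apply: eq_bigr => i _; case: (eqVneq (ind i z') (ind (ordS i) z')) => [->|ne].
    by rewrite subrr !mulr0.
  congr (_ * _); congr (nat_of_bool _)%:R.
  have [q' Hq' eq'] := ind_neq ne.
  have [q Hq eq] : exists2 q, edge i q & q.1 = z.1.
    case: (eqVneq (Q i).1 z.1) => [h|h1]; first by exists (Q i) => //; exact: seg_l.
    case: (eqVneq (Q (ordS i)).1 z.1) => [h|h2]; first by exists (Q (ordS i)) => //; exact: seg_r.
    by apply: ind_neq; rewrite -!indE.
  rewrite (@above_pt i z' q') //; last by move=> /boundary_edge; exact: sub.
  rewrite (@above_pt i z q) //; last by move=> /boundary_edge; exact: Hz.
  apply/esym; apply: (@above_seg (Q i) (Q (ordS i))) => // x /segB h /boundary_edge; exact: h.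
apply/eqP; rewrite -subr_eq0 wnE' /wn -sumrB.
have -> : \sum_i ((above i z)%:R * (ind i z' - ind (ordS i) z') -
   (above i z)%:R * (ind i z - ind (ordS i) z)) =
   \sum_i ((above i z)%:R * D i - (above (ordS i) z)%:R * D (ordS i)).
  apply: eq_bigr => i _.
  have -> : (above (ordS i) z)%:R * D (ordS i) = (above i z)%:R * D (ordS i).
    case: (eqVneq (Q (ordS i)).1 z.1) => [h|/indE h]; last by rewrite /D h subrr !mulr0.
    rewrite (@above_pt i z (Q (ordS i))) //; last 2 first.
    - by move=> /boundary_edge; exact: Hz.
    - exact: seg_r.
    rewrite (@above_pt (ordS i) z (Q (ordS i))) //; last exact: seg_l.
    by move=> /boundary_edge; exact: Hz.
  by rewrite /D; ring.
by rewrite sumrB (sum_ordS (fun i => (above i z)%:R * D i)) subrr.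
Qed.

Lemma wn_connected A z z' : connected A -> A `<=` ~` boundary Q -> A z -> A z' -> wn z' = wn z.
Proof.
move=> cA Ab Az Az'.
have oP (P : R -> Prop) : open [set y | ~ boundary Q y /\ P (wn y)].
  rewrite openE => y [by_ Py]; apply/nbhs_ballP.
  have [e e0 He] := wn_near by_; exists e => // y' /He [h1 h2].
  by split=> //; rewrite h2.
have HA : [set y | A y /\ wn y = wn z] = A; last by move: Az'; rewrite -HA => -[].
apply: cA.
- by exists z.
- exists [set y | ~ boundary Q y /\ wn y = wn z]; first exact: (oP (fun r => r = wn z)).
  rewrite predeqE => y; split=> [[h1 h2]|[h1 [_ h2]]] //=.
  by split=> //; split=> //; exact: Ab.
- exists (~` [set y | ~ boundary Q y /\ wn y <> wn z]).
    exact: (open_closedC (oP (fun r => r <> wn z))).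
  rewrite predeqE => y; split=> [[h1 h2]|[h1 h2]]; split=> //; try by case.
  by apply: contrapT => h3; apply: h2; split=> //; exact: Ab.
Qed.

Lemma seg_connected a b : connected (seg a b).
Proof.
have -> : seg a b = lp a b @` `[0, 1].
  rewrite predeqE => z; split.
    by move=> [t t01 ->]; exists t => //=; rewrite in_itv.
  by move=> [t /=]; rewrite in_itv /= => ? <-; exists t.
apply: connected_continuous_connected; first exact: segment_connected.
apply: continuous_subspaceT => x.
apply: cvgD; first exact: cvg_cst.
by apply: cvgZr_tmp; exact: cvg_id.
Qed.

Lemma wn_seg a b : (forall z, seg a b z -> ~ boundary Q z) -> wn b = wn a.
Proof.
move=> H; apply: (@wn_connected (seg a b));
  [exact: seg_connected|exact: H|exact: seg_l|exact: seg_r].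
Qed.

(** The winding number is constant on the component and zero outside a large square, so the
    component is bounded. To the left, to the right and above the square all summands vanish; below
    it every edge that counts lies above, and the sum telescopes. *)
Lemma wn_enclosed z : ~ boundary Q z -> wn z != 0 -> enclosed Q z.
Proof.
move=> bz wz; split=> //.
set C := connected_component _ _.
have Cb : C `<=` ~` boundary Q by exact: connected_component_sub.
have wC y : C y -> wn y != 0.
  move=> Cy; rewrite (@wn_connected C z y) //.
  - exact: component_connected.
  - exact: connected_component_refl.
pose M := \sum_i (`|(Q i).1| + `|(Q i).2|).
have HM i : `|(Q i).1| <= M /\ `|(Q i).2| <= M.
  have : `|(Q i).1| + `|(Q i).2| <= M.
    rewrite /M (bigD1 i) //= lerDl; apply: sumr_ge0 => j _; exact: addr_ge0.
  by have := normr_ge0 (Q i).1; have := normr_ge0 (Q i).2; lra.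
have bnd y : C y -> `|y| <= M.
  move=> /wC wy; rewrite leNgt; apply/negP => hM; move/negP: wy; apply; apply/eqP.
  have yM : [\/ y.1 < - M, M < y.1, y.2 < - M | M < y.2].
    move: hM; rewrite prod_normE /= lt_max !ltr_normr => /orP[/orP[]|/orP[]] h.
    - by constructor 2.
    - by constructor 1; lra.
    - by constructor 4.
    - by constructor 3; lra.
  have HQ i : - M <= (Q i).1 <= M /\ - M <= (Q i).2 <= M.
    by case: (HM i); rewrite !ler_norml.
  have lowQ i q : edge i q -> - M <= q.2 <= M.
    move=> /segP [t [t01 _ ->]]; have [_ h1] := HQ i; have [_ h2] := HQ (ordS i).
    have : 0 <= t * (M - (Q (ordS i)).2) by apply: mulr_ge0; lra.
    have : 0 <= (1 - t) * (M - (Q i).2) by apply: mulr_ge0; lra.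
    have : 0 <= t * ((Q (ordS i)).2 + M) by apply: mulr_ge0; lra.
    have : 0 <= (1 - t) * ((Q i).2 + M) by apply: mulr_ge0; lra.
    lra.
  case: yM => hy.
  - apply: big1 => i _; rewrite /ind.
    have [h1 _] := HQ i; have [h2 _] := HQ (ordS i).
    by rewrite !leNgt (lt_le_trans hy) ?(lt_le_trans hy) ?subrr ?mulr0 //; lra.
  - apply: big1 => i _; rewrite /ind.
    have [h1 _] := HQ i; have [h2 _] := HQ (ordS i).
    have -> : (Q i).1 <= y.1 by lra.
    have -> : (Q (ordS i)).1 <= y.1 by lra.
    by rewrite subrr mulr0.
  - have -> : wn y = \sum_i (ind i y - ind (ordS i) y).
      apply: eq_bigr => i _; case: (eqVneq (ind i y) (ind (ordS i) y)) => [->|/ind_neq [q Hq eq]].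
        by rewrite subrr mulr0.
      have -> : above i y; last by rewrite mul1r.
      by apply/asboolP; exists q => //; split=> //; have := lowQ i q Hq; lra.
    by rewrite sumrB (sum_ordS (fun i => ind i y)) subrr.
  - apply: big1 => i _; have -> : above i y = false; last by rewrite mul0r.
    by apply/asboolP => -[q /lowQ hq [_]]; lra.
exists M; split; first exact: num_real.
by move=> M' MM' y /bnd h; apply: le_trans h _; exact: ltW.
Qed.

End Winding.

(** * Counterclockwise orientation from the winding number at one edge *)

Section Orientation.
Variables (R : realType) (n : nat) (Q : 'I_n -> R * R).
Hypotheses (n3 : (3 <= n)%N) (sQ : simple_closed Q).
Notation pt := (R * R)%type.
Implicit Types (a b p q u v w x y z : pt) (s t h d : R) (A G O : set pt) (i j : 'I_n).
Notation edge i := (seg (Q i) (Q (ordS i))).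

Lemma ordS_neq i : ordS i != i.
Proof.
apply/eqP => /(congr1 val) /= e; have := ltn_ord i; move: e n3.
case: (ltnP i.+1 n) => h; first by rewrite modn_small //; clear; lia.
move=> e n3' i_n; have {}h : i.+1 = n by move: h i_n; clear; lia.
by move: e n3'; rewrite h modnn; move: h; clear; lia.
Qed.

Lemma ordSS_neq i : ordS (ordS i) != i.
Proof.
apply/eqP => /(congr1 val) /= e; have := ltn_ord i; move: e n3.
case: (ltnP i.+1 n) => h.
  rewrite (modn_small h); case: (ltnP i.+2 n) => h2; first by rewrite modn_small //; clear; lia.
  have {}h2 : i.+2 = n by move: h h2; clear; lia.
  by rewrite h2 modnn; move: h2; clear; lia.
move=> e n3' i_n; have {}h : i.+1 = n by move: h i_n; clear; lia.
move: e n3'; rewrite h modnn modn_small; last by move: n3; clear; lia.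
by move: h; clear; lia.
Qed.

(** Injectivity is known for half-open edges only, so the end of an edge is read as the start of the
    next one. *)
Lemma edge_meet i j z : i != j -> edge i z -> edge j z ->
  (j = ordS i /\ z = Q j) \/ (i = ordS j /\ z = Q i).
Proof.
move=> ij [s s01 es] [t t01 et].
have h0 : 0 <= (0 : R) < 1 by rewrite lexx ltr01.
have e0 (k : 'I_n) : edge_pt Q k 0 = Q k by rewrite /edge_pt scale0r addr0.
case: (eqVneq s 1) => [s1|s1]; case: (eqVneq t 1) => [t1|t1].
- move: es et; rewrite s1 t1 !lp1 => -> e.
  have [/ordS_inj ij' _] := sQ h0 h0 (etrans (e0 _) (etrans e (esym (e0 _)))).
  by rewrite ij' eqxx in ij.
- have t01' : 0 <= t < 1 by rewrite lt_neqAle t1; case/andP: t01 => -> ->.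
  have [ij' t0] := sQ (i := ordS i) (j := j) h0 t01' (etrans (e0 _) (etrans (esym (lp1 (Q i) _)) (etrans (esym (congr1 _ s1)) (etrans (esym es) et)))).
  by left; split=> //; rewrite et -t0 lp0.
- have s01' : 0 <= s < 1 by rewrite lt_neqAle s1; case/andP: s01 => -> ->.
  have [ij' s0] := sQ (i := i) (j := ordS j) s01' h0 (etrans (esym es) (etrans et (etrans (congr1 _ t1) (etrans (lp1 _ _) (esym (e0 _)))))).
  by right; split=> //; rewrite es s0 lp0.
- have t01' : 0 <= t < 1 by rewrite lt_neqAle t1; case/andP: t01 => -> ->.
  have s01' : 0 <= s < 1 by rewrite lt_neqAle s1; case/andP: s01 => -> ->.
  have [ij' _] := sQ s01' t01' (etrans (esym es) et).
  by rewrite ij' eqxx in ij.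
Qed.

Lemma vertex_neq i j : i != j -> Q i <> Q j.
Proof.
move=> ij e; have h0 : 0 <= (0 : R) < 1 by rewrite lexx ltr01.
have e0 (k : 'I_n) : edge_pt Q k 0 = Q k by rewrite /edge_pt scale0r addr0.
have [ij' _] := sQ h0 h0 (etrans (e0 _) (etrans e (esym (e0 _)))).
by rewrite ij' eqxx in ij.
Qed.

Definition inside_left i t : Prop :=
  ev (fun d => ~ boundary Q (edge_pt Q i t + d *: left_normal (edge_vec Q i)) /\
     wn Q (edge_pt Q i t + d *: left_normal (edge_vec Q i)) != 0).

Lemma lp_neq_l a b t : a <> b -> 0 < t -> lp a b t <> a.
Proof. by move=> ab t0 e; have := @lp_inj R a b t 0 ab; rewrite lp0 => /(_ e); lra. Qed.

Lemma seg_lp_l a b t z : a <> b -> 0 < t <= 1 -> seg (lp a b t) b z -> z <> a.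
Proof.
move=> ab t01 [s s01 ->] e; have := @lp_inj R a b (t + s * (1 - t)) 0 ab.
rewrite lp0; have -> : lp a b (t + s * (1 - t)) = lp (lp a b t) b s.
  by apply: ptP; rewrite !ptE; ring.
have h : 0 <= s * (1 - t) by apply: mulr_ge0; lra.
by move=> /(_ e); lra.
Qed.

Lemma seg_lp_r a b t z : a <> b -> 0 <= t < 1 -> seg a (lp a b t) z -> z <> b.
Proof.
move=> ab t01 [s s01 ->] e; have := @lp_inj R a b (s * t) 1 ab.
rewrite lp1; have -> : lp a b (s * t) = lp a (lp a b t) s.
  by apply: ptP; rewrite !ptE; ring.
have h : 0 <= t * (1 - s) by apply: mulr_ge0; lra.
move=> /(_ e) e1; have : t * (1 - s) = t - 1 by lra.
lra.
Qed.

Lemma cross_left_normal (a b : pt) : a <> b -> 0 < cross (b - a) (left_normal (b - a)).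
Proof.
move=> ab; have -> : cross (b - a) (left_normal (b - a)) = (b - a).1 ^+ 2 + (b - a).2 ^+ 2.
  by rewrite /cross /left_normal /=; ring.
exact: sqr_norm_gt0.
Qed.

Lemma boundary_split i j z : boundary Q z ->
  [\/ edge i z, edge j z | edges Q [seq k <- enum 'I_n | (k != i) && (k != j)] z].
Proof.
rewrite boundaryE => -[k _ Hk]; case: (eqVneq k i) => [<-|ki]; first by constructor 1.
case: (eqVneq k j) => [<-|kj]; first by constructor 2.
by constructor 3; exists k => //; rewrite mem_filter ki kj mem_enum.
Qed.

(** The corner is passed by [vis_step] with [k = 1]: a point to the left of edge [j], the point [L],
    and a point to the left of edge [i] are joined by segments off the boundary, so their winding
    numbers agree. *)
Lemma inside_left_next i t t' : 0 < t < 1 -> 0 < t' < 1 ->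
  inside_left i t -> inside_left (ordS i) t'.
Proof.
move=> t01 t'01 Hi; set j := ordS i; set k := ordS j.
have ij : i != j by rewrite eq_sym; exact: ordS_neq.
have jk : j != k by rewrite eq_sym; exact: ordS_neq.
have ik : i != k by rewrite eq_sym; exact: ordSS_neq.
have [Qij Qjk Qik] : [/\ Q i <> Q j, Q j <> Q k & Q i <> Q k].
  by split; exact: vertex_neq.
have t0 : 0 < t by case/andP: t01.
have t1 : t < 1 by case/andP: t01.
have t'0 : 0 < t' by case/andP: t'01.
have t'1 : t' < 1 by case/andP: t'01.
have t01' : 0 <= t <= 1 by rewrite !ltW.
have t'01' : 0 <= t' <= 1 by rewrite !ltW.
set x := lp (Q i) (Q j) t; set y := lp (Q j) (Q k) t'.
set others := [seq l <- enum 'I_n | (l != i) && (l != j)].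
pose O := ~` edges Q others.
have oO : open O by apply: closed_openC; exact: edges_closed.
have meet_ij z : edge i z -> edge j z -> z = Q j.
  move=> h1 h2; case: (edge_meet ij h1 h2) => [[]//|[e _]].
  by exfalso; move/eqP: ik; apply; rewrite /k -e.
have othersP l : l \in others -> (i != l) && (j != l).
  by rewrite mem_filter => /andP[/andP[h1 h2] _]; rewrite ![_ == l]eq_sym h1.
have sV0 : simple [:: Q i; Q j; Q k].
  split=> // z h1 [h2|h2]; first exact: meet_ij.
  by apply: meet_ij => //; rewrite (h2 : z = Q k); exact: seg_r.
have sV : simple [:: Q i; x; Q j; Q k] by exact: (simple_insert (l1 := [::]) t01).
have O_xj z : seg x (Q j) z -> O z.
  move=> Hz [l /othersP /andP[il jl] Hl].
  have Hi' : edge i z by apply: seg_sub_r Hz.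
  case: (edge_meet il Hi' Hl) => [[e _]|[_ e]].
    by move: jl; rewrite e eqxx.
  by move: e; apply: seg_lp_l Hz => //; rewrite t0 ltW.
have O_jy z : seg (Q j) y z -> O z /\ ~ seg (Q i) x z.
  move=> Hz; have Hj : edge j z by apply: seg_sub Hz.
  split.
    move=> [l /othersP /andP[il jl] Hl].
    case: (edge_meet jl Hj Hl) => [[_ e]|[/ordS_inj e _]].
      have {}e : z = Q k by case: (edge_meet jl Hj Hl) => [[el ->]|[/ordS_inj el _]];
        [rewrite el|move: il; rewrite el eqxx].
      by move: e; apply: seg_lp_r Hz => //; rewrite t'1 ltW.
    by move: il; rewrite e eqxx.
  move=> Hx; have zj : z = Q j by apply: meet_ij => //; apply: seg_sub Hx.
  by move: zj; apply: seg_lp_r Hx => //; rewrite t1 ltW.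
have oO2 : open (O `\` seg (Q i) x) by apply: open_diff => //; exact: seg_closed.
set nj := left_normal (edge_vec Q j); set ni := left_normal (edge_vec Q i).
have E1 : ev (fun h => vis 1 (O `\` seg (Q i) x) x (Q j) (Q k) [::] (y + h *: nj)).
  apply: (@first_seg R 1 _ x (Q j) (Q k) [::] y nj t') => //.
    by rewrite mul1r; exact: cross_left_normal.
  apply: near_seg_r; first exact: supp_closed.
  by move=> z Hz zk; rewrite /= in zk; move: zk; apply: seg_lp_r Hz => //; rewrite t'1 ltW.
apply: ev_mono E1 => h h0 V; set c := y + h *: nj in V *.
have one0 : (1 : R) != 0 by exact: oner_neq0.
have [L [L1 L2]] : exists L, vis 1 O (Q i) x (Q j) [:: Q k] L /\
    forall z, seg L c z -> O z /\ ~ supp [:: Q i; x; Q j; Q k] z.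
  apply: vis_step => //; first by apply: vis_sub V => z [].
  by case: V => _ V2 _ _ z /V2 [].
have avoid z : O z -> ~ supp [:: Q i; x; Q j; Q k] z -> ~ boundary Q z.
  move=> Oz Hz /(boundary_split i j) [Hi'|Hj|//]; apply: Hz.
    apply/(supp_insert [::] (Q i) (Q j) [:: Q k] z t01').
    by left.
  apply/(supp_insert [::] (Q i) (Q j) [:: Q k] z t01').
  by right; left.
have E2 : ev (fun h => forall z, seg (lp x (x + ni) h) L z -> O z /\ ~ supp [:: Q i; x; Q j; Q k] z).
  apply: (@perturb R 1) => //.
    by move=> z /segP [s [s01 e1 e2]]; rewrite /cross !ptE e1 e2 /x !ptE; ring.
  rewrite mul1r; have -> : cross (Q j - x) (x + ni - x) = (1 - t) * cross (Q j - Q i) ni.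
    by rewrite /cross /x !ptE; ring.
  by apply: mulr_gt0; [rewrite subr_gt0|exact: (cross_left_normal Qij)].
have [d d0 [[H1 H2] H3]] := ev_ex (ev_and Hi E2).
have ex : edge_pt Q i t + d *: ni = lp x (x + ni) d.
  by apply: ptP; rewrite /x !ptE; ring.
rewrite ex in H1 H2.
split; first by have [h1 h2] := L2 c (@seg_r _ _ _); exact: avoid.
rewrite (@wn_seg _ _ _ L c); last by move=> z /L2 []; exact: avoid.
by rewrite (@wn_seg _ _ _ (lp x (x + ni) d) L) //; move=> z /H3 []; exact: avoid.
Qed.

Lemma val_iter_ordS k i : val (iter k (@ordS n) i) = ((i + k) %% n)%N.
Proof.
elim: k => [|k IH] /=; first by rewrite addn0 modn_small.
by rewrite IH -addn1 modnDml -addnA addn1.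
Qed.

Lemma inside_left_all i t : 0 < t < 1 -> inside_left i t ->
  forall j t', 0 < t' < 1 -> inside_left j t'.
Proof.
move=> t01 Hi j.
have H k : forall t', 0 < t' < 1 -> inside_left (iter k.+1 (@ordS n) i) t'.
  elim: k => [|k IH] t' t'01; first exact: inside_left_next Hi.
  by apply: (inside_left_next t01 t'01); exact: IH.
have -> : j = iter (j + n - i).-1.+1 (@ordS n) i; last exact: H.
apply: val_inj; rewrite val_iter_ordS.
have jn := ltn_ord j; have i_n := ltn_ord i.
rewrite prednK; last by move: i_n; clear; lia.
by rewrite subnKC ?modnDr ?modn_small //; move: i_n; clear; lia.
Qed.

Lemma ccw_of_inside_left i t : 0 < t < 1 -> inside_left i t -> counterclockwise Q.
Proof.
move=> t01 Hi j t' t'01; have [e [e0 He]] := inside_left_all t01 Hi j t'01.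
have Hd d : 0 < d < e -> enclosed Q (edge_pt Q j t' + d *: left_normal (edge_vec Q j)).
  by move=> /He [h1 h2]; exact: wn_enclosed.
near=> d; apply: Hd; apply/andP; split.
  by near: d; exact: nbhs_right_gt.
by near: d; exact: nbhs_right_lt.
Unshelve. all: by end_near.
Qed.

(** The upward ray from [z0], above the top vertex, meets nothing. From there [zp], above the
    midpoint [e], is reached parallel to the edge. The step down to [zm] crosses only edge [i] and
    changes only its summand. From [zm] the point on the left normal is reached without crossing,
    since the edge runs to the left and its left normal points downwards. *)
Lemma top_inside_left m i : ordS m = i -> (Q m).1 = (Q i).1 -> (Q m).2 < (Q i).2 ->
  (Q (ordS i)).1 < (Q i).1 ->
  (forall z, boundary Q z -> z.1 = (Q i).1 -> z.2 <= (Q i).2) ->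
  inside_left i (1 / 2).
Proof.
move=> em m1 m2 w1 top; set u := Q i in m1 m2 w1 top *; set w := Q (ordS i) in w1 *.
have half : 0 < (1 / 2 : R) < 1 by lra.
have half' : 0 <= (1 / 2 : R) <= 1 by lra.
have uw : u <> w by move=> e; move: w1; rewrite -e ltxx.
set e := lp u w (1 / 2); pose up : pt := (0, 1).
have e1 : e.1 = u.1 + 1 / 2 * (w.1 - u.1) by [].
have He : edge i e by exists (1 / 2).
pose G2 := edges Q [seq k <- enum 'I_n | (k != i) && (k != m)].
pose G1 := edges Q [seq k <- enum 'I_n | (k != i) && (k != i)].
have meet z k : seg u e z -> k != i -> edge k z -> k = m /\ z = u.
  move=> Hz ki Hk; have Hi : edge i z by apply: seg_sub Hz.
  rewrite eq_sym in ki; case: (edge_meet ki Hi Hk) => [[ek ez]|[ek ez]].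
    by exfalso; apply: (seg_lp_r uw _ Hz); [lra|rewrite ez ek].
  by split=> //; apply: (@ordS_inj n); rewrite em.
have E1 : ev (fun d => forall z, seg (u + d *: up) (e + d *: up) z -> ~ G2 z).
  apply: near_seg; first exact: edges_closed.
  move=> z Hz [k]; rewrite mem_filter => /andP[/andP[ki km] _] Hk.
  by have [k_m _] := meet z k Hz ki Hk; rewrite k_m eqxx in km.
have eG1 z : seg e e z -> ~ G1 z.
  move=> Hz; have -> : z = e.
    by case/segP: Hz => t [_ z1 z2]; apply: ptP; rewrite ?z1 ?z2; ring.
  move=> [k]; rewrite mem_filter => /andP[/andP[ki _] _] Hk.
  have [_ eu] := meet e k (@seg_r _ _ _) ki Hk.
  by move: eu; apply: lp_neq_l => //; lra.
have cG1 : closed G1 by exact: edges_closed.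
set nl := left_normal (edge_vec Q i).
have E2 := near_seg up (- up) cG1 eG1.
have E3 := near_seg (- up) nl cG1 eG1.
apply: ev_mono (ev_and E1 (ev_and E2 E3)) => d d0 [K1 [K2 K3]].
set zp := e + d *: up in K1 K2; set zm := e + d *: - up in K2 K3.
set z0 := u + d *: up in K1.
have up1 : up.1 = 0 by []; have up2 : up.2 = 1 by [].
have shift z s : edge i z -> s != 0 -> ~ edge i (z + s *: up).
  move=> /segP [t [t01 f1 f2]] s0 /segP [r [r01 g1 g2]].
  move: g1 g2; rewrite !ptE f1 f2 up1 up2 -/u -/w => g1 g2.
  have : (r - t) * (w.1 - u.1) = 0 by lra.
  move=> /eqP; rewrite mulf_eq0 => /orP[/eqP rt|/eqP]; last by lra.
  have rt' : r = t by lra.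
  by move/eqP: s0; apply; move: g2; rewrite rt'; lra.
have Hb1 z : seg z0 zp z -> ~ boundary Q z.
  move=> Hz /(boundary_split i m) [Hi|Hm|]; last exact: K1.
    case/segP: Hz => t [t01 f1 f2].
    apply: (@shift (lp u e t) d _ (lt0r_neq0 d0)).
      by apply: (seg_sub half'); exists t.
    have <- // : z = lp u e t + d *: up.
    by apply: ptP; rewrite !ptE ?f1 ?f2 /z0 /zp !ptE; ring.
  case/segP: Hz => t [t01 f1 f2]; case/segP: Hm => s [s01 g1 g2].
  rewrite em -/u in g1 g2.
  have t0 : t = 0.
    move: g1; rewrite f1 /z0 /zp !ptE up1 m1 => g1.
    have /eqP : t * (w.1 - u.1) = 0 by lra.
    by rewrite mulf_eq0 => /orP[/eqP//|/eqP]; lra.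
  move: g2; rewrite f2 t0 /z0 !ptE up2 => g2.
  have : 0 <= (1 - s) * (u.2 - (Q m).2) by apply: mulr_ge0; lra.
  lra.
have wz0 : wn Q z0 = 0.
  apply: big1 => k _; have -> : above Q k z0 = false; last by rewrite mul0r.
  apply/asboolP => -[q Hq []]; rewrite /z0 !ptE up1 up2 => q1 q2.
  have : q.2 <= u.2 by apply: top; [exact: boundary_edge Hq|lra].
  lra.
have wzp : wn Q zp = 0 by rewrite (wn_seg Hb1).
have czm : zm = e + (- d) *: up by rewrite /zm scalerN scaleNr.
have Np : ~ edge i zp by apply: shift => //; exact: lt0r_neq0.
have Nm : ~ edge i zm by rewrite czm; apply: shift => //; rewrite oppr_eq0; exact: lt0r_neq0.
have xp : zp.1 = e.1 by rewrite /zp !ptE up1; ring.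
have xm : zm.1 = e.1 by rewrite /zm !ptE up1; ring.
have indE k : ind Q k zm = ind Q k zp by rewrite /ind xp xm.
have wzm : wn Q zm = -1.
  have Tm : (above Q i zm)%:R * (ind Q i zm - ind Q (ordS i) zm) = -1.
    rewrite (above_pt Nm He) ?xm //.
    have -> : zm.2 < e.2 by rewrite /zm !ptE up2; lra.
    have -> : ind Q i zm = 0.
      by rewrite /ind xm leNgt -/u e1; have -> : u.1 + 1 / 2 * (w.1 - u.1) < u.1 by lra.
    have -> : ind Q (ordS i) zm = 1; last by rewrite mul1r sub0r.
    by rewrite /ind xm -/w e1; have -> : w.1 <= u.1 + 1 / 2 * (w.1 - u.1) by lra.
  have Tp : (above Q i zp)%:R * (ind Q i zp - ind Q (ordS i) zp) = 0.
    rewrite (above_pt Np He) ?xp //.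
    have -> : (zp.2 < e.2) = false; last by rewrite mul0r.
    by apply/negbTE; rewrite -leNgt /zp !ptE up2; lra.
  rewrite -[RHS]add0r -[in RHS]wzp /wn [LHS](bigD1 i) // [in RHS](bigD1 i) //= Tm Tp add0r addrC.
  congr (_ + _).
  apply: eq_bigr => k ki; rewrite !indE.
  case: (eqVneq (ind Q k zp) (ind Q (ordS k) zp)) => [->|/ind_neq [q Hq eq]].
    by rewrite subrr !mulr0.
  have NG z : seg zp zm z -> ~ edge k z.
    by move=> Hz Hk; apply: (K2 z Hz); exists k => //; rewrite mem_filter ki mem_enum.
  congr (_ * _); congr (nat_of_bool _)%:R.
  rewrite (@above_pt _ _ _ k zm q) //; last 2 first.
  - by apply: NG; exact: seg_r.
  - by rewrite eq xp xm.
  rewrite (@above_pt _ _ _ k zp q) //; last by apply: NG; exact: seg_l.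
  by apply/esym; apply: (@above_seg _ (Q k) (Q (ordS k))) => //; rewrite eq xp xm.
have Hb2 z : seg zm (e + d *: nl) z -> ~ boundary Q z.
  move=> Hz /(boundary_split i i) [Hi|Hi|]; last (exact: K3).
    have c1 : 0 < 1 * cross (w - u) (zm - u).
      have -> : 1 * cross (w - u) (zm - u) = d * (u.1 - w.1).
        by rewrite /cross /zm /e !ptE up1 up2; ring.
      by rewrite mulr_gt0 // subr_gt0.
    have c2 : 0 < 1 * cross (w - u) (e + d *: nl - u).
      have -> : 1 * cross (w - u) (e + d *: nl - u) = d * cross (w - u) nl.
        by rewrite /cross /e !ptE; ring.
      by rewrite mulr_gt0 //; exact: cross_left_normal.
    have := cross_seg c1 c2 Hz.
    by rewrite (cross_on_seg Hi) mulr0 ltxx.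
  have c1 : 0 < 1 * cross (w - u) (zm - u).
    have -> : 1 * cross (w - u) (zm - u) = d * (u.1 - w.1).
      by rewrite /cross /zm /e !ptE up1 up2; ring.
    by rewrite mulr_gt0 // subr_gt0.
  have c2 : 0 < 1 * cross (w - u) (e + d *: nl - u).
    have -> : 1 * cross (w - u) (e + d *: nl - u) = d * cross (w - u) nl.
      by rewrite /cross /e !ptE; ring.
    by rewrite mulr_gt0 //; exact: cross_left_normal.
  have := cross_seg c1 c2 Hz.
  by rewrite (cross_on_seg Hi) mulr0 ltxx.
have -> : edge_pt Q i (1 / 2) + d *: nl = e + d *: nl by [].
split; first by apply: Hb2; exact: seg_r.
by rewrite (wn_seg Hb2) wzm oppr_eq0 oner_eq0.
Qed.

End Orientation.

(** * Filling the gaps of a partial description *)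

Section Drawing.
Variable R : realType.
Notation pt := (R * R)%type.
Notation arc := (seq pt * seq pt * nat)%type.
Implicit Types (a b e p q u v w x y z : pt) (s t h r M : R)
  (c f l m n A B F K : seq pt) (Fs : seq (seq pt)) (g k Y : nat) (X : seq arc)
  (o : seq (option pt)).

(** [all2] also forces equal lengths, so the exact number of vertices in each gap is respected. *)
Definition agree o K : bool :=
  all2 (fun (r : option pt) x => if r is Some p then x == p else true) o K.

Lemma agree_cat o1 o2 K1 K2 : agree o1 K1 -> agree o2 K2 -> agree (o1 ++ o2) (K1 ++ K2).
Proof. by elim: o1 K1 => [|? o1 IH] [|x K1] //= /andP[-> /IH]. Qed.

Lemma agree_catE o1 o2 K : agree (o1 ++ o2) K ->
  exists K1 K2, [/\ K = K1 ++ K2, agree o1 K1 & agree o2 K2].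
Proof.
elim: o1 K => [|q o1 IH] K /=; first by exists [::], K.
case: K => //= x K /andP[h /IH [K1 [K2 [-> h1 h2]]]].
by exists (x :: K1), K2; rewrite /agree /= h.
Qed.

Lemma agree_some A K : agree (map Some A) K = (K == A).
Proof.
elim: A K => [|x A IH] [|y K] //=; rewrite eqseq_cons -IH //.
Qed.

Lemma agree_none g K : agree (nseq g None) K = (size K == g).
Proof. by elim: g K => [|g IH] [|y K] //=; rewrite /agree /= -/(agree _ _) IH. Qed.

Definition pat X : seq (option pt) :=
  flatten [seq map Some xa.1.1 ++ nseq xa.2 None | xa <- X].

Lemma pat_cat X1 X2 : pat (X1 ++ X2) = pat X1 ++ pat X2.
Proof. by rewrite /pat map_cat flatten_cat. Qed.

(* [A] is the arc to be drawn; [A0] omits the vertices added only to reach the prescribed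
   number, so that its size bounds the length of the paths needed. *)
Definition arc_ok A A0 : Prop := exists a n n0,
  [/\ A = a :: n, A0 = a :: n0, last a n = last a n0, simple A /\ simple A0 &
      forall z, supp A z <-> supp A0 z].

(* [Y] stands for the number of vertices of the arcs plus twice their number plus 1: joining
   two arcs takes at most [Y + 2] vertices and at most doubles [Y], and the closing path takes
   at most [3 * Y + 2] vertices. *)
Fixpoint fillable Y (gs : seq nat) : bool :=
  if gs is g :: gs' then
    (if gs' is _ :: _ then (Y + 2 <= g)%N && fillable (2 * Y) gs' else (3 * Y + 2 <= g)%N)
  else false.

Lemma csimple_rot1 x l : csimple (x :: l) ->
  csimple (rcons l x) /\ forall z, csupp (rcons l x) z <-> csupp (x :: l) z.
Proof.
case: l => [[] //|y l] [sL /= bx hb].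
set b := last y l in bx hb.
have eb : y :: l = rcons (belast y l) b by rewrite lastI.
have [xy h1 sl] := sL.
have nx : ~ supp (y :: l) x by move=> H; apply: xy; apply: h1 => //; exact: seg_l.
have S z : supp (y :: rcons l x) z <-> supp (y :: l) z \/ seg b x z.
  by rewrite -rcons_cons eb supp_rcons2.
split; last first.
  move=> z; rewrite /csupp /= last_rcons.
  change (supp (y :: rcons l x) z \/ seg x y z <-> (seg x y z \/ supp (y :: l) z) \/ seg b x z).
  rewrite S; tauto.
change (csimple (y :: rcons l x)); rewrite /csimple last_rcons; split.
- rewrite -rcons_cons eb; apply/simple_rcons2; rewrite -eb; split=> //.
  by move=> z hz /hb [|//|zx]; [by right|exfalso; apply: nx; rewrite -zx].
- by [].
- move=> z hz /S [h|h]; first by right; exact: h1.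
  have [|zb|->] := hb z h; [by left|right|by left].
  by apply: h1 => //; rewrite zb /b; apply: supp_mem; rewrite mem_last.
Qed.

Lemma csimple_rot K1 K2 : csimple (K1 ++ K2) ->
  csimple (K2 ++ K1) /\ forall z, csupp (K2 ++ K1) z <-> csupp (K1 ++ K2) z.
Proof.
elim: K1 K2 => [|x K1 IH] K2 /=; first by rewrite cats0.
move=> /csimple_rot1 [h1 h2]; rewrite rcons_cat in h1 h2.
have [h3 h4] := IH _ h1; rewrite cat_rcons in h3 h4.
by split=> // z; rewrite h4 h2.
Qed.

Lemma top_turn_rot K1 K2 : csimple (K1 ++ K2) -> top_turn (K1 ++ K2) -> top_turn (K2 ++ K1).
Proof.
move=> cK [j [p [u [w [K' [ej h1 h2 h3]]]]]].
have [_ S] := csimple_rot cK.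
have [j' ej'] : exists j', rot j' (K2 ++ K1) = [:: p, u, w & K'].
  case: (leqP j (size (K1 ++ K2))) => jK; last first.
    exists (size K2); rewrite rot_size_cat -ej rot_oversize //; exact: ltnW.
  rewrite -ej -[K1 ++ K2 as X in rot j X](@rot_size_cat _ K2 K1) rot_add_mod.
  - by eexists.
  - by rewrite size_cat leq_addr.
  - by move: jK; rewrite !size_cat addnC.
exists j', p, u, w, K'; split=> // z /S; exact: h3.
Qed.

Lemma pairwise_disjoint_cat Fs1 Fs2 : pairwise_disjoint (Fs1 ++ Fs2) <->
  [/\ pairwise_disjoint Fs1, pairwise_disjoint Fs2 &
      forall F F', F \in Fs1 -> F' \in Fs2 -> forall z, supp F z -> supp F' z -> False].
Proof.
elim: Fs1 => [|F Fs1 IH] /=; first by split=> [?|[]].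
split=> [[h1 /IH [h2 h3 h4]]|[[h1 h2] h3 h4]].
  split=> //.
  - by split=> // F' h; apply: h1; rewrite mem_cat h.
  - move=> G F'; rewrite inE => /predU1P[-> h|]; last exact: h4.
    by apply: h1; rewrite mem_cat h orbT.
split; last first.
  by apply/IH; split=> // G F' h; apply: h4; rewrite inE h orbT.
move=> F'; rewrite mem_cat => /orP[/h1//|h].
by apply: h4 => //; rewrite inE eqxx.
Qed.

Lemma pairwise_disjoint_rot Fs1 Fs2 :
  pairwise_disjoint (Fs1 ++ Fs2) -> pairwise_disjoint (Fs2 ++ Fs1).
Proof.
move=> /pairwise_disjoint_cat [h1 h2 h3]; apply/pairwise_disjoint_cat; split=> //.
by move=> F F' h h' z hz hz'; exact: (h3 F' F h' h z).
Qed.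

Lemma merge3 m b c a n : simple (rcons m b) -> simple (b :: rcons c a) -> simple (a :: n) ->
  (forall z, supp (b :: rcons c a) z ->
     (supp (rcons m b) z -> z = b) /\ (supp (a :: n) z -> z = a)) ->
  (forall z, supp (rcons m b) z -> supp (a :: n) z -> False) ->
  simple (rcons m b ++ c ++ a :: n) /\
  forall z, supp (rcons m b ++ c ++ a :: n) z <->
    [\/ supp (rcons m b) z, supp (b :: rcons c a) z | supp (a :: n) z].
Proof.
move=> s1 s2 s3 h1 h2; rewrite -cat_rcons.
have S1 z : supp (b :: rcons c a ++ n) z <-> supp (b :: rcons c a) z \/ supp (a :: n) z.
  by rewrite -cat_cons -rcons_cons supp_rcons_cat.
split.
  apply: simple_merge => //.
    rewrite -cat_cons -rcons_cons; apply: simple_merge => // z /h1 [_]; exact.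
  by move=> z hz /S1 [/h1 [h _]|/(h2 _ hz)//]; exact: h.
move=> z; rewrite supp_rcons_cat S1; split=> [[|[]]|[]]; try tauto.
- by constructor 1.
- by constructor 2.
- by constructor 3.
Qed.

Lemma pad_mid b c a g : simple (b :: rcons c a) -> (size c <= g)%N -> exists c',
  [/\ size c' = g, simple (b :: rcons c' a) &
      forall z, supp (b :: rcons c' a) z <-> supp (b :: rcons c a) z].
Proof.
move=> sc szc.
have [y [l ey]] : exists y l, rcons c a = y :: l.
  by case: (c) => [|y l]; [exists a, [::]|exists y, (rcons l a)].
rewrite ey in sc *; have [y' [l' [szl' sl' Sl' ll' _]]] := pad (g - size c) sc.
have la : last y' l' = a by rewrite ll' -(last_cons a) -ey last_rcons.
exists (belast y' l'); rewrite -la -lastI; split=> //.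
rewrite size_belast szl'; have := congr1 size ey; rewrite size_rcons /= => -[<-].
by rewrite subnKC.
Qed.

(** The arc before the shortest gap is joined to its cyclic successor. If [S] is the quantity
    bounded by [Y], the path has at most [S + 2] vertices, and losing one arc lowers [S] by two; so
    the new value is at most [2 * Y]. *)
Lemma draw gs X Y M : perm_eq gs [seq xa.2 | xa <- X] -> fillable Y gs ->
  (\sum_(xa <- X) size xa.1.2 + 2 * size X + 1 <= Y)%N ->
  {in X, forall xa, arc_ok xa.1.1 xa.1.2} -> pairwise_disjoint [seq xa.1.2 | xa <- X] ->
  exists K, [/\ agree (pat X) K, csimple K, top_turn K & exists2 z, z \in K & M <= z.2].
Proof.
have [N] := ubnP (size gs); elim: N gs X Y => // N IH [|g [|g' gs]] X Y //.
  move=> _ gX /= fY szX okX dX.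
  have : size X = 1%N by rewrite -(size_map snd) -(perm_size gX).
  case: X gX szX okX dX => [|[[A A0] h] [|]] // gX szX okX _ _.
  have {}gX : h = g by have := perm_mem gX h; rewrite /= !inE eqxx => /eqP.
  subst h; have [a [n [n0 [/= eA eA0 eb [sA sA0] eS]]]] := okX _ (mem_head _ _).
  rewrite big_seq1 /= in szX.
  have rA : A = rcons (belast a n) (last a n) by rewrite eA lastI.
  have rA0 : A0 = rcons (belast a n0) (last a n) by rewrite eA0 eb lastI.
  have [||||||c [szc h1 h2 h3]] := @close_top R (belast a n) (last a n) (belast a n0) a n n0 g M;
    rewrite -?rA -?rA0 //.
    by move: fY szX; clear; lia.
  rewrite -rA in h1 h2 h3.
  exists (A ++ c); split=> //.
  rewrite /pat /= cats0; apply: agree_cat; first by rewrite agree_some.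
  by rewrite agree_none szc.
rewrite ltnS => szN gX /andP[gY fY] szX okX dX.
have : g \in [seq xa.2 | xa <- X] by rewrite -(perm_mem gX) mem_head.
move=> /mapP [[[A A0] h] xX /= eh]; subst h.
have [X1 [X2 eX]] : exists X1 X2, X = X1 ++ (A, A0, g) :: X2.
  by case/splitPr: xX => X1 X2; exists X1, X2.
have gX' : perm_eq (g' :: gs) [seq xa.2 | xa <- X2 ++ X1].
  rewrite -(perm_cons g); apply: (perm_trans gX).
  rewrite eX !map_cat /= perm_catC /=; exact: perm_refl.
(* Read cyclically from [A], the other arcs are [X2 ++ X1]; at least one exists because a second gap
   is left. *)
have [[[B B0] gB] [X3 eX3]] : exists (xa : arc) X3, X2 ++ X1 = xa :: X3.
  case: (X2 ++ X1) gX' => [|xa X3]; last by exists xa, X3.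
  by move/perm_size.
rewrite eX3 in gX'.
have okA : arc_ok A A0 by have := okX _ xX.
have memX (xa : arc) : xa \in (B, B0, gB) :: X3 -> xa \in X.
  by rewrite -eX3 eX !mem_cat inE; case: (xa \in X1); rewrite ?orbT // orbF => ->; rewrite orbT.
have okB : arc_ok B B0 by have := okX _ (memX _ (mem_head _ _)).
have dX' : pairwise_disjoint [:: A0, B0 & [seq xa.1.2 | xa <- X3]].
  have -> : [:: A0, B0 & [seq xa.1.2 | xa <- X3]] =
     [seq xa.1.2 | xa <- ((A, A0, g) :: X2)] ++ [seq xa.1.2 | xa <- X1].
    by rewrite -map_cat /= eX3.
  by apply: pairwise_disjoint_rot; rewrite -map_cat -eX.
have [a1 [n1 [n10 [eA eA0 eb1 [sA sA0] SA]]]] := okA.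
have [a2 [n2 [n20 [eB eB0 eb2 [sB sB0] SB]]]] := okB.
set b1 := last a1 n1 in eb1.
have rA : A = rcons (belast a1 n1) b1 by rewrite eA lastI.
have rA0 : A0 = rcons (belast a1 n10) b1 by rewrite eA0 eb1 lastI.
have [|F|c [sc hc szc]] := @connect_arcs R (belast a1 n10) b1 a2 n20 [seq xa.1.2 | xa <- X3].
  by rewrite -rA0 -eB0.
  rewrite -rA0 -eB0 !inE => /orP[/eqP->//|/orP[/eqP->//|/mapP [x xX3 ->]]].
  have [|? [? [? [_ _ _ [_ ]]]]] // := okX x.
  by apply: memX; rewrite inE xX3 orbT.
rewrite -rA0 -eB0 in hc szc.
have pX : perm_eq X [:: (A, A0, g), (B, B0, gB) & X3].
  by rewrite eX -eX3 -cat_cons perm_catC.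
have szc' : (size c <= \sum_(xa <- X) size xa.1.2 + 2 * size X + 3)%N.
  apply: leq_trans szc _.
  rewrite (perm_size pX) (perm_big _ pX) !big_cons !big_map /= big_split /=.
  by rewrite big_const_seq count_predT iter_addn_0; clear; lia.
have cg : (size c <= g)%N by move: szc' szX gY; clear; lia.
(* The drawn arc receives the padded path [c'], the reduced arc the bare path [c]. *)
have [c' [szc2 sc' Sc']] := pad_mid sc cg.
have [dA [dB _]] := dX'.
have AB z : supp A0 z -> supp B0 z -> False by apply: dA; rewrite inE eqxx.
have [sM0 SM0] : simple (A0 ++ c ++ B0) /\ forall z, supp (A0 ++ c ++ B0) z <->
    [\/ supp A0 z, supp (b1 :: rcons c a2) z | supp B0 z].
  rewrite rA0 eB0; apply: merge3; rewrite -?rA0 -?eB0 //.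
  by move=> z /hc [].
have [sM SM] : simple (A ++ c' ++ B) /\ forall z, supp (A ++ c' ++ B) z <->
    [\/ supp A z, supp (b1 :: rcons c' a2) z | supp B z].
  rewrite rA eB; apply: merge3; rewrite -?rA -?eB //.
    by move=> z /Sc' /hc [h1 h2 _]; split=> [/SA|/SB].
  by move=> z /SA h1 /SB; exact: AB.
pose X' := (A ++ c' ++ B, A0 ++ c ++ B0, gB) :: X3.
have [||||||K [h1 h2 h3 h4]] := IH (g' :: gs) X' (2 * Y)%N.
- exact: szN.
- by [].
- by [].
- move: szX szc'; rewrite (perm_size pX) (perm_big _ pX) !big_cons /= !size_cat.
  by clear; lia.
- move=> x; rewrite inE => /predU1P[->|xX3]; last first.
    by apply: okX; apply: memX; rewrite inE xX3 orbT.
  exists a1, (n1 ++ c' ++ B), (n10 ++ c ++ B0); split=> //=.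
  + by rewrite eA.
  + by rewrite eA0.
  + by rewrite !last_cat eB eB0 /= eb2.
  + move=> z; rewrite SM SM0; split=> -[/SA|/Sc'|/SB] ?;
      by [constructor 1|constructor 2|constructor 3].
- split; last by case: dX' => _ [].
  move=> F FX3 z /= /SM0 [h|h|h] hF.
  + by apply: (dA F _ z h hF); rewrite inE FX3 orbT.
  + by case: (hc z h) => _ _; apply; exists F.
  + exact: (dB F FX3 z h hF).
have {}h1 : agree (pat ((A, A0, g) :: X2) ++ pat X1) K.
  rewrite -pat_cat /= eX3; move: h1; rewrite /X' /pat /= !map_cat -!catA.
  move=> /agree_catE [K1 [K2 [-> k1 /agree_catE [K3 [K4 [-> k3 k4]]]]]].
  apply: agree_cat => //; apply: agree_cat => //.
  by move: k3; rewrite agree_some agree_none => /eqP ->; rewrite szc2.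
have [K1 [K2 [eK k1 k2]]] := agree_catE h1.
rewrite eK in h2 h3 h4; exists (K2 ++ K1); split.
- by rewrite eX pat_cat; exact: agree_cat.
- by have [] := csimple_rot h2.
- exact: top_turn_rot.
- by case: h4 => z; rewrite mem_cat orbC -mem_cat => ? ?; exists z.
Qed.

End Drawing.

(** * Choice of the gaps that are redrawn *)

Section Gaps.
Local Open Scope nat_scope.
Implicit Types (g j k n t Y : nat) (gs bs : seq nat).

Definition large theta gs := sort leq [seq g <- gs | (theta <= g)%N].

(* The value of [Y] in [fillable] when the gaps below [theta] are kept. *)
Definition load k theta gs : nat :=
  k + sumn [seq g <- gs | (g < theta)%N] + 2 * count (leq theta) gs + 1.

(** The load doubles at each gap. If the test fails at gap number [j], then by sortedness this gap
    and the [j] gaps before it are all short; if it fails at the last gap, all gaps are below the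
    last bound. *)
Lemma not_fillable Y bs : sorted leq bs -> bs != [::] -> ~~ fillable Y bs ->
  (exists j, (j < count (gtn (2 ^ j * Y + 2)) bs)%N) \/
  all (gtn (3 * 2 ^ (size bs).-1 * Y + 2)%N) bs.
Proof.
elim: bs Y => [//|g [|g' bs] IH] Y.
  by move=> _ _ /=; rewrite -ltnNge => gY; right; rewrite muln1 gY.
move=> s _ /=; rewrite negb_and -ltnNge => /orP[gY|].
  by left; exists 0%N; rewrite mul1n gY.
have /= s' : sorted leq (g' :: bs) by case/andP: s.
have ming : all (leq g) (g' :: bs) by exact: (order_path_min leq_trans s).
move=> nf; have [[j hj]|h] := IH _ s' isT nf.
  left; exists j.+1; have e : (2 ^ j * (2 * Y) = 2 ^ j.+1 * Y)%N by rewrite expnS; ring.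
  rewrite e in hj.
  have /hasP [e' e'bs e'l] : has (gtn (2 ^ j.+1 * Y + 2)) (g' :: bs).
    by rewrite has_count; apply: leq_trans hj.
  have : (g < 2 ^ j.+1 * Y + 2)%N by apply: leq_ltn_trans e'l; exact: (allP ming).
  by move=> ge; rewrite /= ge; move: hj => /=; rewrite add1n ltnS.
right; have e : (3 * 2 ^ (size bs) * (2 * Y) = 3 * 2 ^ (size bs).+1 * Y)%N by rewrite expnS; ring.
rewrite /= e in h; rewrite h andbT; case/andP: h => h _; apply: leq_ltn_trans h.
by case/andP: ming.
Qed.

(** Equivalent to [1 + j * 2 ^ (j - 1) <= (5 / 2) ^ j], the growth of the load when [j] gaps are
    given up. Small cases are computed. *)
Lemma expn_bound1 j : (0 < j)%N -> (2 ^ j * (2 + j * 2 ^ j) <= 2 * 5 ^ j)%N.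
Proof.
case: j => // j _; case: (ltnP j 4) => [|j4]; first by case: j => [|[|[|[]]]].
elim: j j4 => // j IH; rewrite leq_eqVlt => /predU1P[[<-]//|]; rewrite ltnS => j4.
have := IH j4; rewrite 2!(expnS _ j.+1) !(expnS 2).
move: (2 ^ j)%N (5 ^ j.+1)%N => x y; move: j4; clear; nia.
Qed.

Lemma expn_bound2 t : (0 < t)%N -> (2 ^ t * (2 + 3 * t * 2 ^ t) <= 5 ^ t.+1)%N.
Proof.
case: t => // t _; case: (ltnP t 4) => [|t4]; first by case: t => [|[|[|[]]]].
elim: t t4 => // t IH; rewrite leq_eqVlt => /predU1P[[<-]//|]; rewrite ltnS => t4.
have := IH t4; rewrite (expnS 5 t.+2) !(expnS 2).
move: (2 ^ t)%N (5 ^ t.+2)%N => x y; move: t4; clear; nia.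
Qed.

Lemma count_large theta theta' gs : (theta <= theta')%N ->
  count (leq theta) gs = (count (leq theta') gs + count (gtn theta') (large theta gs))%N.
Proof.
move=> h; rewrite /large (permP (permEl (perm_sort _ _))).
elim: gs => //= g gs ->.
by case: (leqP theta' g) => h1; case: (leqP theta g) => h2 //=; rewrite ?(leqNgt theta') ?h1 //=;
  move: h h1 h2; clear; lia.
Qed.

Lemma sumn_large theta theta' gs : (theta <= theta')%N ->
  (sumn [seq g <- gs | (g < theta')%N] <= sumn [seq g <- gs | (g < theta)%N] +
     count (gtn theta') (large theta gs) * theta'.-1)%N.
Proof.
move=> h; rewrite /large (permP (permEl (perm_sort _ _))).
elim: gs => //= g gs IH.
case: (ltnP g theta') => h1; case: (ltnP g theta) => h2 /=; rewrite ?h1 ?(ltnNge g theta') ?h1 /=;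
  move: (sumn _) (sumn _) (count _ _) IH h h1 h2 => a b c IH; rewrite ?add1n ?add0n ?mulSn;
  move: (c * _) IH; clear; lia.
Qed.

(** Induction on the number [t] of gaps that reach the threshold. If an intermediate join fails, the
    threshold is raised to [2 ^ j * Y + 2], which gives up [j' > j] gaps at a cost of at most
    [(5 / 2) ^ j']. If only the closing test fails, every large gap is short and the sum is bounded
    directly. *)
Lemma not_fillable_bound k theta gs :
  (forall theta', theta <= theta' -> ~~ fillable (load k theta' gs) (large theta' gs))%N ->
  (2 ^ (count (leq theta) gs).+1 * (k + sumn gs) <=
     5 ^ (count (leq theta) gs).+1 * load k theta gs)%N.
Proof.
have [N] := ubnP (count (leq theta) gs); elim: N theta => // N IH theta; rewrite ltnS => tN nf.
set t := count _ gs in tN *; set Y := load k theta gs.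
have sz : size (large theta gs) = t by rewrite size_sort size_filter.
have nY : (k + sumn [seq g <- gs | (g < theta)%N] + 2 * t + 1 = Y)%N by [].
have key theta' : (theta <= theta')%N ->
    let j := count (gtn theta') (large theta gs) in
    (t = count (leq theta') gs + j)%N /\
    (load k theta' gs + 2 * j <= Y + j * theta'.-1)%N.
  move=> h /=; have e := count_large gs h; split=> //; have := sumn_large gs h.
  rewrite /Y /load e; move: (sumn _) (sumn _) (count _ _) (count _ _) => a b c d.
  clear; nia.
have [l0|ln0] := eqVneq (large theta gs) [::].
  have t0 : t = 0%N by rewrite -sz l0.
  have <- : sumn [seq g <- gs | (g < theta)%N] = sumn gs.
    congr (sumn _); apply/all_filterP/allP => g ggs; rewrite ltnNge; apply/negP => h.
    by move: t0; apply/eqP; rewrite -lt0n -has_count; apply/hasP; exists g.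
  by rewrite t0 -nY t0; clear; lia.
have s : sorted leq (large theta gs) by apply: sort_sorted; exact: leq_total.
have t0 : (0 < t)%N by rewrite -sz lt0n size_eq0.
have [[j hj]|h] := not_fillable s ln0 (nf _ (leqnn _)).
  set theta' := (2 ^ j * Y + 2)%N in hj.
  have th : (theta <= theta')%N.
    have /hasP [e e1 e2] : has (gtn theta') (large theta gs) by rewrite has_count (leq_trans _ hj).
    apply: ltnW; apply: leq_ltn_trans e2.
    by move: e1; rewrite mem_sort mem_filter => /andP[].
  have [] := key _ th; set j' := count _ _ in hj *; set t' := count _ gs => et hY.
  have hN : (t' < N)%N by move: et tN hj; clear; lia.
  have := IH _ hN (fun x h => nf x (leq_trans th h)); rewrite -/t'; set Y' := load _ _ _ in hY *.
  move=> h; have j'0 : (0 < j')%N by exact: leq_trans hj.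
  have e2 : (2 ^ j <= 2 ^ j'.-1)%N by rewrite leq_exp2l // -ltnS prednK.
  have e3 : (2 ^ j' = 2 * 2 ^ j'.-1)%N by rewrite -expnS prednK.
  (* Each gap given up has length at most [2 ^ j * Y + 1] with [j <= j' - 1]; the term [+ 1] is paid
     by the arcs that are no longer counted. *)
  have hY2 : (2 * Y' <= Y * (2 + j' * 2 ^ j'))%N.
    have : (j' * theta'.-1 <= j' * (2 ^ j'.-1 * Y + 1))%N.
      by rewrite leq_mul2l /theta' addn2 /= addn1 ltnS leq_mul2r e2 !orbT.
    by move: hY; rewrite e3; move: (2 ^ _)%N => x; move: (j' * _)%N => y; clear; nia.
  have := expn_bound1 j'0; rewrite et -addSn !expnD.
  move: h hY2; clear.
  move: (2 ^ j')%N (5 ^ j')%N (2 ^ t'.+1)%N (5 ^ t'.+1)%N (k + sumn gs)%N => a b c d n h h1 h2.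
  rewrite -(leq_pmul2l (isT : 0 < 2)%N).
  apply: (@leq_trans (2 * a * (d * Y')))%N.
    by apply: leq_trans (leq_mul (leqnn (2 * a)) h); rewrite leq_eqVlt; apply/orP; left; apply/eqP; ring.
  apply: (@leq_trans (a * d * (Y * (2 + j' * a))))%N.
    by apply: leq_trans (leq_mul (leqnn (a * d)) h1); rewrite leq_eqVlt; apply/orP; left; apply/eqP; ring.
  apply: (@leq_trans (d * Y * (2 * b)))%N.
    by apply: leq_trans (leq_mul (leqnn (d * Y)) h2); rewrite leq_eqVlt; apply/orP; left; apply/eqP; ring.
  by rewrite leq_eqVlt; apply/orP; left; apply/eqP; ring.
have sg : (sumn gs <= sumn [seq g <- gs | (g < theta)%N] + t * (3 * 2 ^ t.-1 * Y + 1))%N.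
  have -> : sumn gs = (sumn [seq g <- gs | (g < theta)%N] + sumn (large theta gs))%N.
    rewrite /large (perm_sumn (permEl (perm_sort _ _))) -sumn_cat; apply: perm_sumn.
    rewrite -(permPl (permEl (perm_filterC (gtn theta) gs))) perm_cat2l.
    by rewrite (@eq_filter _ (predC (gtn theta)) (leq theta)) // => g /=; rewrite -leqNgt.
  rewrite sz in h; rewrite leq_add2l -{1}sz; move: h; elim: (large theta gs) => //= g bs IHb /andP[h1 /IHb h2].
  by rewrite (mulSn (size bs)); apply: leq_add; rewrite // -ltnS addn1 -addn2.
have := expn_bound2 t0.
have e3 : (2 ^ t = 2 * 2 ^ t.-1)%N by rewrite -expnS prednK.
rewrite [(2 ^ t.+1)%N]expnS.
move: sg nY; rewrite e3; move: (2 ^ t.-1)%N (5 ^ _)%N (sumn _) (sumn gs) => a b c n h1 h2 h3.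
have h4 : (k + n <= Y * (1 + 3 * t * a))%N by move: h1 h2; clear; nia.
apply: (@leq_trans (2 * (2 * a) * (Y * (1 + 3 * t * a))))%N; first by rewrite leq_mul2l h4 orbT.
apply: (@leq_trans (2 * a * (2 + 3 * t * (2 * a)) * Y))%N.
  by rewrite leq_eqVlt; apply/orP; left; apply/eqP; ring.
by rewrite leq_mul2r h3 orbT.
Qed.

(** At [k = 2] the inequality fails, [875] against [864], so that case needs a separate argument. *)
Lemma sixth_powers k : 2 < k -> 5 ^ k.+1 * (3 * k + 1) < 6 ^ k.+1 * (k + 2).
Proof.
elim: k => // k IH; rewrite leq_eqVlt => /predU1P[[<-]//|]; rewrite ltnS => k2.
have := IH k2; rewrite (expnS 5 k.+1) (expnS 6 k.+1).
move: (5 ^ k.+1) (6 ^ k.+1) => x y; move: k2; clear; nia.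
Qed.

Lemma expn_3_17 n : 3 ^ 3 * 4 <= n -> 3 ^ 17 <= n ^ 4.
Proof.
move=> h; have : (3 ^ 3 * 4) ^ 4 <= n ^ 4 by rewrite leq_exp2r.
rewrite expnMn -expnM; apply: leq_trans.
have -> : 17 = 3 * 4 + 5 by [].
by rewrite expnD leq_mul2l; apply/orP; right.
Qed.

(** The assumption on [a] and [b] says [n >= 3 ^ k.+1 * log3 n] without logarithms, [a / b] running
    over the rational lower bounds of [log3 n]. Each bound obtained for [n] is fed back to get a
    better one. *)
Lemma gap_choice k n gs : 0 < k -> size gs = k -> n = k + sumn gs ->
  (forall a b, 3 ^ a <= n ^ b -> 3 ^ k.+1 * a <= n * b) -> 3 <= n ->
  exists theta, fillable (load k theta gs) (large theta gs).
Proof.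
move=> k0 sz en H n3; apply: contrapT => /forallNP nf.
have L1 : 3 ^ k.+1 <= n by have := H 1 1; rewrite !expn1 !muln1; exact.
have L2 : 3 ^ k.+1 * k.+1 <= n by have := H k.+1 1; rewrite expn1 muln1; exact.
have [k1|k1] := eqVneq k 1.
  (* Here [n >= 18], so the only gap has at least 17 vertices; with load 4 it needs 14. *)
  case: gs sz en nf => [|g [|]]; rewrite k1 // => _ en nf; apply: (nf 0) => /=.
  move: L2 en; rewrite k1; clear; rewrite /load /=; change (3 ^ 2) with 9; lia.
have bnd : 2 ^ k.+1 * n <= 5 ^ k.+1 * (3 * k + 1).
  have := @not_fillable_bound k 0 gs (fun x _ => introN idP (nf x)).
  rewrite -en (_ : count _ gs = k); last by rewrite -sz; apply/eqP; rewrite -all_count; apply/allP.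
  rewrite /load (_ : [seq g <- gs | g < 0] = [::]); last by elim: (gs).
  rewrite (_ : count _ gs = k); last by rewrite -sz; apply/eqP; rewrite -all_count; apply/allP.
  by rewrite addn0 -mulSn.
have k_gt1 : 1 < k by move: k0 k1; clear; lia.
have L3 : 3 ^ k.+1 * k.+2 <= n.
  have := H k.+2 1; rewrite expn1 muln1; apply; apply: leq_trans L2.
  by rewrite (expnS 3 k.+1) mulnC leq_mul2l; apply/orP; right; exact: k_gt1.
have [k2|k2] := eqVneq k 2.
  (* [bnd] gives [n <= 109] and [L3] gives [n >= 108]. Since [108 ^ 4 >= 3 ^ 17], the logarithm is
     at least [17 / 4], which improves the lower bound to 115. *)
  have n108 : 3 ^ 17 <= n ^ 4 by apply: expn_3_17; apply: leq_trans L3; rewrite k2.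
  have := H _ _ n108; move: bnd; rewrite k2; clear; change (5 ^ 3) with 125.
  change (2 ^ 3) with 8; change (3 ^ 3) with 27; lia.
have {}k2 : 2 < k by move: k_gt1 k2; clear; lia.
have := sixth_powers k2; rewrite ltnNge => /negP; apply; apply: leq_trans bnd.
by rewrite (expnMn 2 3) -mulnA leq_mul2l addn2 L3 orbT.
Qed.

End Gaps.

(** * The logarithmic hypothesis as inequalities between natural numbers *)

Section Logarithm.
Variable R : realType.

(** From [n >= 3] follows [log3 n >= 1], so the iterated logarithm is taken of a positive number and
    the hypothesis may be exponentiated. *)
Lemma log3_bound k n : (3 <= n)%N ->
  k%:R <= log3 (n%:R : R) - log3 (log3 (n%:R : R)) - 1 ->
  forall a b, (3 ^ a <= n ^ b)%N -> (3 ^ k.+1 * a <= n * b)%N.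
Proof.
move=> n3 hP a b ab.
have n0 : 0 < n%:R :> R by rewrite ltr0n; apply: leq_trans n3.
have l3 : 0 < ln 3 :> R by rewrite ln_gt0 // ltr1n.
have t0 : 0 < 3 :> R by [].
set L := log3 (n%:R : R) in hP.
have eL : ln n%:R = L * ln 3 by rewrite /L /log3 divfK // gt_eqF.
have L1 : 1 <= L by rewrite /L /log3 ler_pdivlMr // mul1r ler_ln ?posrE // ler_nat.
have L0 : 0 < L by apply: lt_le_trans L1.
have aL : a%:R <= L * b%:R.
  have : ln ((3 : R) ^+ a) <= ln (n%:R ^+ b).
    by rewrite ler_ln ?posrE ?exprn_gt0 // -!natrX ler_nat.
  by rewrite !lnXn // -(mulr_natl (ln 3)) -(mulr_natl (ln n%:R)) eL mulrA ler_pM2r // mulrC.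
have key : 3 ^+ k.+1 * L <= n%:R.
  have p0 : 0 < 3 ^+ k.+1 :> R by rewrite exprn_gt0.
  rewrite -[_ <= _]ler_ln ?posrE //; last by rewrite mulr_gt0.
  rewrite lnM ?posrE // lnXn // -(mulr_natl (ln 3)).
  have -> : ln L = log3 L * ln 3 by rewrite /log3 divfK // gt_eqF.
  rewrite eL -mulrDl ler_pM2r // -natr1; move: hP; lra.
rewrite -(ler_nat R) !natrM natrX.
apply: (@le_trans _ _ (3 ^+ k.+1 * (L * b%:R))).
  by rewrite ler_pM2l ?exprn_gt0.
by rewrite mulrA ler_wpM2r.
Qed.

End Logarithm.

(** * Polygons as lists of vertices *)

Section VertexLists.
Variable R : realType.
Notation pt := (R * R)%type.
Implicit Types (a b p q u w x y z : pt) (l K : seq pt) (i j k : nat) (s t : R).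

Lemma supp_nth l z : supp l z <->
  (exists2 i, (i.+1 < size l)%N & seg (nth 0 l i) (nth 0 l i.+1) z) \/
  (size l = 1%N /\ z = nth 0 l 0).
Proof.
elim: l => [|x [|y l] IH].
- by split=> [[]|[[i]|[]]].
- by split=> [->|[[i]|[_ ->]]] //; right.
- rewrite supp_cons IH; split.
    move=> [h|[[i i1 h]|[s1 ->]]]; left; [by exists 0%N|by exists i.+1|].
    by exists 0%N => //=; exact: seg_r.
  move=> [[[|i] i1 h]|[]] //; first by left.
  by right; left; exists i.
Qed.

Lemma simple_nth l : simple l <->
  (forall i, (i.+1 < size l)%N -> nth 0 l i <> nth 0 l i.+1) /\
  (forall i j z, (i < j)%N -> (j.+1 < size l)%N -> seg (nth 0 l i) (nth 0 l i.+1) z ->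
     seg (nth 0 l j) (nth 0 l j.+1) z -> j = i.+1 /\ z = nth 0 l j).
Proof.
elim: l => [|x [|y l] IH]; [by split|by split=> // _; split=> // i [|j]|].
split=> [[xy h /IH [h1 h2]]|[h1 h2]].
  split=> [[|i]|[|i] [|j] z] //; first exact: h1.
    move=> _ jl zx zj; have zy : z = y.
      by apply: h => //; apply/supp_nth; left; exists j.
    case: j jl zj => // j jl zj; exfalso; rewrite zy in zj.
    have [j0 yz] := h2 0%N j.+1 y isT jl (seg_l _ _) zj.
    by case: j0 yz jl => -> yz jl; exact: (h1 0%N (ltnW jl)).
  by move=> ij jl zi zj; have [-> ->] := h2 i j z ij jl zi zj.
split; first exact: (h1 0%N).
- move=> z zx /supp_nth [[j jl zj]|[l0 ->]] //.
  by have [[->] ->] := h2 0%N j.+1 z isT jl zx zj.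
- apply/IH; split=> [i|i j z ij jl zi zj]; first exact: (h1 i.+1).
  by have [[->] ->] := h2 i.+1 j.+1 z ij jl zi zj.
Qed.

End VertexLists.

Section Polygon.
Variables (R : realType) (n : nat).
Notation pt := (R * R)%type.
Implicit Types (Q : 'I_n -> pt) (z : pt) (K : seq pt).
Hypothesis n3 : (3 <= n)%N.

Lemma nth_vertices Q (i : 'I_n) : nth 0 [seq Q i | i <- enum 'I_n] i = Q i.
Proof. by rewrite (nth_map i) ?nth_ord_enum // size_enum_ord. Qed.

Lemma val_ordS (i : 'I_n) : val (ordS i) = if (i.+1 < n)%N then i.+1 else 0%N.
Proof.
rewrite /=; case: ltnP => h; first by rewrite modn_small.
by have -> : i.+1 = n; [apply/eqP; rewrite eqn_leq ltn_ord|rewrite modnn].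
Qed.

Lemma csimple_vertices Q : simple_closed Q -> csimple [seq Q i | i <- enum 'I_n].
Proof.
move=> sQ; set L := map _ _.
have szL : size L = n by rewrite size_map size_enum_ord.
have Lv (i : 'I_n) : nth 0 L i = Q i by exact: nth_vertices.
have Ln i (h : (i < n)%N) : nth 0 L i = Q (Ordinal h) by rewrite -Lv.
have Ls i (h : (i.+1 < n)%N) : nth 0 L i.+1 = Q (ordS (Ordinal (ltnW h))).
  by rewrite -Lv val_ordS /= h.
have nQ := vertex_neq sQ; have mQ := edge_meet sQ.
have n0 : (0 < n)%N by exact: leq_trans n3.
have n1 : (n.-1 < n)%N by rewrite prednK.
have last0 : ordS (Ordinal n1) = Ordinal n0 by apply: val_inj; rewrite val_ordS /= prednK // ltnn.
have e0 : nth 0 L 0 = Q (Ordinal n0) by rewrite Ln.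
have e1 : nth 0 L n.-1 = Q (Ordinal n1) by rewrite Ln.
have sL : simple L.
  apply/simple_nth; rewrite szL; split=> [i h|i j z ij h].
    rewrite (Ls _ h) (Ln _ (ltnW h)); apply: nQ; rewrite eq_sym; exact: ordS_neq.
  have h' := leq_ltn_trans ij (ltnW h).
  rewrite (Ls _ h) (Ln _ (ltnW h)) (Ls _ h') (Ln _ (ltnW h')) => zi zj.
  case: (mQ _ _ z _ zi zj) => [|[/(congr1 val) + ->]|[/(congr1 val) + _]].
  - by apply/eqP => /(congr1 val) /= e; rewrite e ltnn in ij.
  - by rewrite val_ordS /= h'.
  - by rewrite val_ordS /= h => e; move: ij; rewrite e; clear; lia.
have suppL z : supp L z -> exists (i : 'I_n), (i.+1 < n)%N /\ seg (Q i) (Q (ordS i)) z.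
  move=> /supp_nth; rewrite szL => -[[i h]|[e _]]; last by move/eqP: e; rewrite gtn_eqF // ltnW.
  by rewrite (Ls _ h) (Ln _ (ltnW h)) => zi; exists (Ordinal (ltnW h)).
have [x [l eL']] : exists x l, L = x :: l.
  by case: (L) szL => [e|x l _]; [move: n3; rewrite -e|exists x, l].
rewrite eL'.
have ex : x = Q (Ordinal n0) by rewrite -e0 eL'.
have el : last x l = Q (Ordinal n1).
  by rewrite -e1 -szL nth_last eL'.
split; first by rewrite -eL'.
- rewrite el ex; apply: nQ; apply/eqP => /(congr1 val) /=; move: n3; clear; lia.
- rewrite el -eL' ex => z; rewrite -last0 => zl /suppL [i [h zi]].
  case: (mQ i (Ordinal n1) z _ zi zl) => [|[_ ->]|[-> ->]]; [|by left|by right].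
  by apply/eqP => /(congr1 val) /= e; move: h; rewrite e prednK // ltnn.
Qed.

Definition vertex K (i : 'I_n) : pt := nth 0 K i.

Lemma vertexS K (i : 'I_n) : size K = n ->
  vertex K (ordS i) = if (i.+1 < n)%N then nth 0 K i.+1 else nth 0 K 0.
Proof. by rewrite /vertex val_ordS; case: ifP. Qed.

Lemma boundary_vertex K z : size K = n -> boundary (vertex K) z <-> csupp K z.
Proof.
move=> szK; have [x [l eK]] : exists x l, K = x :: l.
  by case: (K) szK => [e|x l _]; [move: n3; rewrite -e|exists x, l].
have el : last x l = nth 0 K n.-1 by rewrite -szK nth_last eK.
have -> : csupp K z <-> supp K z \/ seg (nth 0 K n.-1) (nth 0 K 0) z by rewrite {1 2}eK /csupp el eK.
have n0 : (0 < n)%N by exact: leq_trans n3.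
have n1 : (n.-1 < n)%N by rewrite prednK.
split.
  move=> [i [t [t01 ->]]].
  have H : seg (vertex K i) (vertex K (ordS i)) (edge_pt (vertex K) i t) by exists t.
  move: H; set y := edge_pt _ _ _; rewrite vertexS //; case: ltnP => h H.
    by left; apply/supp_nth; left; exists i; rewrite ?szK.
  right; have <- : val i = n.-1; last exact: H.
  by move: h (ltn_ord i); clear; rewrite /=; lia.
move=> [/supp_nth|H].
  rewrite szK => -[[i h H]|[e _]]; last by move/eqP: e; rewrite gtn_eqF // ltnW.
  apply: (@boundary_edge R n (vertex K) (Ordinal (ltnW h))).
  by rewrite vertexS //= h.
by apply: (@boundary_edge R n (vertex K) (Ordinal n1)); rewrite vertexS //= prednK // ltnn.
Qed.

(** A common point of two half-open edges [i < j] would be the end of edge [i], which is excluded.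
    If [j] is the closing edge, the point is the last vertex; it lies on the edge before [j], so [i]
    must be that edge. *)
Lemma simple_closed_vertex K : size K = n -> csimple K -> simple_closed (vertex K).
Proof.
move=> szK; have [x [l eK]] : exists x l, K = x :: l.
  by case: (K) szK => [e|x l _]; [move: n3; rewrite -e|exists x, l].
have el : last x l = nth 0 K n.-1 by rewrite -szK nth_last eK.
have ex : x = nth 0 K 0 by rewrite eK.
rewrite {1}eK => -[]; rewrite el -eK ex => /simple_nth; rewrite szK => -[h1 h2] lx h3.
have neq (i : 'I_n) : vertex K i <> vertex K (ordS i).
  rewrite vertexS //; case: ltnP => h; first exact: h1.
  by rewrite /vertex; have -> : val i = n.-1; [move: h (ltn_ord i); clear; rewrite /=; lia|].
have seg_pt (i : 'I_n) t : 0 <= t < 1 -> seg (vertex K i) (vertex K (ordS i)) (edge_pt (vertex K) i t).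
  by move=> /andP[t0 t1]; exists t => //; rewrite t0 ltW.
have end_pt (i : 'I_n) t : t < 1 -> edge_pt (vertex K) i t <> vertex K (ordS i).
  move=> t1 e; have := @lp_inj _ _ _ t 1 (neq i); rewrite lp1 => /(_ e) t1'.
  by rewrite t1' ltxx in t1.
have key (i j : 'I_n) s t : 0 <= s < 1 -> 0 <= t < 1 ->
    edge_pt (vertex K) i s = edge_pt (vertex K) j t -> (i < j)%N -> False.
  move=> s01 t01 e ij; have [_ s1] := andP s01; have [_ t1] := andP t01.
  have iS : (i.+1 < n)%N by exact: leq_ltn_trans ij (ltn_ord j).
  have zi := seg_pt i s s01; have zj := seg_pt j t t01.
  have ni := end_pt i s s1; have nj := end_pt j t t1.
  rewrite -e in zj nj; move: (edge_pt _ i s) zi zj ni nj => z {e}.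
  rewrite !vertexS // iS; case: ltnP => jS zi zj ni nj.
    have [e1 e2] := h2 i j z ij jS zi zj.
    by apply: ni; rewrite e2 e1.
  have ej : val j = n.-1 by move: jS (ltn_ord j); clear; rewrite /=; lia.
  rewrite /vertex ej in zj.
  have zK : supp K z by apply/supp_nth; left; exists i; rewrite ?szK.
  have [ez|//] := h3 z zj zK.
  have [n2 n2'] : (n.-2.+1 < n)%N /\ n.-2.+1 = n.-1 by move: n3; clear; lia.
  have zn : seg (nth 0 K n.-2) (nth 0 K n.-2.+1) z by rewrite n2' ez; exact: seg_r.
  case: (ltnP i n.-2) => hi.
    have [_ ez'] := h2 i n.-2 z hi n2 zi zn.
    by apply: (h1 n.-2 n2); rewrite n2' -ez' ez.
  apply: ni; rewrite ez; congr (nth 0 K _).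
  by move: hi ij ej n3; clear; rewrite /=; lia.
move=> i j s t s01 t01 e; case: (ltngtP i j) => [ij|ji|/val_inj ij].
- by case: (key i j s t s01 t01 e ij).
- by case: (key j i t s t01 s01 (esym e) ji).
- by split=> //; rewrite -ij in e; exact: (lp_inj (neq i) e).
Qed.

Lemma nth_rot (T : Type) (x0 : T) (l : seq T) j i : (i < size l)%N -> (j <= size l)%N ->
  nth x0 (rot j l) i = nth x0 l ((j + i) %% size l).
Proof.
move=> il jl; rewrite /rot nth_cat size_drop; case: ltnP => h.
  by rewrite nth_drop modn_small //; move: h; clear; lia.
have -> : (j + i = size l + (i - (size l - j)))%N by move: h jl; clear; lia.
by rewrite nth_take ?modnDl ?modn_small //; move: h jl il; clear; lia.
Qed.

Lemma counterclockwise_vertex K : size K = n -> csimple K -> top_turn K ->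
  counterclockwise (vertex K).
Proof.
move=> szK cK [j0 [p [u [w [K' [ej0 [h1 h2] h3 h4]]]]]].
have [j [jK ej]] : exists j, (j < size K)%N /\ rot j K = [:: p, u, w & K'].
  have n0 : (0 < size K)%N by rewrite szK; exact: leq_trans n3.
  case: (ltnP j0 (size K)) => jK; first by exists j0.
  by exists 0%N; split=> //; rewrite rot0 -ej0 rot_oversize.
rewrite szK in jK; pose m := Ordinal jK.
have rotE (i : nat) : (i < n)%N -> nth 0 (rot j K) i = vertex K (iter i (@ordS n) m).
  by move=> h; rewrite /vertex val_iter_ordS nth_rot szK // ltnW.
have e0 : vertex K m = p by have := rotE 0%N (ltnW (ltnW n3)); rewrite ej.
have e1 : vertex K (ordS m) = u by have := rotE 1%N (ltnW n3); rewrite ej.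
have e2 : vertex K (ordS (ordS m)) = w by have := rotE 2%N n3; rewrite ej.
apply: (@ccw_of_inside_left _ _ _ _ _ (ordS m) (1 / 2)) => //.
- exact: simple_closed_vertex.
- by lra.
- apply: (top_inside_left (simple_closed_vertex szK cK) (erefl (ordS m))); rewrite ?e0 ?e1 ?e2 //.
  by move=> z /(boundary_vertex z szK) /h4.
Qed.

End Polygon.

(** * Cutting a realization into arcs and large gaps *)

Section Blocks.
Variable R : realType.
Notation pt := (R * R)%type.
Notation block := (pt * seq pt)%type.
Implicit Types (p : pt) (M : R) (K c A : seq pt) (o : seq (option pt)) (bl : seq block)
  (b : block) (Z : seq (seq pt * seq pt)) (k theta : nat).

(* A block is a specified vertex together with the unspecified vertices that follow it. *)
Definition flat bl : seq pt := flatten [seq b.1 :: b.2 | b <- bl].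

Definition block_pat bl : seq (option pt) :=
  flatten [seq Some b.1 :: nseq (size b.2) None | b <- bl].

Lemma parse o K : agree o K -> exists c bl,
  K = c ++ flat bl /\ o = nseq (size c) None ++ block_pat bl.
Proof.
elim: o K => [|[p|] o IH] [|x K] //; first by exists [::], [::].
  case/andP=> /eqP -> /IH [c [bl [-> ->]]].
  by exists [::], ((p, c) :: bl).
by move=> /IH [c [bl [-> ->]]]; exists (x :: c), bl.
Qed.

Lemma agree_weak c o K : agree (map Some c ++ o) K -> agree (nseq (size c) None ++ o) K.
Proof.
move=> /agree_catE [K1 [K2 [-> + k2]]]; rewrite agree_some => /eqP ->.
by apply: agree_cat => //; rewrite agree_none.
Qed.

Definition gaps bl : seq nat := [seq size b.2 | b <- bl].

(** Gaps below [theta] are absorbed into the arcs with the vertices they have in the realization, so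
    the pattern of [Z] prescribes more than that of the blocks. As the last block has a large gap,
    every arc is followed by one. *)
Lemma group theta bl b : (theta <= size b.2)%N -> exists Z,
  [/\ flatten [seq z.1 ++ z.2 | z <- Z] = flat (rcons bl b),
      forall K, agree (pat [seq (z.1, z.1, size z.2) | z <- Z]) K -> agree (block_pat (rcons bl b)) K,
      [seq size z.2 | z <- Z] = [seq g <- gaps (rcons bl b) | theta <= g]%N,
      (\sum_(z <- Z) size z.1 = (size bl).+1 + sumn [seq g <- gaps (rcons bl b) | g < theta])%N &
      all (fun z => z.1 != [::]) Z].
Proof.
move=> hb; elim: bl => [|[p c] bl [Z [h1 h2 h3 h4 h5]]].
  exists [:: ([:: b.1], b.2)]; split=> //=.
  - by rewrite hb.
  - by rewrite big_seq1 /= ltnNge hb.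
rewrite /= -/(gaps _); case: (leqP theta (size c)) => hc.
  exists (([:: p], c) :: Z); split=> //=.
  - by rewrite h1.
  - case=> [|x K] //= /andP[px /agree_catE [K1 [K2 [-> k1 k2]]]]; apply/andP; split=> //.
    by apply: agree_cat => //; exact: h2.
  - by rewrite h3.
  - by rewrite big_cons h4.
case: Z h1 h2 h3 h4 h5 => [|[A c'] Z] h1 h2 h3 h4 h5.
  by move/(congr1 size): h3; rewrite /gaps map_rcons filter_rcons hb size_rcons.
exists ((p :: c ++ A, c') :: Z); split=> //.
- rewrite -cat_cons /= -!catA; congr (_ :: _ ++ _); exact: etrans (catA _ _ _) h1.
- case=> [|x K] //= /andP[px]; rewrite map_cat -catA -catA => /agree_weak.
  move=> /agree_catE [K1 [K2 [-> k1 k2]]]; apply/andP; split=> //.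
  by apply: agree_cat => //; apply: h2; rewrite /pat /= -catA.
- by move: h4; rewrite !big_cons /= size_cat; clear; lia.
- by case/andP: h5.
Qed.

(** Even an empty gap leaves an edge between two consecutive arcs, so [simple_disj] applies. *)
Lemma disjoint_arcs Z : simple (flatten [seq z.1 ++ z.2 | z <- Z]) ->
  all (fun z => z.1 != [::]) Z ->
  pairwise_disjoint [seq z.1 | z <- Z] /\
  {in Z, forall z, simple z.1 /\
    forall x, supp z.1 x -> supp (flatten [seq z.1 ++ z.2 | z <- Z]) x}.
Proof.
elim: Z => [|[A c] Z IH] //= sZ /andP[A0 hZ].
have sZ' := simple_suffix sZ; have [h1 h2] := IH sZ' hZ.
have sA : simple A by move: sZ; rewrite -catA => /simple_prefix.
have S x : supp A x -> supp ((A ++ c) ++ flatten [seq z.1 ++ z.2 | z <- Z]) x.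
  by rewrite -catA => h; apply: supp_cat; left.
split; last first.
  move=> z; rewrite inE => /predU1P[-> //|/h2 [k1 k2]]; split=> // x /k2 h.
  by apply: supp_cat; right.
split=> // F /mapP [z zZ ->] x xA /(h2 _ zZ).2 xZ.
have : supp (c ++ flatten [seq z.1 ++ z.2 | z <- Z]) x by apply: supp_cat; right.
move: sZ; rewrite -catA; case: (c ++ _) => // y l.
case/lastP: (A) A0 xA => // m a _ xA; rewrite cat_rcons => /simple_disj; exact.
Qed.

(* [o] can be completed to a polygon whose vertices reach the height [M]. *)
Definition completable o M : Prop :=
  exists K, [/\ agree o K, csimple K, top_turn K & exists2 z, z \in K & M <= z.2].

Lemma completable_rot o1 o2 M : completable (o1 ++ o2) M -> completable (o2 ++ o1) M.
Proof.
move=> [K [/agree_catE [K1 [K2 [-> k1 k2]]] h1 h2 [z zK zM]]].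
exists (K2 ++ K1); split.
- exact: agree_cat.
- by have [] := csimple_rot h1.
- exact: top_turn_rot.
- by exists z => //; move: zK; rewrite !mem_cat orbC.
Qed.

Lemma flat_cat bl1 bl2 : flat (bl1 ++ bl2) = flat bl1 ++ flat bl2.
Proof. by rewrite /flat map_cat flatten_cat. Qed.

Lemma block_pat_cat bl1 bl2 : block_pat (bl1 ++ bl2) = block_pat bl1 ++ block_pat bl2.
Proof. by rewrite /block_pat map_cat flatten_cat. Qed.

(** [fillable] fails on an empty list, so a large gap exists; a rotation puts it at the end, as
    [group] requires. *)
Lemma completable_blocks bl theta M : csimple (flat bl) ->
  fillable (load (size bl) theta (gaps bl)) (large theta (gaps bl)) -> completable (block_pat bl) M.
Proof.
move=> sbl fbl.
have : has (fun b : block => theta <= size b.2)%N bl.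
  apply/negPn/negP => h; move: fbl; rewrite /large (_ : [seq g <- gaps bl | (theta <= g)%N] = [::]) //.
  by apply/eqP; rewrite -size_eq0 size_filter eqn0Ngt -has_count has_map.
move=> hs; case/split_find: hs sbl fbl => b bl1 bl2 hb _ sbl fbl.
rewrite block_pat_cat; apply: completable_rot; rewrite -block_pat_cat -rcons_cat.
set bl' := bl2 ++ bl1.
have perm_bl : perm_eq (rcons bl1 b ++ bl2) (rcons bl' b) by rewrite perm_catC rcons_cat.
have perm_g : perm_eq (gaps (rcons bl1 b ++ bl2)) (gaps (rcons bl' b)) by exact: perm_map.
have sbl' : simple (flat (rcons bl' b)).
  rewrite rcons_cat flat_cat; move: sbl; rewrite flat_cat => /csimple_rot [+ _].
  by case: (_ ++ _) => // x l [].
have [Z [h1 h2 h3 h4 h5]] := group bl' hb.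
rewrite -h1 in sbl'; have [dZ sZ] := disjoint_arcs sbl' h5.
pose X := [seq (z.1, z.1, size z.2) | z <- Z].
have [||||K [k1 k2 k3 k4]] := @draw R (large theta (gaps (rcons bl1 b ++ bl2))) X
  (load (size (rcons bl1 b ++ bl2)) theta (gaps (rcons bl1 b ++ bl2))) M _ fbl.
- rewrite /large perm_sort -map_comp h3; exact: perm_filter.
- rewrite big_map /= size_map h4 /load (perm_size perm_bl) size_rcons.
  have -> : size Z = count (leq theta) (gaps (rcons bl1 b ++ bl2)).
    by rewrite (permP perm_g) -size_filter -h3 size_map.
  by rewrite (perm_sumn (perm_filter _ perm_g)).
- move=> _ /mapP [[[|a n] c] zZ ->] /=; first by have := allP h5 _ zZ.
  by exists a, n, n; split=> //; have [] := sZ _ zZ.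
- by rewrite -map_comp.
by exists K; split=> //; exact: h2.
Qed.

End Blocks.

(** * From completed patterns to realizations of arbitrary height *)

Section Realizations.
Variables (R : realType) (n : nat).
Hypothesis n3 : (3 <= n)%N.
Notation pt := (R * R)%type.
Implicit Types (P : 'I_n -> option pt) (Q : 'I_n -> pt) (M t : R) (o : seq (option pt)).

(** Without specified vertices there is no arc to start from. A triangle with a vertical right edge
    is used, and all further vertices are placed on its edge from [u] to [w]. *)
Lemma completable_free M : completable (nseq n (@None pt)) M.
Proof.
pose p : pt := (0, M); pose u : pt := (0, M + 1); pose w : pt := (-1, M).
have uw : u <> w by move=> /pair_equal_spec [/eqP]; rewrite eq_sym oppr_eq0 oner_eq0.
have suw : simple [:: u; w] by split=> // z.
have [y [l [szl sl Sl ly [t t01 ey]]]] := @pad R u w [::] (n - 3) suw.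
have pu z : seg p u z -> z.1 = 0 /\ M <= z.2 <= M + 1.
  by move=> /segP [s [s01 -> ->]] /=; split; [ring|lra].
have su z : supp [:: u, y & l] z -> [/\ -1 <= z.1 <= 0, z.2 = M + 1 + z.1 & True].
  move=> /Sl [/segP [s [s01 -> ->]] /=|-> /=]; split=> //; lra.
have wp z : seg w p z -> z.2 = M by move=> /segP [s [s01 _ ->]] /=; ring.
have sK : simple [:: p, u, y & l].
  split=> //; first by move=> /pair_equal_spec [_]; lra.
  by move=> z /pu [h1 h2] /su [h3 h4 _]; apply: ptP; rewrite /u /=; lra.
exists [:: p, u, y & l]; split.
- by rewrite agree_none /= szl; apply/eqP; move: n3; clear; rewrite /=; lia.
- split=> //=; rewrite ly /=; first by move=> /pair_equal_spec [/eqP]; rewrite oppr_eq0 oner_eq0.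
  move=> z /wp z2 [/pu [h1 _]|/su [_ h _]]; [right|left]; apply: ptP; rewrite /p /w /= ?h1 //; lra.
- exists 0%N, p, u, y, l; rewrite rot0; split=> //.
  + by split=> //=; lra.
  + by rewrite ey lpE1 /=; lra.
  + by move=> z /= [[/pu [_ h]|/su [h1 h2 _]]|]; [lra|lra|rewrite ly => /wp ->; lra].
- by exists p; rewrite ?inE ?eqxx.
Qed.

Lemma agree_map (T : Type) (f : T -> option pt) (g : T -> pt) (s : seq T) :
  (forall i p, f i = Some p -> g i = p) -> agree (map f s) (map g s).
Proof.
move=> h; elim: s => //= i s IH; rewrite /agree /= -/(agree _ _) IH andbT.
by case e: (f i) => [p|//]; rewrite (h _ _ e).
Qed.

Lemma agree_nth o (K : seq pt) i p : agree o K -> nth None o i = Some p -> nth 0 K i = p.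
Proof.
elim: o K i => [|q o IH] [|x K] [|i] //= /andP[h k]; last exact: IH.
by move=> e; move: h; rewrite e => /eqP.
Qed.

Lemma agree_size o (K : seq pt) : agree o K -> size K = size o.
Proof. by rewrite /agree all2E => /andP[/eqP]. Qed.

Lemma realize P M : completable [seq P i | i <- enum 'I_n] M ->
  exists Q, realization P Q /\ exists2 z, boundary Q z & M <= z.2.
Proof.
move=> [K [aK cK tK [z zK zM]]].
have szK : size K = n by rewrite (agree_size aK) size_map size_enum_ord.
exists (vertex K); split; last first.
  exists z => //; apply/(boundary_vertex n3 z szK).
  by case: (K) zK => // x l zK; left; exact: supp_mem.
split; first split=> //.
- exact: simple_closed_vertex.
- exact: counterclockwise_vertex.
- move=> i p e; apply: (agree_nth aK).
  by rewrite (nth_map i) ?nth_ord_enum // size_enum_ord.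
Qed.

Lemma size_blocks (bl : seq (pt * seq pt)) : size (block_pat bl) = (size bl + sumn (gaps bl))%N.
Proof.
elim: bl => //= b bl IH; rewrite -/(block_pat bl) size_cat IH /= size_nseq; clear; lia.
Qed.

Lemma count_blocks (bl : seq (pt * seq pt)) : count isSome (block_pat bl) = size bl.
Proof.
elim: bl => //= b bl IH; rewrite -/(block_pat bl) count_cat IH count_nseq.
by rewrite mul0n.
Qed.

Lemma completable_description P M : (exists Q, realization P Q) ->
  (num_specified P)%:R <= log3 (n%:R : R) - log3 (log3 (n%:R : R)) - 1 :> R ->
  completable [seq P i | i <- enum 'I_n] M.
Proof.
move=> [Q [[_ sQ _] PQ]] hP; set o := map _ _.
have cL := csimple_vertices n3 sQ; set L := map _ _ in cL.
have aL : agree o L by exact: agree_map.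
have szo : size o = n by rewrite size_map size_enum_ord.
have ko : count isSome o = num_specified P.
  rewrite /num_specified cardE /enum_mem size_filter count_map -enumT.
  by apply: eq_count => i /=; rewrite /in_mem /=; case: (P i).
have [hS|/hasPn hN] := boolP (has isSome o); last first.
  suff -> : o = nseq n None by exact: completable_free.
  by rewrite -szo; apply/all_pred1P/allP => q /hN; case: q.
(* Rotated to start with a specified vertex, the pattern consists of blocks only. *)
have [x [r1 [r2 eo]]] : exists x r1 r2, o = r1 ++ Some x :: r2.
  by case/split_find: hS => q o1 o2; case: q => // p _ _; exists p, o1, o2; rewrite cat_rcons.
rewrite eo; apply: completable_rot.
rewrite eo in aL; have [L1 [L2 [eL a1 a2]]] := agree_catE aL.
have aL' : agree ((Some x :: r2) ++ r1) (L2 ++ L1) by exact: agree_cat.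
rewrite eL in cL; have [{}cL _] := csimple_rot cL.
have [[|y c] [bl [eK eo']]] := parse aL'; last by [].
have {}eo' : (Some x :: r2) ++ r1 = block_pat bl := eo'.
have {}eK : L2 ++ L1 = flat bl := eK.
have po : perm_eq o (block_pat bl) by rewrite -eo' eo perm_catC.
have kb : size bl = num_specified P by rewrite -count_blocks -(permP po).
rewrite eo'; rewrite eK in cL.
have [|||||theta h] := @gap_choice (size bl) n (gaps bl).
- by rewrite -count_blocks -eo' /=.
- by rewrite size_map.
- by rewrite -size_blocks -(perm_size po).
- by rewrite kb; exact: (log3_bound n3 hP).
- by [].
exact: completable_blocks cL h.
Qed.

End Realizations.

Theorem corollary3p4 (R : realType) (n : nat) (P : 'I_n -> option (R * R))
    (hn : (3 <= n)%N)
    (hP : (num_specified P)%:R <=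
          log3 (n%:R : R) - log3 (log3 (n%:R : R)) - 1 :> R) :
  ~ (exists Q : 'I_n -> R * R, realization P Q) \/ unbounded_description P.
Proof.
have [hQ|] := pselect (exists Q, realization P Q); last by left.
right=> -[B [[M [_ bM]] hB]].
(* [bounded_set] bounds norms by every number above [M], here [M + 1]; a height of [M + 2] exceeds
   it. *)
have [Q [PQ [z bz zM]]] := realize hn (completable_description hn (M + 2) hQ hP).
have : `|z| <= M + 1 by apply: (bM (M + 1)); [lra|apply: (hB Q PQ); left].
have : `|z.2| <= `|z| by rewrite prod_normE le_max lexx orbT.
have := ler_norm z.2; lra.
Qed.
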